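(* For $n=3$, $$\min\{\Phi(S,u):\ S\in\mathcal{C},\ u\in S^*\}=\frac18,$$ and $\Phi(S,u)=\frac18$ with $S\in\mathcal{C}$, $u\in S^*$ if and only if $S$ is an $S^+$-orthant (up to rotation, the intersection of $S^2$ with an orthant) and $u$ is one of its extreme points.
   Context: $\sigma$ is the surface measure on $S^2$, $\omega_3=4\pi$, and $\Phi(S,u)=\frac{2}{\omega_3}\int_S\langle\theta,u\rangle\,d\sigma(\theta)$. A sector is a set $N\cap S^2$ with $N$ a closed convex cone; the dual of a sector $S$ is $S^*=\{y\in S^2:\langle y,x\rangle\ge0\ \forall x\in S\}$; $\mathcal{C}$ is the class of sectors $S$ with $S\supseteq S^*$. An orthant is the image of the nonnegative orthant $\{x_1,x_2,x_3\ge0\}$ under a rotation; an $S^+$-orthant is the intersection of the unit sphere with an orthant, and its extreme points are the three unit vectors along its edges. *)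

(* Defs.v *)
From Stdlib Require Import Reals Lra ClassicalEpsilon.
Open Scope R_scope.

Definition R3 : Type := (R * R * R)%type.
Definition v1 (x : R3) : R := fst (fst x).
Definition v2 (x : R3) : R := snd (fst x).
Definition v3 (x : R3) : R := snd x.
Definition mk3 (a b c : R) : R3 := (a, b, c).

Definition dot (x y : R3) : R := v1 x * v1 y + v2 x * v2 y + v3 x * v3 y.
Definition vadd (x y : R3) : R3 := mk3 (v1 x + v1 y) (v2 x + v2 y) (v3 x + v3 y).
Definition vscale (c : R) (x : R3) : R3 := mk3 (c * v1 x) (c * v2 x) (c * v3 x).
Definition cross (x y : R3) : R3 :=
  mk3 (v2 x * v3 y - v3 x * v2 y) (v3 x * v1 y - v1 x * v3 y) (v1 x * v2 y - v2 x * v1 y).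

Definition on_sphere (x : R3) : Prop := dot x x = 1.

Definition cv3 (s : nat -> R3) (x : R3) : Prop :=
  Un_cv (fun n => v1 (s n)) (v1 x) /\ Un_cv (fun n => v2 (s n)) (v2 x) /\
  Un_cv (fun n => v3 (s n)) (v3 x).

Definition is_closed_set (N : R3 -> Prop) : Prop :=
  forall (s : nat -> R3) (x : R3), (forall n, N (s n)) -> cv3 s x -> N x.

Definition is_convex_cone (N : R3 -> Prop) : Prop :=
  (forall x y, N x -> N y -> N (vadd x y)) /\
  (forall c x, 0 <= c -> N x -> N (vscale c x)).

Definition closed_convex_cone (N : R3 -> Prop) : Prop :=
  is_closed_set N /\ is_convex_cone N.

Definition sector (S : R3 -> Prop) : Prop :=
  exists N, closed_convex_cone N /\ forall x, S x <-> (N x /\ on_sphere x).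

Definition dual (S : R3 -> Prop) (y : R3) : Prop :=
  on_sphere y /\ forall x, S x -> 0 <= dot y x.

Definition classC (S : R3 -> Prop) : Prop :=
  sector S /\ forall y, dual S y -> S y.

(** Surface integral over S^2 : Riemann integral in spherical coordinates
    theta(a,b) = (sin a cos b, sin a sin b, cos a), a in [0,pi], b in [0,2pi],
    with area element sin a da db.  Riemann integrability with value I is
    expressed by convergence of tagged Riemann sums over the uniform n x n
    grids, uniformly in the choice of tags. *)
Definition sph (a b : R) : R3 := mk3 (sin a * cos b) (sin a * sin b) (cos a).

Definition tags_ok (n : nat) (t : nat -> nat -> R * R) : Prop :=
  forall i j, (i < n)%nat -> (j < n)%nat ->
    INR i * PI / INR n <= fst (t i j) <= INR (S i) * PI / INR n /\
    INR j * (2 * PI) / INR n <= snd (t i j) <= INR (S j) * (2 * PI) / INR n.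

Definition riemann_sum (f : R3 -> R) (n : nat) (t : nat -> nat -> R * R) : R :=
  sum_f_R0 (fun i => sum_f_R0 (fun j =>
      f (sph (fst (t i j)) (snd (t i j))) * sin (fst (t i j))) (pred n)) (pred n)
  * (PI / INR n) * (2 * PI / INR n).

Definition is_sphere_integral (f : R3 -> R) (I : R) : Prop :=
  forall eps, 0 < eps -> exists N : nat, forall n t, (N <= n)%nat -> (1 <= n)%nat ->
    tags_ok n t -> Rabs (riemann_sum f n t - I) < eps.

Definition sphere_integral (f : R3 -> R) : R :=
  epsilon (inhabits 0) (is_sphere_integral f).

Definition indicator_mul (S : R3 -> Prop) (g : R3 -> R) (x : R3) : R :=
  if excluded_middle_informative (S x) then g x else 0.

Definition omega3 : R := 4 * PI.

Definition Phi (S : R3 -> Prop) (u : R3) : R :=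
  2 / omega3 * sphere_integral (indicator_mul S (fun th => dot th u)).

(** Rotations: right-handed orthonormal frames (e1,e2,e3) = columns of a
    rotation matrix.  The S^+-orthant of the frame is the intersection of S^2
    with {a e1 + b e2 + c e3 : a,b,c >= 0}; its extreme points are e1,e2,e3. *)
Definition rotation_frame (e1 e2 e3 : R3) : Prop :=
  dot e1 e1 = 1 /\ dot e2 e2 = 1 /\ dot e3 e3 = 1 /\
  dot e1 e2 = 0 /\ dot e1 e3 = 0 /\ dot e2 e3 = 0 /\
  dot (cross e1 e2) e3 = 1.

Definition orthant (e1 e2 e3 : R3) (x : R3) : Prop :=
  exists a b c, 0 <= a /\ 0 <= b /\ 0 <= c /\
    x = vadd (vadd (vscale a e1) (vscale b e2)) (vscale c e3).

Definition splus_orthant (e1 e2 e3 : R3) (x : R3) : Prop :=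
  orthant e1 e2 e3 x /\ on_sphere x.

(* Main.v *)
(* Choose coordinates in which u is the north pole and let r(b) be the polar angle at which the
   meridian of longitude b leaves S; the integral of <theta, u> over S is half of the integral of
   sin^2 r(b).  For four longitudes in quarter-turn position, supporting normals of the cone at the
   four boundary points lie in the dual, hence in S itself, so they pairwise have nonnegative scalar
   products; an elementary inequality for their planar parts shows that the four values of sin^2 r
   add up to at least 1 + their minimum.  Integrating over a quarter turn gives pi / 4.
   In the case of equality some direction leaves S at the pole, so S* contains a horizontal vector n;
   then for longitudes f and f - pi/2 (measured from n) the two values add up to at least
   1 + 3/4 of their product.  So one of them vanishes almost everywhere, and S is an orthant.

   The integral of the statement is handled by sandwiching the discontinuous integrand between C^{1,1}
   functions built from the squared distance to the cone.  For such F, invariance of the spherical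
   coordinate integral under rotations follows by differentiating along the rotations about two of
   the axes: the derivative is the integral of a divergence. *)

Require Import Defs.
From Coquelicot Require Import Coquelicot.
From Stdlib Require Import Reals Lra Lia Psatz Classical ClassicalEpsilon.
Open Scope R_scope.

(** [Phi] takes its value from [epsilon], so nothing is known about it until the integral is shown
    to exist. For this, a cone containing its dual is proved to have an interior direction; along
    the meridians through that direction its boundary layer is thin. Existence thus uses an interior
    pole, the estimate uses the pole [u], and the Riemann sums are tied to a fixed one, which is why
    rotation invariance is indispensable. No differentiation under the integral occurs: the integral
    changes by O(s^2) under a rotation by s, uniformly, hence not at all. The exit angle r(b) is
    never defined. An upper test function only yields numbers dominating sin^2 r(b), and this
    suffices because the inequalities bound sums from below. Strictness also avoids null sets:
    convexity spreads one vector of the cone over a whole interval of longitudes, so the gain does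
    not depend on the test function. The factor 3/4 is 1 - (1/2)^2, where 1/2 bounds the product of
    two slopes. Finally [Phi] is I / (2 pi), so pi / 4 for I means 1/8. *)

Ltac vunfold :=
  unfold dot, cross, vadd, vscale, mk3, v1, v2, v3 in *; simpl in *.

Ltac vdestr :=
  repeat match goal with x : R3 |- _ => destruct x as [[? ?] ?] end.

Ltac vring := intros; vdestr; vunfold; ring.

(** * Vectors of three-dimensional space *)

Definition vsub (x y : R3) : R3 := vadd x (vscale (-1) y).

Definition nrm (x : R3) : R := sqrt (dot x x).

Lemma vec_ext (x y : R3) : v1 x = v1 y -> v2 x = v2 y -> v3 x = v3 y -> x = y.
Proof. vdestr; vunfold; intros; subst; reflexivity. Qed.

Ltac veq := apply vec_ext; unfold vsub; vdestr; vunfold; ring.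

Lemma dot_comm (x y : R3) : dot x y = dot y x.
Proof. vring. Qed.

Lemma dot_vadd_l (x y z : R3) : dot (vadd x y) z = dot x z + dot y z.
Proof. vring. Qed.

Lemma dot_vadd_r (x y z : R3) : dot x (vadd y z) = dot x y + dot x z.
Proof. vring. Qed.

Lemma dot_vscale_l (c : R) (x y : R3) : dot (vscale c x) y = c * dot x y.
Proof. vring. Qed.

Lemma dot_vscale_r (c : R) (x y : R3) : dot x (vscale c y) = c * dot x y.
Proof. vring. Qed.

Lemma dot_vsub_l (x y z : R3) : dot (vsub x y) z = dot x z - dot y z.
Proof. unfold vsub; vring. Qed.

Lemma dot_vsub_r (x y z : R3) : dot x (vsub y z) = dot x y - dot x z.
Proof. unfold vsub; vring. Qed.

Lemma dot_self_nonneg (x : R3) : 0 <= dot x x.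
Proof. vdestr; vunfold; nra. Qed.

Lemma dot_self_eq0 (x : R3) : dot x x = 0 -> x = mk3 0 0 0.
Proof.
  vdestr; vunfold; intros H.
  assert (r * r = 0) by nra. assert (r0 * r0 = 0) by nra. assert (r1 * r1 = 0) by nra.
  repeat f_equal; nra.
Qed.

Lemma nrm_nonneg (x : R3) : 0 <= nrm x.
Proof. apply sqrt_pos. Qed.

Lemma nrm_sqr (x : R3) : nrm x * nrm x = dot x x.
Proof. apply sqrt_sqrt, dot_self_nonneg. Qed.

Lemma Rabs_le_of_sqr (a b : R) : 0 <= b -> a * a <= b * b -> Rabs a <= b.
Proof. intros. apply Rabs_le. nra. Qed.

Lemma le_of_sqr (a b : R) : 0 <= b -> a * a <= b * b -> a <= b.
Proof. intros. nra. Qed.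

Lemma nrm_le (x : R3) (c : R) : 0 <= c -> dot x x <= c * c -> nrm x <= c.
Proof. intros. apply le_of_sqr; auto. rewrite nrm_sqr; auto. Qed.

Lemma cauchy_schwarz_sqr (x y : R3) : dot x y * dot x y <= dot x x * dot y y.
Proof.
  assert (H : dot x x * dot y y - dot x y * dot x y = dot (cross x y) (cross x y)) by vring.
  pose proof (dot_self_nonneg (cross x y)). lra.
Qed.

Lemma cauchy_schwarz (x y : R3) : Rabs (dot x y) <= nrm x * nrm y.
Proof.
  pose proof (nrm_nonneg x). pose proof (nrm_nonneg y).
  apply Rabs_le_of_sqr; [nra|].
  pose proof (cauchy_schwarz_sqr x y).
  replace (nrm x * nrm y * (nrm x * nrm y)) with ((nrm x * nrm x) * (nrm y * nrm y)) by ring.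
  rewrite !nrm_sqr; auto.
Qed.

Lemma nrm_vadd (x y : R3) : nrm (vadd x y) <= nrm x + nrm y.
Proof.
  pose proof (nrm_nonneg x). pose proof (nrm_nonneg y).
  apply nrm_le; [lra|].
  rewrite dot_vadd_l, !dot_vadd_r, (dot_comm y x), <- !nrm_sqr.
  pose proof (cauchy_schwarz x y) as H1. apply Rabs_le_between in H1. nra.
Qed.

Lemma nrm_vscale (c : R) (x : R3) : nrm (vscale c x) = Rabs c * nrm x.
Proof.
  unfold nrm. rewrite dot_vscale_l, dot_vscale_r.
  replace (c * (c * dot x x)) with (Rsqr c * dot x x) by (unfold Rsqr; ring).
  rewrite sqrt_mult_alt, sqrt_Rsqr_abs; auto. apply Rle_0_sqr.
Qed.

Lemma nrm_vsub (x y : R3) : nrm (vsub x y) <= nrm x + nrm y.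
Proof.
  unfold vsub. eapply Rle_trans; [apply nrm_vadd|]. rewrite nrm_vscale.
  rewrite Rabs_left by lra. lra.
Qed.

Lemma nrm_on_sphere (x : R3) : on_sphere x -> nrm x = 1.
Proof. unfold on_sphere, nrm. intros ->. apply sqrt_1. Qed.

Lemma nrm_sub_sphere (x y : R3) : on_sphere x -> on_sphere y -> nrm (vsub y x) <= 2.
Proof.
  intros Hx Hy. eapply Rle_trans; [apply nrm_vsub|].
  rewrite !nrm_on_sphere by auto. lra.
Qed.

Lemma Rabs_coord_le (x : R3) : Rabs (v1 x) <= nrm x /\ Rabs (v2 x) <= nrm x /\ Rabs (v3 x) <= nrm x.
Proof.
  pose proof (nrm_sqr x). pose proof (nrm_nonneg x).
  repeat split; apply Rabs_le_of_sqr; auto; rewrite nrm_sqr; vdestr; vunfold; nra.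
Qed.

Lemma cv3_of_nrm (s : nat -> R3) (x : R3) :
  (forall eps, 0 < eps -> exists N, forall n, (n >= N)%nat -> nrm (vsub (s n) x) < eps) ->
  cv3 s x.
Proof.
  intros H. repeat split; intros eps He; destruct (H eps He) as [N HN]; exists N; intros n Hn;
    specialize (HN n Hn); pose proof (Rabs_coord_le (vsub (s n) x)) as (A & B & C);
    unfold Rdist;
    [ replace (v1 (s n) - v1 x) with (v1 (vsub (s n) x))
    | replace (v2 (s n) - v2 x) with (v2 (vsub (s n) x))
    | replace (v3 (s n) - v3 x) with (v3 (vsub (s n) x)) ];
    try lra; unfold vsub; vunfold; ring.
Qed.

Lemma nrm_le_coords (x : R3) : nrm x <= Rabs (v1 x) + Rabs (v2 x) + Rabs (v3 x).
Proof.
  pose proof (Rabs_pos (v1 x)). pose proof (Rabs_pos (v2 x)). pose proof (Rabs_pos (v3 x)).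
  apply nrm_le; [lra|].
  assert (E : forall t, t * t = Rabs t * Rabs t).
  { intro t. rewrite <- Rabs_mult. symmetry; apply Rabs_pos_eq. nra. }
  unfold dot. rewrite (E (v1 x)), (E (v2 x)), (E (v3 x)). nra.
Qed.

(** The sequence t = 1/(n+1) leads back to the unperturbed vector. Closedness is needed in this form
    for horizontal vectors that are only seen to lie in the cone after a small shift. *)
Lemma closed_of_perturb (N : R3 -> Prop) (x v : R3) :
  is_closed_set N -> (forall t, 0 < t -> N (vadd x (vscale t v))) -> N x.
Proof.
  intros Hc H. apply (Hc (fun n => vadd x (vscale (/ INR (S n)) v))).
  - intro n. apply H. apply Rinv_0_lt_compat, lt_0_INR. lia.
  - apply cv3_of_nrm. intros eps He.
    destruct (archimed_cor1 (eps / (nrm v + 1))) as (N0 & HN & HN0).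
    { pose proof (nrm_nonneg v). apply Rdiv_lt_0_compat; lra. }
    exists N0. intros n Hn.
    replace (vsub _ x) with (vscale (/ INR (S n)) v) by veq.
    rewrite nrm_vscale. pose proof (nrm_nonneg v).
    assert (0 < INR N0) by (apply lt_0_INR; lia).
    assert (INR N0 <= INR (S n)) by (apply le_INR; lia).
    assert (/ INR (S n) <= / INR N0) by (apply Rinv_le_contravar; lra).
    assert (0 < / INR (S n)) by (apply Rinv_0_lt_compat; lra).
    rewrite Rabs_pos_eq by lra.
    assert (/ INR (S n) * (nrm v + 1) < eps).
    { apply Rle_lt_trans with (/ INR N0 * (nrm v + 1)); [nra|].
      apply (Rmult_lt_compat_r (nrm v + 1)) in HN; [|lra].
      unfold Rdiv in HN. rewrite Rmult_assoc, Rinv_l in HN; lra. }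
    nra.
Qed.

(** * Projection onto a closed convex cone and separation *)

(** Unlike [dual], no unit length is imposed, so these vectors themselves form a cone and normals
    may be rescaled freely. *)
Definition in_dual (N : R3 -> Prop) (y : R3) : Prop := forall x, N x -> 0 <= dot y x.

Lemma closed_cone_0 (N : R3 -> Prop) (x : R3) : closed_convex_cone N -> N x -> N (mk3 0 0 0).
Proof.
  intros [_ [_ H]] Hx. replace (mk3 0 0 0) with (vscale 0 x) by veq. apply H; auto. lra.
Qed.

Lemma pointwise_choice (A B : Type) (P : A -> B -> Prop) :
  (forall x, exists y, P x y) -> exists f, forall x, P x (f x).
Proof.
  intros H. exists (fun x => proj1_sig (constructive_indefinite_description _ (H x))).
  intro x. apply proj2_sig.
Qed.

(* A minimising sequence for the distance is Cauchy by the parallelogram law. *)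
Lemma nearest_point (N : R3 -> Prop) (x : R3) :
  closed_convex_cone N -> (exists z, N z) ->
  exists p, N p /\ forall y, N y -> dot (vsub x p) (vsub x p) <= dot (vsub x y) (vsub x y).
Proof.
  intros [Hcl [Hadd Hsc]] [z Hz].
  (* [completeness] gives suprema, so the infimum [d] of the squared distances is minus the supremum
     [m] of their negatives. *)
  destruct (completeness (fun t => exists y, N y /\ t = - dot (vsub x y) (vsub x y))) as [m [Hub Hlub]].
  { exists 0. intros t (y & _ & ->). pose proof (dot_self_nonneg (vsub x y)). lra. }
  { exists (- dot (vsub x z) (vsub x z)), z. auto. }
  set (d := - m).
  assert (Hd : forall y, N y -> d <= dot (vsub x y) (vsub x y)).
  { intros y Hy. assert (- dot (vsub x y) (vsub x y) <= m) by (apply Hub; exists y; auto). unfold d; lra. }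
  assert (Hex : forall n, exists y, N y /\ dot (vsub x y) (vsub x y) < d + / INR (S n)).
  { intro n. apply NNPP. intro Hne.
    assert (0 < / INR (S n)) by (apply Rinv_0_lt_compat, lt_0_INR; lia).
    assert (m <= m - / INR (S n)); [|lra].
    apply Hlub. intros t (y & Hy & ->).
    destruct (Rlt_le_dec (dot (vsub x y) (vsub x y)) (d + / INR (S n))); [|unfold d in *; lra].
    exfalso; apply Hne; exists y; auto. }
  destruct (pointwise_choice _ _ _ Hex) as [s Hs].
  assert (Hcau : forall eps, 0 < eps -> exists N0, forall n k, (n >= N0)%nat -> (k >= N0)%nat ->
     nrm (vsub (s n) (s k)) < eps).
  (* Both squared distances exceed [d] by at most 1/N0 and the midpoint has at least [d], so the
     squared gap is at most 4/N0; hence the quarter. *)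
  { intros eps He. destruct (archimed_cor1 (eps * eps / 4)) as (N0 & HN & HN0); [nra|].
    exists N0. intros n k Hn Hk.
    destruct (Hs n) as [Sn1 Sn2]. destruct (Hs k) as [Sk1 Sk2].
    assert (0 < INR N0) by (apply lt_0_INR; lia).
    assert (In : / INR (S n) <= / INR N0) by (apply Rinv_le_contravar; [lra|apply le_INR; lia]).
    assert (Ik : / INR (S k) <= / INR N0) by (apply Rinv_le_contravar; [lra|apply le_INR; lia]).
    pose proof (Hd (vscale (1/2) (vadd (s n) (s k)))) as Hm.
    assert (Nm : N (vscale (1/2) (vadd (s n) (s k)))) by (apply Hsc; [lra|apply Hadd; auto]).
    specialize (Hm Nm).
    assert (P : dot (vsub (s n) (s k)) (vsub (s n) (s k)) =
       2 * dot (vsub x (s n)) (vsub x (s n)) + 2 * dot (vsub x (s k)) (vsub x (s k))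
       - 4 * dot (vsub x (vscale (1/2) (vadd (s n) (s k)))) (vsub x (vscale (1/2) (vadd (s n) (s k))))).
    { unfold vsub; generalize (s n) (s k); intros; vdestr; vunfold; field. }
    pose proof (nrm_sqr (vsub (s n) (s k))). pose proof (nrm_nonneg (vsub (s n) (s k))).
    nra. }
  assert (Hc : forall f : R3 -> R, (forall a b, f a - f b = f (vsub a b)) ->
      (forall v, Rabs (f v) <= nrm v) -> { l | Un_cv (fun n => f (s n)) l }).
  { intros f Hf1 Hf2. apply R_complete. intros eps He. destruct (Hcau eps He) as [N0 HN].
    exists N0. intros n k Hn Hk. unfold Rdist. rewrite Hf1.
    eapply Rle_lt_trans; [apply Hf2|]. apply HN; auto. }
  destruct (Hc v1) as [p1 Hp1]; [intros; unfold vsub; vring|intro v; apply Rabs_coord_le|].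
  destruct (Hc v2) as [p2 Hp2]; [intros; unfold vsub; vring|intro v; apply Rabs_coord_le|].
  destruct (Hc v3) as [p3 Hp3]; [intros; unfold vsub; vring|intro v; apply Rabs_coord_le|].
  set (p := mk3 p1 p2 p3).
  assert (Np : N p).
  { apply (Hcl s); [intro; apply Hs|]. repeat split; assumption. }
  exists p. split; auto. intros y Hy.
  apply Rle_trans with d; [|auto].
  assert (Hlim : Un_cv (fun n => dot (vsub x (s n)) (vsub x (s n))) (dot (vsub x p) (vsub x p))).
  { assert (Q : forall (f : nat -> R) l a, Un_cv f l ->
       Un_cv (fun n => (a + -1 * f n) * (a + -1 * f n)) ((a + -1 * l) * (a + -1 * l))).
    { intros f l a Hf. apply is_lim_seq_Reals. apply is_lim_seq_Reals in Hf.
      assert (is_lim_seq (fun n => a + -1 * f n) (a + -1 * l)).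
      { apply is_lim_seq_plus'; [apply is_lim_seq_const|].
        apply (is_lim_seq_scal_l f (-1) l). auto. }
      apply is_lim_seq_mult'; auto. }
    apply is_lim_seq_Reals. unfold vsub, dot. simpl.
    apply is_lim_seq_plus'; [apply is_lim_seq_plus'|]; apply is_lim_seq_Reals;
      apply Q; assumption. }
  apply is_lim_seq_Reals in Hlim.
  assert (Hlim2 : is_lim_seq (fun n => d + / INR (S n)) d).
  { replace (Finite d) with (Finite (d + 0)) by (f_equal; lra).
    apply is_lim_seq_plus'; [apply is_lim_seq_const|].
    apply is_lim_seq_Reals. intros eps He.
    destruct (archimed_cor1 eps He) as (N0 & HN & HN0). exists N0. intros n Hn.
    unfold Rdist. rewrite Rminus_0_r.
    assert (0 < / INR (S n)) by (apply Rinv_0_lt_compat, lt_0_INR; lia).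
    rewrite Rabs_pos_eq by lra.
    apply Rle_lt_trans with (/ INR N0); auto.
    apply Rinv_le_contravar; [apply lt_0_INR; lia| apply le_INR; lia]. }
  apply (is_lim_seq_le _ _ (Finite (dot (vsub x p) (vsub x p))) (Finite d)) with (2 := Hlim) (3 := Hlim2).
  intro n. left. apply Hs.
Qed.

(* [q] is the component of [x] in the polar cone (Moreau decomposition). *)
Definition polar_part (N : R3 -> Prop) (x q : R3) : Prop :=
  N (vsub x q) /\ (forall y, N y -> dot q y <= 0) /\ dot q (vsub x q) = 0.

(** First-order condition at the nearest point p: moving to p + t y does not decrease the distance,
    and t -> 0 gives the sign of the product with y. The choices y = p and y = -p give
    orthogonality. *)
Lemma polar_part_exists (N : R3 -> Prop) (x : R3) :
  closed_convex_cone N -> (exists z, N z) -> exists q, polar_part N x q.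
Proof.
  intros HN Hz. destruct (nearest_point N x HN Hz) as (p & Np & Hp).
  destruct HN as [Hcl [Hadd Hsc]].
  assert (D : forall y t, 0 < t -> N (vadd p (vscale t y)) ->
     2 * dot (vsub x p) y <= t * dot y y).
  { intros y t Ht Hy. specialize (Hp _ Hy).
    replace (dot (vsub x (vadd p (vscale t y))) (vsub x (vadd p (vscale t y)))) with
      (dot (vsub x p) (vsub x p) - 2 * t * dot (vsub x p) y + t * t * dot y y) in Hp
      by (unfold vsub; vring).
    nra. }
  (* The limit t -> 0 in algebraic form: if a > 0, the value t = a / (b + 1 + a) makes t b smaller
     than a. The range t < 1 is there because p - t p must stay in the cone. *)
  assert (L : forall a b, 0 <= b -> (forall t, 0 < t < 1 -> 2 * a <= t * b) -> a <= 0).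
  { intros a b Hb H. destruct (Rle_lt_dec a 0); auto.
    assert (0 < a / (b + 1 + a)) by (apply Rdiv_lt_0_compat; lra).
    assert (a / (b + 1 + a) * (b + 1 + a) = a) by (field; lra).
    specialize (H (a / (b + 1 + a))). nra. }
  exists (vsub x p). split; [|split].
  - replace (vsub x (vsub x p)) with p by veq. auto.
  - intros y Hy. apply (L _ (dot y y)); [apply dot_self_nonneg|].
    intros t Ht. apply D; [lra|]. apply Hadd; auto. apply Hsc; auto; lra.
  - replace (vsub x (vsub x p)) with p by veq.
    apply Rle_antisym.
    + apply (L _ (dot p p)); [apply dot_self_nonneg|]. intros t Ht. apply D; [lra|].
      apply Hadd; auto. apply Hsc; auto; lra.
    + enough (dot (vsub x p) (vscale (-1) p) <= 0) by (rewrite dot_vscale_r in H; lra).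
      apply (L _ (dot (vscale (-1) p) (vscale (-1) p))); [apply dot_self_nonneg|].
      intros t Ht. apply D; [lra|].
      replace (vadd p (vscale t (vscale (-1) p))) with (vscale (1 - t) p) by veq.
      apply Hsc; auto; lra.
Qed.

(** Each polar part has nonpositive product with the cone part of the other point, so |qy - qx|^2 <=
    <qy - qx, y - x>; Cauchy-Schwarz finishes. *)
Lemma polar_part_lipschitz (N : R3 -> Prop) (x y qx qy : R3) :
  polar_part N x qx -> polar_part N y qy -> nrm (vsub qy qx) <= nrm (vsub y x).
Proof.
  intros (A1 & A2 & A3) (B1 & B2 & B3).
  assert (H1 := A2 _ B1). assert (H2 := B2 _ A1).
  assert (H : dot (vsub qy qx) (vsub qy qx) <= dot (vsub qy qx) (vsub y x)).
  { assert (E : dot (vsub qy qx) (vsub y x) - dot (vsub qy qx) (vsub qy qx) =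
       dot qy (vsub y qy) - dot qy (vsub x qx) - dot qx (vsub y qy) + dot qx (vsub x qx))
      by (unfold vsub; vring). lra. }
  pose proof (cauchy_schwarz (vsub qy qx) (vsub y x)) as C. apply Rabs_le_between in C.
  pose proof (nrm_sqr (vsub qy qx)). pose proof (nrm_nonneg (vsub qy qx)).
  pose proof (nrm_nonneg (vsub y x)).
  destruct (Rle_lt_dec (nrm (vsub qy qx)) (nrm (vsub y x))); auto. nra.
Qed.

(** |q|^2 is the squared distance from x to the cone, and 2 q is its gradient. Both remainder bounds
    are identities with a square and cross terms whose signs come from polarity; this is what makes
    the squared distance C^{1,1} for an arbitrary cone. *)
Lemma polar_part_taylor (N : R3 -> Prop) (x y qx qy : R3) :
  polar_part N x qx -> polar_part N y qy ->
  Rabs (dot qy qy - dot qx qx - 2 * dot qx (vsub y x)) <= dot (vsub y x) (vsub y x).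
Proof.
  intros (A1 & A2 & A3) (B1 & B2 & B3).
  assert (H1 := A2 _ B1). assert (H2 := B2 _ A1).
  apply Rabs_le. split.
  - assert (E : dot qy qy - dot qx qx - 2 * dot qx (vsub y x) =
       dot (vsub qy qx) (vsub qy qx) - 2 * dot qx (vsub y qy) + 2 * dot qx (vsub x qx))
      by (unfold vsub; vring).
    pose proof (dot_self_nonneg (vsub qy qx)). pose proof (dot_self_nonneg (vsub y x)). lra.
  - assert (E : dot qy qy - dot qx qx - 2 * dot qx (vsub y x) =
       dot (vsub y x) (vsub y x) - dot (vsub (vsub y x) (vsub qy qx)) (vsub (vsub y x) (vsub qy qx))
       - 2 * dot qy (vsub y qy) + 2 * dot qy (vsub x qx)) by (unfold vsub; vring).
    pose proof (dot_self_nonneg (vsub (vsub y x) (vsub qy qx))). lra.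
Qed.

Lemma polar_part_nrm (N : R3 -> Prop) (x q : R3) : polar_part N x q -> nrm q <= nrm x.
Proof.
  intros (_ & _ & H). apply nrm_le; [apply nrm_nonneg|]. rewrite nrm_sqr.
  assert (E : dot x x = dot q q + 2 * dot q (vsub x q) + dot (vsub x q) (vsub x q))
    by (unfold vsub; vring).
  pose proof (dot_self_nonneg (vsub x q)). lra.
Qed.

Lemma polar_part_in (N : R3 -> Prop) (x q : R3) : polar_part N x q -> N x -> dot q q = 0.
Proof.
  intros (_ & H & H0) Hx. specialize (H x Hx). rewrite dot_vsub_r in H0.
  pose proof (dot_self_nonneg q). lra.
Qed.

(** Minus the polar part of x separates: its product with x is -|q|^2, and q = 0 would mean that x
    equals its own cone part. *)
Lemma cone_separation (N : R3 -> Prop) (x : R3) :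
  closed_convex_cone N -> (exists z, N z) -> ~ N x ->
  exists n, in_dual N n /\ dot n x < 0.
Proof.
  intros HN Hz Hx. destruct (polar_part_exists N x HN Hz) as (q & A & B & C).
  exists (vscale (-1) q). split.
  - intros y Hy. rewrite dot_vscale_l. specialize (B y Hy). lra.
  - rewrite dot_vscale_l. rewrite dot_vsub_r in C.
    destruct (Req_dec (dot q q) 0) as [E|E].
    + exfalso. apply Hx. apply dot_self_eq0 in E. subst q.
      replace x with (vsub x (mk3 0 0 0)) by veq. auto.
    + pose proof (dot_self_nonneg q). lra.
Qed.

(** * Integrals of continuous functions of one and two variables *)

Definition cts1 (g : R -> R) : Prop := forall x, continuity_pt g x.

Definition cts2 (k : R -> R -> R) : Prop := forall x y, continuity_2d_pt k x y.

Lemma ex_RInt_cts1 (g : R -> R) (a b : R) : cts1 g -> ex_RInt g a b.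
Proof.
  intros H. apply (ex_RInt_continuous (V := R_CompleteNormedModule)). intros z _.
  apply continuity_pt_filterlim, H.
Qed.

Lemma cts1_const (c : R) : cts1 (fun _ => c).
Proof. intro x. apply continuity_pt_const. intros u v; reflexivity. Qed.

Lemma cts1_plus (f g : R -> R) : cts1 f -> cts1 g -> cts1 (fun x => f x + g x).
Proof. intros Hf Hg x. apply (continuity_pt_plus f g x); auto. Qed.

Lemma cts1_minus (f g : R -> R) : cts1 f -> cts1 g -> cts1 (fun x => f x - g x).
Proof. intros Hf Hg x. apply (continuity_pt_minus f g x); auto. Qed.

Lemma cts1_mult (f g : R -> R) : cts1 f -> cts1 g -> cts1 (fun x => f x * g x).
Proof. intros Hf Hg x. apply (continuity_pt_mult f g x); auto. Qed.

Lemma cts1_sin : cts1 sin.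
Proof. intro x; apply continuity_sin. Qed.

Lemma cts1_cos : cts1 cos.
Proof. intro x; apply continuity_cos. Qed.

Lemma cts1_shift (g : R -> R) (c : R) : cts1 g -> cts1 (fun x => g (x + c)).
Proof.
  intros H x. apply (continuity_pt_comp (fun x => x + c) g); [|apply H].
  apply continuity_pt_plus; [apply derivable_continuous_pt, derivable_pt_id|].
  apply continuity_pt_const; intros u v; reflexivity.
Qed.

Lemma cts2_slice (k : R -> R -> R) (x : R) : cts2 k -> cts1 (k x).
Proof.
  intros H y. apply continuity_pt_locally. intros eps.
  destruct (H x y eps) as [d Hd]. exists d. intros z Hz.
  apply Hd; [rewrite Rminus_diag, Rabs_R0; apply cond_pos|exact Hz].
Qed.

Lemma cts2_swap (k : R -> R -> R) : cts2 k -> cts2 (fun x y => k y x).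
Proof.
  intros H x y eps. destruct (H y x eps) as [d Hd]. exists d. intros; apply Hd; auto.
Qed.

Lemma cts2_mult (f g : R -> R -> R) : cts2 f -> cts2 g -> cts2 (fun x y => f x y * g x y).
Proof. intros Hf Hg x y. apply continuity_2d_pt_mult; auto. Qed.

Lemma cts2_plus (f g : R -> R -> R) : cts2 f -> cts2 g -> cts2 (fun x y => f x y + g x y).
Proof. intros Hf Hg x y. apply continuity_2d_pt_plus; auto. Qed.

Lemma cts2_fst (f : R -> R) : cts1 f -> cts2 (fun x _ => f x).
Proof.
  intros H x y. apply (continuity_1d_2d_pt_comp f (fun x _ => x)); auto.
  apply continuity_2d_pt_id1.
Qed.

Lemma cts2_snd (f : R -> R) : cts1 f -> cts2 (fun _ y => f y).
Proof.
  intros H x y. apply (continuity_1d_2d_pt_comp f (fun _ y => y)); auto.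
  apply continuity_2d_pt_id2.
Qed.

Lemma RInt_close (g : R -> R) (a b c e : R) :
  a <= b -> cts1 g -> (forall x, a <= x <= b -> Rabs (g x - c) <= e) ->
  Rabs (RInt g a b - c * (b - a)) <= e * (b - a).
Proof.
  intros Hab Hg H.
  replace (RInt g a b - c * (b - a)) with (RInt (fun x => g x - c) a b).
  - rewrite (Rmult_comm e). apply abs_RInt_le_const; auto.
    apply ex_RInt_cts1, cts1_minus; auto. apply cts1_const.
  - rewrite (RInt_minus (V := R_CompleteNormedModule) g (fun _ => c)).
    + rewrite (RInt_const (V := R_CompleteNormedModule)).
      unfold minus, plus, opp, scal; simpl; unfold mult; simpl. ring.
    + apply ex_RInt_cts1; auto.
    + apply ex_RInt_cts1, cts1_const.
Qed.

Lemma RInt_plus_cts1 (f g : R -> R) (a b : R) : cts1 f -> cts1 g ->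
  RInt (fun x => f x + g x) a b = RInt f a b + RInt g a b.
Proof.
  intros. apply (RInt_plus (V := R_CompleteNormedModule) f g); apply ex_RInt_cts1; auto.
Qed.

Lemma RInt_minus_cts1 (f g : R -> R) (a b : R) : cts1 f -> cts1 g ->
  RInt (fun x => f x - g x) a b = RInt f a b - RInt g a b.
Proof.
  intros. apply (RInt_minus (V := R_CompleteNormedModule) f g); apply ex_RInt_cts1; auto.
Qed.

Lemma RInt_scal_cts1 (f : R -> R) (c a b : R) : cts1 f ->
  RInt (fun x => c * f x) a b = c * RInt f a b.
Proof.
  intros. apply (RInt_scal (V := R_CompleteNormedModule) f); apply ex_RInt_cts1; auto.
Qed.

Lemma RInt_ext_R (f g : R -> R) (a b : R) : (forall x, f x = g x) -> RInt f a b = RInt g a b.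
Proof. intros H. apply (RInt_ext (V := R_CompleteNormedModule)). intros; apply H. Qed.

Lemma RInt_const_R (a b c : R) : RInt (fun _ => c) a b = (b - a) * c.
Proof. apply (RInt_const (V := R_CompleteNormedModule)). Qed.

Lemma RInt_le_cts1 (f g : R -> R) (a b : R) : a <= b -> cts1 f -> cts1 g ->
  (forall x, a < x < b -> f x <= g x) -> RInt f a b <= RInt g a b.
Proof. intros. apply RInt_le; auto; apply ex_RInt_cts1; auto. Qed.

Lemma RInt_Chasles_cts1 (f : R -> R) (a b c : R) : cts1 f ->
  RInt f a c = RInt f a b + RInt f b c.
Proof.
  intros. symmetry. apply (RInt_Chasles (V := R_CompleteNormedModule)); apply ex_RInt_cts1; auto.
Qed.

Lemma RInt_derive_cts1 (f df : R -> R) (a b : R) :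
  (forall x, is_derive f x (df x)) -> cts1 df -> RInt df a b = f b - f a.
Proof.
  intros H Hc. apply is_RInt_unique.
  apply (is_RInt_derive (V := R_CompleteNormedModule) f df); intros; auto.
  apply continuity_pt_filterlim, Hc.
Qed.

Lemma cts1_RInt (k : R -> R -> R) (c d : R) : c <= d -> cts2 k ->
  cts1 (fun x => RInt (k x) c d).
Proof.
  intros Hcd Hk x. apply continuity_pt_locally. intros eps.
  assert (He : 0 < eps / (d - c + 1)).
  { apply Rdiv_lt_0_compat; [apply cond_pos|lra]. }
  destruct (uniform_continuity_2d k (x - 1) (x + 1) c d (fun u v _ _ => Hk u v)
    (mkposreal _ He)) as [del Hdel]. simpl in Hdel.
  assert (Hm : 0 < Rmin del 1) by (apply Rmin_pos; [apply cond_pos|lra]).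
  exists (mkposreal _ Hm). intros y Hy. simpl in Hy.
  assert (Hy1 : Rabs (y - x) < del) by (eapply Rlt_le_trans; [exact Hy|apply Rmin_l]).
  assert (Hy2 : Rabs (y - x) < 1) by (eapply Rlt_le_trans; [exact Hy|apply Rmin_r]).
  rewrite <- RInt_minus_cts1 by (apply cts2_slice; auto).
  apply Rle_lt_trans with ((d - c) * (eps / (d - c + 1))).
  - apply abs_RInt_le_const; auto.
    + apply ex_RInt_cts1, cts1_minus; apply cts2_slice; auto.
    + intros t Ht. left. apply Rabs_def2 in Hy2. apply Hdel; auto; try lra.
      rewrite Rminus_diag, Rabs_R0. apply cond_pos.
  - pose proof (cond_pos eps).
    assert (eps / (d - c + 1) * (d - c + 1) = eps) by (field; lra). nra.
Qed.

(** The numbers c i need not be values of g, only close to g on the i-th cell. This lets the lemma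
    be used twice: for the inner sums, and for the outer sum whose c i are inner sums. *)
Lemma RInt_sum_close (g : R -> R) (c : nat -> R) (A e : R) (n : nat) :
  0 <= A -> (1 <= n)%nat -> cts1 g ->
  (forall i x, (i < n)%nat -> INR i * A / INR n <= x <= INR (S i) * A / INR n ->
     Rabs (g x - c i) <= e) ->
  Rabs (sum_f_R0 c (pred n) * (A / INR n) - RInt g 0 A) <= e * A.
Proof.
  intros HA Hn Hg H.
  assert (Hn0 : 0 < INR n) by (apply lt_0_INR; lia).
  assert (Hw : 0 <= A / INR n) by (apply Rmult_le_pos; auto; left; apply Rinv_0_lt_compat; auto).
  assert (cell : forall i, (i < n)%nat ->
     Rabs (c i * (A / INR n) - RInt g (INR i * A / INR n) (INR (S i) * A / INR n)) <= e * (A / INR n)).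
  { intros i Hi. rewrite Rabs_minus_sym.
    assert (E : INR (S i) * A / INR n - INR i * A / INR n = A / INR n)
      by (rewrite S_INR; field; lra).
    rewrite <- E. apply RInt_close; auto. rewrite S_INR. unfold Rdiv in *. nra. }
  assert (ind : forall k, (k < n)%nat ->
     Rabs (sum_f_R0 c k * (A / INR n) - RInt g 0 (INR (S k) * A / INR n)) <= e * (INR (S k) * A / INR n)).
  { induction k; intros Hk.
    - specialize (cell 0%nat Hk). simpl (sum_f_R0 c 0).
      replace (INR 0 * A / INR n) with 0 in cell by (simpl; unfold Rdiv; ring).
      replace (e * (INR 1 * A / INR n)) with (e * (A / INR n)) by (simpl; unfold Rdiv; ring).
      exact cell.
    - specialize (cell (S k) Hk). specialize (IHk ltac:(lia)).
      rewrite (RInt_Chasles_cts1 g 0 (INR (S k) * A / INR n)) by auto. simpl (sum_f_R0 c (S k)).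
      replace (e * (INR (S (S k)) * A / INR n)) with
        (e * (INR (S k) * A / INR n) + e * (A / INR n)) by (rewrite (S_INR (S k)); field; lra).
      apply Rabs_le_between in cell. apply Rabs_le_between in IHk. apply Rabs_le. lra. }
  specialize (ind (pred n) ltac:(lia)).
  replace (S (pred n)) with n in ind by lia.
  replace (INR n * A / INR n) with A in ind by (field; lra). auto.
Qed.

Lemma sum_f_R0_scal (f : nat -> R) (c : R) (m : nat) :
  sum_f_R0 (fun i => f i * c) m = sum_f_R0 f m * c.
Proof. rewrite Rmult_comm, scal_sum. apply sum_eq. intros; ring. Qed.

(** Tags depend on both indices, so a row does not sample one section of k. Uniform continuity on
    the rectangle absorbs the difference. *)
Lemma double_riemann_sum (k : R -> R -> R) (A B : R) : 0 < A -> 0 < B -> cts2 k ->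
  forall eps, 0 < eps -> exists N, forall n s t, (N <= n)%nat -> (1 <= n)%nat ->
   (forall i j, (i < n)%nat -> (j < n)%nat ->
     INR i * A / INR n <= s i j <= INR (S i) * A / INR n /\
     INR j * B / INR n <= t i j <= INR (S j) * B / INR n) ->
   Rabs (sum_f_R0 (fun i => sum_f_R0 (fun j => k (s i j) (t i j)) (pred n)) (pred n)
          * (A / INR n) * (B / INR n)
     - RInt (fun x => RInt (k x) 0 B) 0 A) < eps.
Proof.
  intros HA HB Hk eps He.
  assert (He' : 0 < eps / (2 * A * B)) by (apply Rdiv_lt_0_compat; nra).
  destruct (uniform_continuity_2d k 0 A 0 B (fun u v _ _ => Hk u v)
    (mkposreal _ He')) as [del Hdel]. simpl in Hdel.
  (* With 1/n below this bound, both mesh widths A/n and B/n are below [del]. *)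
  assert (Hd : 0 < del / (A + B)) by (apply Rdiv_lt_0_compat; [apply cond_pos|lra]).
  destruct (archimed_cor1 _ Hd) as (N & HN & HN0).
  exists N. intros n s t HnN Hn1 Hst.
  assert (Hn0 : 0 < INR n) by (apply lt_0_INR; lia).
  assert (Hin : / INR n <= / INR N).
  { apply Rinv_le_contravar; [apply lt_0_INR; lia|apply le_INR; auto]. }
  assert (Hip : 0 < / INR n) by (apply Rinv_0_lt_compat; auto).
  assert (Hsm : / INR n * (A + B) < del).
  { apply Rle_lt_trans with (/ INR N * (A + B)); [nra|].
    apply (Rmult_lt_compat_r (A + B)) in HN; [|lra].
    unfold Rdiv in HN. rewrite Rmult_assoc, Rinv_l in HN; lra. }
  assert (cellb : forall i L, 0 < L -> (i < n)%nat ->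
     0 <= INR i * L / INR n /\ INR (S i) * L / INR n <= L /\
     INR (S i) * L / INR n = INR i * L / INR n + L * / INR n).
  { intros i L HL Hi. pose proof (pos_INR i).
    assert (INR (S i) <= INR n) by (apply le_INR; lia).
    repeat split.
    - unfold Rdiv. apply Rmult_le_pos; nra.
    - apply Rle_div_l; nra.
    - rewrite S_INR; field; lra. }
  replace (sum_f_R0 (fun i => sum_f_R0 (fun j => k (s i j) (t i j)) (pred n)) (pred n)
          * (A / INR n) * (B / INR n)) with
    (sum_f_R0 (fun i => sum_f_R0 (fun j => k (s i j) (t i j)) (pred n) * (B / INR n)) (pred n)
          * (A / INR n)).
  2:{ rewrite sum_f_R0_scal. ring. }
  apply Rle_lt_trans with (eps / (2 * A * B) * B * A).
  2:{ assert (eps / (2 * A * B) * B * A = eps / 2) by (field; split; lra). lra. }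
  apply RInt_sum_close; auto; [lra|apply cts1_RInt; auto; lra|].
  intros i x Hi Hx. rewrite Rabs_minus_sym. apply RInt_sum_close; auto; [lra|apply cts2_slice; auto|].
  intros j y Hj Hy. left.
  destruct (cellb i A HA Hi) as (a1 & a2 & a3). destruct (cellb j B HB Hj) as (b1 & b2 & b3).
  destruct (Hst i j Hi Hj) as [S1 S2].
  assert (A * / INR n < del) by nra. assert (B * / INR n < del) by nra.
  assert (diff : forall p w u v, w < del -> p <= u <= p + w -> p <= v <= p + w -> Rabs (u - v) < del).
  { intros p w u v Hw Hu Hv. apply Rabs_def1; lra. }
  rewrite a3 in *. rewrite b3 in *.
  apply Hdel; try lra; [apply (diff _ _ _ _ H Hx S1)|apply (diff _ _ _ _ H0 Hy S2)].
Qed.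

(** Both iterated integrals are limits of the same grid sums, up to the order of summation. *)
Lemma RInt_fubini (k : R -> R -> R) (A B : R) : 0 < A -> 0 < B -> cts2 k ->
  RInt (fun x => RInt (fun y => k x y) 0 B) 0 A = RInt (fun y => RInt (fun x => k x y) 0 A) 0 B.
Proof.
  intros HA HB Hk. apply cond_eq. intros eps He.
  destruct (double_riemann_sum k A B HA HB Hk (eps / 2)) as [N1 H1]; [lra|].
  destruct (double_riemann_sum (fun y x => k x y) B A HB HA (cts2_swap _ Hk) (eps / 2)) as [N2 H2]; [lra|].
  set (s := fun i (_ : nat) => INR i * A / INR (S (N1 + N2))).
  set (t := fun (_ j : nat) => INR j * B / INR (S (N1 + N2))).
  assert (Hn0 : 0 < INR (S (N1 + N2))) by (apply lt_0_INR; lia).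
  assert (Hip : 0 < / INR (S (N1 + N2))) by (apply Rinv_0_lt_compat; auto).
  specialize (H1 (S (N1 + N2)) s t ltac:(lia) ltac:(lia)).
  specialize (H2 (S (N1 + N2)) (fun i j => t j i) (fun i j => s j i) ltac:(lia) ltac:(lia)).
  assert (T : forall L i, 0 < L -> INR i * L / INR (S (N1 + N2)) <= INR i * L / INR (S (N1 + N2)) <= INR (S i) * L / INR (S (N1 + N2))).
  { intros L i HL. split; [lra|]. rewrite (S_INR i). unfold Rdiv. apply Rmult_le_compat_r; nra. }
  specialize (H1 (fun i j _ _ => conj (T A i HA) (T B j HB))).
  specialize (H2 (fun i j _ _ => conj (T B i HB) (T A j HA))).
  simpl (pred _) in *.
  assert (E : forall m, sum_f_R0 (fun i => sum_f_R0 (fun j => k (s i j) (t i j)) (N1 + N2)) m =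
      sum_f_R0 (fun i => sum_f_R0 (fun j => k (s j i) (t j i)) m) (N1 + N2)).
  { induction m; simpl; auto. rewrite IHm, <- sum_plus. auto. }
  rewrite E in H1.
  apply Rabs_def2 in H1. apply Rabs_def2 in H2. cbv beta in *.
  unfold s, t in *. cbv beta in *.
  change (RInt (fun x => RInt (fun y => k x y) 0 B) 0 A) with (RInt (fun x => RInt (k x) 0 B) 0 A).
  remember (RInt (fun x => RInt (k x) 0 B) 0 A) as I1.
  remember (RInt (fun y => RInt (fun x => k x y) 0 A) 0 B) as I2.
  match type of H1 with ?S * _ * _ - _ < _ /\ _ => remember S as Sg end.
  rewrite (Rmult_assoc Sg (B / _)), (Rmult_comm (B / _)), <- Rmult_assoc in H2.
  apply Rabs_def1; lra.
Qed.

(** * Quadratic Taylor remainders *)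

(** The remainder is bounded for every [h] with one constant; such a bound survives integration,
    unlike the bare existence of a derivative. *)
Definition quad (f : R -> R) (t l : R) : Prop :=
  exists C, forall h, Rabs (f (t + h) - f t - l * h) <= C * (h * h).

Lemma quad_is_derive (f : R -> R) (t l : R) : quad f t l -> is_derive f t l.
Proof.
  intros [C HC]. apply is_derive_Reals. intros eps He.
  assert (HC' : 0 <= Rabs C) by apply Rabs_pos.
  assert (Hd : 0 < eps / (Rabs C + 1)) by (apply Rdiv_lt_0_compat; lra).
  exists (mkposreal _ Hd). intros h Hh0 Hh. simpl in Hh.
  specialize (HC h).
  replace ((f (t + h) - f t) / h - l) with ((f (t + h) - f t - l * h) / h) by (field; auto).
  unfold Rdiv. rewrite Rabs_mult, Rabs_inv.
  assert (Hp : 0 < Rabs h) by (apply Rabs_pos_lt; auto).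
  apply Rmult_lt_reg_r with (Rabs h); auto.
  rewrite Rmult_assoc, Rinv_l, Rmult_1_r by lra.
  assert (E : h * h = Rabs h * Rabs h).
  { rewrite <- Rabs_mult. symmetry; apply Rabs_pos_eq; nra. }
  rewrite E in HC. pose proof (Rle_abs C).
  assert (Rabs h * (Rabs C + 1) < eps).
  { apply (Rmult_lt_compat_r (Rabs C + 1)) in Hh; [|lra].
    unfold Rdiv in Hh. rewrite Rmult_assoc, Rinv_l in Hh; lra. }
  apply Rle_lt_trans with (Rabs C * Rabs h * Rabs h); [nra|].
  apply Rmult_lt_compat_r; auto. nra.
Qed.

Lemma Rabs_sin_le (x : R) : Rabs (sin x) <= Rabs x.
Proof.
  assert (P : forall y, 0 <= y -> Rabs (sin y) <= y).
  { intros y [Hy|<-]; [|rewrite sin_0, Rabs_R0; lra].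
    destruct (Rle_lt_dec 1 y).
    - pose proof (SIN_bound y). apply Rabs_le; lra.
    - rewrite Rabs_pos_eq; [left; apply sin_lt_x; auto|].
      apply sin_ge_0; [lra|]. pose proof PI2_1. lra. }
  destruct (Rle_lt_dec 0 x).
  - rewrite (Rabs_pos_eq x) by auto. auto.
  - rewrite <- (Rabs_Ropp (sin x)), <- sin_neg, (Rabs_left x) by auto. apply P. lra.
Qed.

Lemma cos_half (x : R) : 1 - cos x = 2 * (sin (x / 2) * sin (x / 2)).
Proof.
  replace x with (2 * (x / 2)) at 1 by field. rewrite cos_2a_sin. ring.
Qed.

Lemma sin_half_bound (x : R) : 0 <= sin (x / 2) * sin (x / 2) <= x * x / 4 /\ Rabs (sin (x/2)) <= 1.
Proof.
  pose proof (Rabs_sin_le (x / 2)) as H. pose proof (SIN_bound (x / 2)).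
  split; [|apply Rabs_le; lra].
  apply Rsqr_le_abs_1 in H. unfold Rsqr in H. nra.
Qed.

Lemma one_minus_cos_le_sqr (x : R) : 0 <= 1 - cos x <= x * x.
Proof. rewrite cos_half. pose proof (sin_half_bound x). nra. Qed.

Lemma one_minus_cos_le_abs (x : R) : 0 <= 1 - cos x <= Rabs x.
Proof.
  rewrite cos_half. destruct (sin_half_bound x) as [H1 H2].
  pose proof (Rabs_sin_le (x / 2)) as H.
  replace (Rabs (x / 2)) with (Rabs x / 2) in H
    by (unfold Rdiv; rewrite Rabs_mult, (Rabs_pos_eq (/ 2)); lra).
  assert (E : sin (x/2) * sin (x/2) = Rabs (sin (x/2)) * Rabs (sin (x/2))).
  { rewrite <- Rabs_mult. symmetry; apply Rabs_pos_eq; nra. }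
  pose proof (Rabs_pos (sin (x/2))). nra.
Qed.

Lemma sin_sub_le_sqr (x : R) : Rabs (sin x - x) <= x * x.
Proof.
  assert (P : forall y, 0 < y -> Rabs (sin y - y) <= y * y).
  { intros y Hy.
    destruct (MVT_cor2 (fun t => sin t - t) (fun t => cos t - 1) 0 y Hy) as (c & Hc & Hc2).
    { intros c _. apply derivable_pt_lim_minus; [apply derivable_pt_lim_sin|apply derivable_pt_lim_id]. }
    rewrite sin_0 in Hc. replace (sin y - y) with ((cos c - 1) * (y - 0)) by lra.
    pose proof (one_minus_cos_le_abs c) as H. rewrite (Rabs_pos_eq c) in H by lra.
    apply Rabs_le. nra. }
  destruct (Rtotal_order 0 x) as [H|[<-|H]]; auto.
  - rewrite sin_0, Rminus_0_r, Rabs_R0. lra.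
  - specialize (P (- x) ltac:(lra)). rewrite sin_neg in P.
    rewrite <- Rabs_Ropp. replace (- (sin x - x)) with (- sin x - - x) by ring. lra.
Qed.

Lemma Rabs_mult_le_1 (a b c : R) : Rabs a <= 1 -> Rabs b <= c -> Rabs (a * b) <= c.
Proof. intros. rewrite Rabs_mult. pose proof (Rabs_pos a). pose proof (Rabs_pos b). nra. Qed.

Lemma Rabs_sin_le_1 (x : R) : Rabs (sin x) <= 1.
Proof. apply Rabs_le. pose proof (SIN_bound x). lra. Qed.

Lemma Rabs_cos_le_1 (x : R) : Rabs (cos x) <= 1.
Proof. apply Rabs_le. pose proof (COS_bound x). lra. Qed.

Lemma sin_taylor (t h : R) : Rabs (sin (t + h) - sin t - cos t * h) <= 2 * (h * h).
Proof.
  rewrite sin_plus.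
  replace (sin t * cos h + cos t * sin h - sin t - cos t * h) with
    (sin t * (cos h - 1) + cos t * (sin h - h)) by ring.
  eapply Rle_trans; [apply Rabs_triang|].
  assert (Rabs (sin t * (cos h - 1)) <= h * h).
  { apply Rabs_mult_le_1; [apply Rabs_sin_le_1|]. pose proof (one_minus_cos_le_sqr h).
    apply Rabs_le; lra. }
  assert (Rabs (cos t * (sin h - h)) <= h * h).
  { apply Rabs_mult_le_1; [apply Rabs_cos_le_1|]. apply sin_sub_le_sqr. }
  lra.
Qed.

Lemma cos_taylor (t h : R) : Rabs (cos (t + h) - cos t - - sin t * h) <= 2 * (h * h).
Proof.
  rewrite cos_plus.
  replace (cos t * cos h - sin t * sin h - cos t - - sin t * h) with
    (cos t * (cos h - 1) + sin t * - (sin h - h)) by ring.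
  eapply Rle_trans; [apply Rabs_triang|].
  assert (Rabs (cos t * (cos h - 1)) <= h * h).
  { apply Rabs_mult_le_1; [apply Rabs_cos_le_1|]. pose proof (one_minus_cos_le_sqr h).
    apply Rabs_le; lra. }
  assert (Rabs (sin t * - (sin h - h)) <= h * h).
  { apply Rabs_mult_le_1; [apply Rabs_sin_le_1|]. rewrite Rabs_Ropp. apply sin_sub_le_sqr. }
  lra.
Qed.

Lemma sin_lipschitz (t h : R) : Rabs (sin (t + h) - sin t) <= 2 * Rabs h.
Proof.
  rewrite sin_plus.
  replace (sin t * cos h + cos t * sin h - sin t) with
    (sin t * (cos h - 1) + cos t * sin h) by ring.
  eapply Rle_trans; [apply Rabs_triang|].
  assert (Rabs (sin t * (cos h - 1)) <= Rabs h).
  { apply Rabs_mult_le_1; [apply Rabs_sin_le_1|]. pose proof (one_minus_cos_le_abs h).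
    apply Rabs_le; lra. }
  assert (Rabs (cos t * sin h) <= Rabs h).
  { apply Rabs_mult_le_1; [apply Rabs_cos_le_1|]. apply Rabs_sin_le. }
  lra.
Qed.

Lemma cos_lipschitz (t h : R) : Rabs (cos (t + h) - cos t) <= 2 * Rabs h.
Proof.
  rewrite cos_plus.
  replace (cos t * cos h - sin t * sin h - cos t) with
    (cos t * (cos h - 1) + sin t * - sin h) by ring.
  eapply Rle_trans; [apply Rabs_triang|].
  assert (Rabs (cos t * (cos h - 1)) <= Rabs h).
  { apply Rabs_mult_le_1; [apply Rabs_cos_le_1|]. pose proof (one_minus_cos_le_abs h).
    apply Rabs_le; lra. }
  assert (Rabs (sin t * - sin h) <= Rabs h).
  { apply Rabs_mult_le_1; [apply Rabs_sin_le_1|]. rewrite Rabs_Ropp. apply Rabs_sin_le. }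
  lra.
Qed.

(* [G] plays the role of the gradient of [F]; everything is only required at points of the sphere. *)
Definition C11 (F : R3 -> R) (G : R3 -> R3) (K : R) : Prop :=
  0 <= K /\ forall x y, on_sphere x -> on_sphere y ->
    Rabs (F x) <= K /\ nrm (G x) <= K /\
    nrm (vsub (G y) (G x)) <= K * nrm (vsub y x) /\
    Rabs (F y - F x - dot (G x) (vsub y x)) <= K * dot (vsub y x) (vsub y x).

(** * Functions on the sphere in spherical coordinates; integrals of rotation fields *)

Definition sph_cont (F : R3 -> R) : Prop := cts2 (fun b a => F (sph a b)).

(** Longitude is the outer variable, so that the inner integral is the contribution of one
    meridian. *)
Definition J (F : R3 -> R) : R :=
  RInt (fun b => RInt (fun a => F (sph a b) * sin a) 0 PI) 0 (2 * PI).

Lemma sph_on_sphere (a b : R) : on_sphere (sph a b).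
Proof.
  unfold on_sphere, sph. vunfold.
  pose proof (sin2_cos2 a) as A. pose proof (sin2_cos2 b) as B. unfold Rsqr in *.
  replace (sin a * cos b * (sin a * cos b) + sin a * sin b * (sin a * sin b) + cos a * cos a) with
    (sin a * sin a * (sin b * sin b + cos b * cos b) + cos a * cos a) by ring.
  rewrite B. lra.
Qed.

Lemma cts2_sph_coords :
  cts2 (fun b a => v1 (sph a b)) /\ cts2 (fun b a => v2 (sph a b)) /\ cts2 (fun b a => v3 (sph a b)).
Proof.
  unfold sph; vunfold. repeat split.
  - apply cts2_mult; [apply (cts2_snd sin), cts1_sin|apply (cts2_fst cos), cts1_cos].
  - apply cts2_mult; [apply (cts2_snd sin), cts1_sin|apply (cts2_fst sin), cts1_sin].
  - apply (cts2_snd cos), cts1_cos.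
Qed.

Lemma sph_cont_lipschitz (F : R3 -> R) (K : R) :
  (forall x y, on_sphere x -> on_sphere y -> Rabs (F y - F x) <= K * nrm (vsub y x)) -> sph_cont F.
Proof.
  intros HF b a eps. destruct cts2_sph_coords as (H1 & H2 & H3).
  assert (HK : 0 <= Rabs K) by apply Rabs_pos. pose proof (Rle_abs K).
  assert (He : 0 < eps / (3 * (Rabs K + 1))) by (apply Rdiv_lt_0_compat; [apply cond_pos|lra]).
  generalize (locally_2d_and _ _ _ _ (H1 b a (mkposreal _ He))
    (locally_2d_and _ _ _ _ (H2 b a (mkposreal _ He)) (H3 b a (mkposreal _ He)))).
  apply locally_2d_impl, locally_2d_forall. cbv beta. cbn [pos]. intros u v (A1 & A2 & A3).
  eapply Rle_lt_trans; [apply HF; apply sph_on_sphere|].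
  pose proof (nrm_le_coords (vsub (sph v u) (sph a b))) as Hn.
  replace (v1 (vsub (sph v u) (sph a b))) with (v1 (sph v u) - v1 (sph a b)) in Hn by (unfold vsub; vunfold; ring).
  replace (v2 (vsub (sph v u) (sph a b))) with (v2 (sph v u) - v2 (sph a b)) in Hn by (unfold vsub; vunfold; ring).
  replace (v3 (vsub (sph v u) (sph a b))) with (v3 (sph v u) - v3 (sph a b)) in Hn by (unfold vsub; vunfold; ring).
  set (n := nrm _) in *. assert (0 <= n) by apply nrm_nonneg.
  assert (n < 3 * (eps / (3 * (Rabs K + 1)))) by lra.
  assert (3 * (eps / (3 * (Rabs K + 1))) * (Rabs K + 1) = eps) by (field; lra).
  nra.
Qed.

(** Chords of the unit sphere have length at most 2, which turns the quadratic remainder into the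
    linear bound 2 K; the gradient contributes the third K. *)
Lemma C11_lipschitz (F : R3 -> R) (G : R3 -> R3) (K : R) : C11 F G K ->
  forall x y, on_sphere x -> on_sphere y -> Rabs (F y - F x) <= 3 * K * nrm (vsub y x).
Proof.
  intros [HK H] x y Hx Hy. destruct (H x y Hx Hy) as (_ & H2 & _ & H4).
  pose proof (cauchy_schwarz (G x) (vsub y x)) as C.
  pose proof (nrm_sub_sphere x y Hx Hy). rewrite <- nrm_sqr in H4.
  pose proof (nrm_nonneg (vsub y x)). pose proof (nrm_nonneg (G x)).
  set (n := nrm (vsub y x)) in *.
  assert (nrm (G x) * n <= K * n) by nra.
  assert (K * (n * n) <= K * (2 * n)) by (apply Rmult_le_compat_l; nra).
  apply Rabs_le_between in H4. apply Rabs_le_between in C. apply Rabs_le. lra.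
Qed.

Lemma C11_sph_cont (F : R3 -> R) (G : R3 -> R3) (K : R) : C11 F G K -> sph_cont F.
Proof. intros H. apply (sph_cont_lipschitz F (3 * K)). apply (C11_lipschitz F G K H). Qed.

Lemma C11_gradient_sph_cont (F : R3 -> R) (G : R3 -> R3) (K : R) : C11 F G K ->
  sph_cont (fun x => v1 (G x)) /\ sph_cont (fun x => v2 (G x)) /\ sph_cont (fun x => v3 (G x)).
Proof.
  intros [HK H]. repeat split; apply (sph_cont_lipschitz _ K); intros x y Hx Hy;
    destruct (H x y Hx Hy) as (_ & _ & H3 & _);
    destruct (Rabs_coord_le (vsub (G y) (G x))) as (A1 & A2 & A3).
  - replace (v1 (G y) - v1 (G x)) with (v1 (vsub (G y) (G x))) by (unfold vsub; vunfold; ring). lra.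
  - replace (v2 (G y) - v2 (G x)) with (v2 (vsub (G y) (G x))) by (unfold vsub; vunfold; ring). lra.
  - replace (v3 (G y) - v3 (G x)) with (v3 (vsub (G y) (G x))) by (unfold vsub; vunfold; ring). lra.
Qed.

Lemma cts2_gradient_dot (F : R3 -> R) (G : R3 -> R3) (K : R) (p q r : R -> R -> R) :
  C11 F G K -> cts2 p -> cts2 q -> cts2 r ->
  cts2 (fun b a => dot (G (sph a b)) (mk3 (p b a) (q b a) (r b a))).
Proof.
  intros H Hp Hq Hr. destruct (C11_gradient_sph_cont F G K H) as (H1 & H2 & H3).
  unfold dot. apply cts2_plus; [apply cts2_plus|]; apply cts2_mult; auto.
Qed.

(** Chain rule with explicit remainder: K C^2 comes from the remainder of [F], and K C from the
    gradient applied to the remainder of the curve. *)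
Lemma C11_curve_quad (F : R3 -> R) (G : R3 -> R3) (K C : R) (c : R -> R3) (t : R) (d : R3) :
  C11 F G K -> (forall s, on_sphere (c s)) ->
  (forall h, nrm (vsub (c (t + h)) (c t)) <= C * Rabs h) ->
  (forall h, nrm (vsub (vsub (c (t + h)) (c t)) (vscale h d)) <= C * (h * h)) ->
  forall h, Rabs (F (c (t + h)) - F (c t) - dot (G (c t)) d * h) <= (K * (C * C) + K * C) * (h * h).
Proof.
  intros [HK H] Hc H1 H2 h. specialize (H1 h). specialize (H2 h).
  destruct (H _ _ (Hc t) (Hc (t + h))) as (_ & B2 & _ & B4).
  rewrite <- nrm_sqr in B4.
  set (e := vsub (vsub (c (t + h)) (c t)) (vscale h d)) in *.
  replace (vsub (c (t + h)) (c t)) with (vadd e (vscale h d)) in B4 at 1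
    by (unfold e; generalize (c (t + h)) (c t); intros; veq).
  rewrite dot_vadd_r, dot_vscale_r in B4.
  pose proof (cauchy_schwarz (G (c t)) e) as CS.
  pose proof (nrm_nonneg e). pose proof (nrm_nonneg (G (c t))).
  pose proof (nrm_nonneg (vsub (c (t + h)) (c t))).
  assert (Eh : Rabs h * Rabs h = h * h).
  { rewrite <- Rabs_mult. apply Rabs_pos_eq; nra. }
  pose proof (Rabs_pos h).
  set (n := nrm (vsub (c (t + h)) (c t))) in *.
  assert (n * n <= C * C * (h * h)) by (rewrite <- Eh; nra).
  assert (K * (n * n) <= K * (C * C * (h * h))) by (apply Rmult_le_compat_l; auto).
  assert (nrm (G (c t)) * nrm e <= K * (C * (h * h))) by (apply Rmult_le_compat; auto).
  apply Rabs_le_between in B4. apply Rabs_le_between in CS. apply Rabs_le. lra.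
Qed.

Lemma C11_curve_is_derive (F : R3 -> R) (G : R3 -> R3) (K C : R) (c : R -> R3) (t : R) (d : R3) :
  C11 F G K -> (forall s, on_sphere (c s)) ->
  (forall h, nrm (vsub (c (t + h)) (c t)) <= C * Rabs h) ->
  (forall h, nrm (vsub (vsub (c (t + h)) (c t)) (vscale h d)) <= C * (h * h)) ->
  is_derive (fun s => F (c s)) t (dot (G (c t)) d).
Proof.
  intros H Hc H1 H2. apply quad_is_derive. eexists.
  apply (C11_curve_quad F G K C c t d H Hc H1 H2).
Qed.

Lemma nrm_le_3 (x : R3) (e : R) :
  Rabs (v1 x) <= e -> Rabs (v2 x) <= e -> Rabs (v3 x) <= e -> nrm x <= 3 * e.
Proof. intros. eapply Rle_trans; [apply nrm_le_coords|]. lra. Qed.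

Lemma is_derive_sph_a (F : R3 -> R) (G : R3 -> R3) (K : R) (a b : R) : C11 F G K ->
  is_derive (fun a => F (sph a b)) a (dot (G (sph a b)) (mk3 (cos a * cos b) (cos a * sin b) (- sin a))).
Proof.
  intros H. apply (C11_curve_is_derive F G K 6 (fun a => sph a b)); auto.
  - intro s; apply sph_on_sphere.
  - intro h. replace (6 * Rabs h) with (3 * (2 * Rabs h)) by ring.
    pose proof (sin_lipschitz a h). pose proof (cos_lipschitz a h).
    apply nrm_le_3; unfold sph, vsub; vunfold.
    + replace (_ + _) with (cos b * (sin (a + h) - sin a)) by ring.
      apply Rabs_mult_le_1; auto. apply Rabs_cos_le_1.
    + replace (_ + _) with (sin b * (sin (a + h) - sin a)) by ring.
      apply Rabs_mult_le_1; auto. apply Rabs_sin_le_1.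
    + replace (_ + _) with (cos (a + h) - cos a) by ring. auto.
  - intro h. replace (6 * (h * h)) with (3 * (2 * (h * h))) by ring.
    pose proof (sin_taylor a h). pose proof (cos_taylor a h).
    apply nrm_le_3; unfold sph, vsub; vunfold.
    + match goal with |- Rabs ?e <= _ => replace e with (cos b * (sin (a + h) - sin a - cos a * h)) by ring end.
      apply Rabs_mult_le_1; auto. apply Rabs_cos_le_1.
    + match goal with |- Rabs ?e <= _ => replace e with (sin b * (sin (a + h) - sin a - cos a * h)) by ring end.
      apply Rabs_mult_le_1; auto. apply Rabs_sin_le_1.
    + match goal with |- Rabs ?e <= _ => replace e with (cos (a + h) - cos a - - sin a * h) by ring end. auto.
Qed.

Lemma is_derive_sph_b (F : R3 -> R) (G : R3 -> R3) (K : R) (a b : R) : C11 F G K ->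
  is_derive (fun b => F (sph a b)) b (dot (G (sph a b)) (mk3 (- (sin a * sin b)) (sin a * cos b) 0)).
Proof.
  intros H. apply (C11_curve_is_derive F G K 6 (fun b => sph a b)); auto.
  - intro s; apply sph_on_sphere.
  - intro h. replace (6 * Rabs h) with (3 * (2 * Rabs h)) by ring.
    pose proof (sin_lipschitz b h). pose proof (cos_lipschitz b h). pose proof (Rabs_pos h).
    apply nrm_le_3; unfold sph, vsub; vunfold.
    + replace (_ + _) with (sin a * (cos (b + h) - cos b)) by ring.
      apply Rabs_mult_le_1; auto. apply Rabs_sin_le_1.
    + replace (_ + _) with (sin a * (sin (b + h) - sin b)) by ring.
      apply Rabs_mult_le_1; auto. apply Rabs_sin_le_1.
    + replace (_ + _) with 0 by ring. rewrite Rabs_R0. lra.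
  - intro h. replace (6 * (h * h)) with (3 * (2 * (h * h))) by ring.
    pose proof (sin_taylor b h). pose proof (cos_taylor b h).
    apply nrm_le_3; unfold sph, vsub; vunfold.
    + match goal with |- Rabs ?e <= _ => replace e with (sin a * (cos (b + h) - cos b - - sin b * h)) by ring end.
      apply Rabs_mult_le_1; auto. apply Rabs_sin_le_1.
    + match goal with |- Rabs ?e <= _ => replace e with (sin a * (sin (b + h) - sin b - cos b * h)) by ring end.
      apply Rabs_mult_le_1; auto. apply Rabs_sin_le_1.
    + match goal with |- Rabs ?e <= _ => replace e with 0 by ring end. rewrite Rabs_R0. nra.
Qed.

Lemma is_derive_mult_R (f g : R -> R) (x df dg : R) :
  is_derive f x df -> is_derive g x dg -> is_derive (fun t => f t * g t) x (df * g x + f x * dg).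
Proof.
  intros Hf Hg. apply is_derive_Reals. apply derivable_pt_lim_mult; apply is_derive_Reals; auto.
Qed.

Lemma is_derive_mult_const_R (f : R -> R) (c x df : R) :
  is_derive f x df -> is_derive (fun t => f t * c) x (df * c).
Proof.
  intros Hf. replace (df * c) with (df * c + f x * 0) by ring.
  apply (is_derive_mult_R f (fun _ => c)); auto. apply is_derive_Reals, derivable_pt_lim_const.
Qed.

Lemma is_derive_const_mult_R (f : R -> R) (c x df : R) :
  is_derive f x df -> is_derive (fun t => c * f t) x (c * df).
Proof. intros Hf. apply is_derive_Reals, derivable_pt_lim_scal, is_derive_Reals, Hf. Qed.

Definition axis1 : R3 := mk3 1 0 0.
Definition axis3 : R3 := mk3 0 0 1.

Lemma two_PI_pos : 0 < 2 * PI.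
Proof. pose proof PI_RGT_0. lra. Qed.

Lemma J_ext (F F' : R3 -> R) : (forall x, on_sphere x -> F x = F' x) -> J F = J F'.
Proof.
  intros H. unfold J. apply RInt_ext_R. intros b. apply RInt_ext_R. intros a.
  rewrite H; auto. apply sph_on_sphere.
Qed.

(** Along rotations about the third axis the derivative is the partial derivative in longitude, and
    its integral over a full period vanishes. *)
Lemma J_rotation_field_axis3 (F : R3 -> R) (G : R3 -> R3) (K : R) : C11 F G K ->
  J (fun x => dot (G x) (cross axis3 x)) = 0.
Proof.
  intros H. unfold J.
  set (k := fun b a => dot (G (sph a b)) (mk3 (- (sin a * sin b)) (sin a * cos b) 0) * sin a).
  assert (Hk0 : cts2 (fun b a => dot (G (sph a b)) (mk3 (- (sin a * sin b)) (sin a * cos b) 0))).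
  { apply (cts2_gradient_dot F G K (fun b a => - (sin a * sin b)) (fun b a => sin a * cos b) (fun _ _ => 0)); auto.
    - intros b a. apply continuity_2d_pt_opp. apply (cts2_mult (fun b a => sin a) (fun b a => sin b));
      [apply (cts2_snd sin), cts1_sin|apply (cts2_fst sin), cts1_sin].
    - apply (cts2_mult (fun b a => sin a) (fun b a => cos b));
      [apply (cts2_snd sin), cts1_sin|apply (cts2_fst cos), cts1_cos].
    - intros b a. apply continuity_2d_pt_const. }
  assert (Hk : cts2 k).
  { apply cts2_mult; auto. apply (cts2_snd sin), cts1_sin. }
  transitivity (RInt (fun b => RInt (fun a => k b a) 0 PI) 0 (2 * PI)).
  { apply RInt_ext_R; intros b. apply RInt_ext_R; intros a. unfold k. f_equal.
    f_equal. apply vec_ext; unfold axis3, sph; vunfold; ring. }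
  rewrite RInt_fubini; auto; [|apply two_PI_pos|apply PI_RGT_0].
  rewrite (RInt_ext_R _ (fun _ => 0)); [rewrite RInt_const_R; ring|].
  intros a. unfold k.
  rewrite (RInt_derive_cts1 (fun b => F (sph a b) * sin a)).
  - unfold sph. rewrite sin_2PI, cos_2PI, sin_0, cos_0. ring.
  - intro b. apply (is_derive_mult_const_R (fun b => F (sph a b))). apply (is_derive_sph_b F G K); auto.
  - apply (cts2_slice (fun a b => k b a)). apply cts2_swap; auto.
Qed.

(* The rotation field about the first axis, times [sin a], is minus the divergence in the
   coordinates [(a, b)] of [(sin a sin b F, cos a cos b F)]. *)
Lemma J_rotation_field_axis1 (F : R3 -> R) (G : R3 -> R3) (K : R) : C11 F G K ->
  J (fun x => dot (G x) (cross axis1 x)) = 0.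
Proof.
  intros H. unfold J.
  pose proof (C11_sph_cont F G K H) as HF. unfold sph_cont in HF.
  assert (ss : cts2 (fun b a => sin a)) by apply (cts2_snd sin), cts1_sin.
  assert (sc : cts2 (fun b a => cos a)) by apply (cts2_snd cos), cts1_cos.
  assert (fs : cts2 (fun b a => sin b)) by apply (cts2_fst sin), cts1_sin.
  assert (fc : cts2 (fun b a => cos b)) by apply (cts2_fst cos), cts1_cos.
  assert (opp : forall k, cts2 k -> cts2 (fun b a => - k b a)).
  { intros k Hk b a. apply continuity_2d_pt_opp, Hk. }
  set (Fa := fun b a => dot (G (sph a b)) (mk3 (cos a * cos b) (cos a * sin b) (- sin a))).
  set (Fb := fun b a => dot (G (sph a b)) (mk3 (- (sin a * sin b)) (sin a * cos b) 0)).
  assert (HFa : cts2 Fa).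
  { apply (cts2_gradient_dot F G K (fun b a => cos a * cos b) (fun b a => cos a * sin b) (fun b a => - sin a));
      auto using cts2_mult. }
  assert (HFb : cts2 Fb).
  { apply (cts2_gradient_dot F G K (fun b a => - (sin a * sin b)) (fun b a => sin a * cos b) (fun _ _ => 0)); auto using cts2_mult.
    intros b a. apply continuity_2d_pt_const. }
  (* [dU] is the a-derivative of sin a sin b F, which vanishes at both poles; [dV] is the
     b-derivative of cos a cos b F, which is periodic. Both therefore integrate to zero. *)
  set (dU := fun b a => cos a * sin b * F (sph a b) + sin a * sin b * Fa b a).
  set (dV := fun b a => cos a * - sin b * F (sph a b) + cos a * cos b * Fb b a).
  assert (HdU : cts2 dU).
  { apply cts2_plus; auto using cts2_mult. }
  assert (HdV : cts2 dV).
  { apply cts2_plus; auto using cts2_mult. }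
  transitivity (RInt (fun b => RInt (fun a => - dU b a) 0 PI - RInt (fun a => dV b a) 0 PI) 0 (2 * PI)).
  { apply RInt_ext_R; intros b. rewrite <- RInt_minus_cts1.
    - apply RInt_ext_R; intros a. unfold dU, dV, Fa, Fb. generalize (G (sph a b)); intros [[p q] r].
      unfold axis1, sph; vunfold.
      pose proof (sin2_cos2 b) as B. unfold Rsqr in B.
      match goal with |- ?l = ?r => assert (E : l - r = (1 - (sin b * sin b + cos b * cos b)) * sin a * - (q * cos a)) by ring end.
      rewrite B in E. lra.
    - apply (cts2_slice (fun b a => - dU b a)). auto.
    - apply (cts2_slice dV). auto. }
  rewrite RInt_minus_cts1.
  - rewrite (RInt_ext_R _ (fun _ => 0)).
    2:{ intros b. rewrite (RInt_ext_R _ (fun a => -1 * dU b a)) by (intros; ring).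
        rewrite RInt_scal_cts1 by (apply cts2_slice; auto).
        unfold dU. rewrite (RInt_derive_cts1 (fun a => sin a * sin b * F (sph a b))).
        - rewrite sin_0, sin_PI. ring.
        - intro a. apply (is_derive_mult_R (fun a => sin a * sin b)).
          + apply (is_derive_mult_const_R sin). apply is_derive_Reals, derivable_pt_lim_sin.
          + apply (is_derive_sph_a F G K); auto.
        - apply (cts2_slice dU); auto. }
    rewrite RInt_const_R, RInt_fubini; auto; [|apply two_PI_pos|apply PI_RGT_0].
    rewrite (RInt_ext_R _ (fun _ => 0)); [rewrite RInt_const_R; ring|].
    intros a. unfold dV. rewrite (RInt_derive_cts1 (fun b => cos a * cos b * F (sph a b))).
    + unfold sph. rewrite sin_2PI, cos_2PI, sin_0, cos_0. ring.
    + intro b. apply (is_derive_mult_R (fun b => cos a * cos b)).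
      * apply (is_derive_const_mult_R cos). apply is_derive_Reals, derivable_pt_lim_cos.
      * apply (is_derive_sph_b F G K); auto.
    + apply (cts2_slice (fun a b => dV b a)). apply cts2_swap; auto.
  - apply (cts1_RInt (fun b a => - dU b a)); [left; apply PI_RGT_0|]; auto.
  - apply (cts1_RInt dV); [left; apply PI_RGT_0|]; auto.
Qed.

(** * Linearity and monotonicity of the spherical integral *)

Lemma sph_cont_integrand (F : R3 -> R) : sph_cont F -> cts2 (fun b a => F (sph a b) * sin a).
Proof. intros H. apply cts2_mult; auto. apply (cts2_snd sin), cts1_sin. Qed.

Lemma sph_cont_inner (F : R3 -> R) : sph_cont F -> cts1 (fun b => RInt (fun a => F (sph a b) * sin a) 0 PI).
Proof.
  intros H. apply (cts1_RInt (fun b a => F (sph a b) * sin a)); [left; apply PI_RGT_0|].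
  apply sph_cont_integrand; auto.
Qed.

Lemma J_le (F F' : R3 -> R) : sph_cont F -> sph_cont F' ->
  (forall x, on_sphere x -> F x <= F' x) -> J F <= J F'.
Proof.
  intros HF HF' H. pose proof PI_RGT_0.
  apply RInt_le_cts1; [lra|apply sph_cont_inner; auto|apply sph_cont_inner; auto|].
  intros b _. apply RInt_le_cts1; [lra| | |].
  - apply (cts2_slice (fun b a => F (sph a b) * sin a)), sph_cont_integrand; auto.
  - apply (cts2_slice (fun b a => F' (sph a b) * sin a)), sph_cont_integrand; auto.
  - intros a Ha. apply Rmult_le_compat_r; [left; apply sin_gt_0; lra|]. apply H, sph_on_sphere.
Qed.

Lemma J_plus (F F' : R3 -> R) : sph_cont F -> sph_cont F' ->
  J (fun x => F x + F' x) = J F + J F'.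
Proof.
  intros HF HF'. unfold J. rewrite <- RInt_plus_cts1 by (apply sph_cont_inner; auto).
  apply RInt_ext_R; intros b. rewrite <- RInt_plus_cts1.
  - apply RInt_ext_R; intros; ring.
  - apply (cts2_slice (fun b a => F (sph a b) * sin a)), sph_cont_integrand; auto.
  - apply (cts2_slice (fun b a => F' (sph a b) * sin a)), sph_cont_integrand; auto.
Qed.

Lemma J_scal (c : R) (F : R3 -> R) : sph_cont F -> J (fun x => c * F x) = c * J F.
Proof.
  intros HF. unfold J. rewrite <- RInt_scal_cts1 by (apply sph_cont_inner; auto).
  apply RInt_ext_R; intros b. rewrite <- RInt_scal_cts1.
  - apply RInt_ext_R; intros; ring.
  - apply (cts2_slice (fun b a => F (sph a b) * sin a)), sph_cont_integrand; auto.
Qed.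

Lemma J_const (c : R) : J (fun _ => c) = 4 * PI * c.
Proof.
  unfold J. rewrite (RInt_ext_R _ (fun _ => 2 * c)).
  - rewrite RInt_const_R. ring.
  - intros b. rewrite RInt_scal_cts1 by apply cts1_sin.
    rewrite (RInt_derive_cts1 (fun a => - cos a) sin).
    + rewrite cos_PI, cos_0. ring.
    + intro x. replace (sin x) with (- - sin x) by ring. apply (is_derive_opp cos).
      apply is_derive_Reals, derivable_pt_lim_cos.
    + apply cts1_sin.
Qed.

Lemma sph_cont_const (c : R) : sph_cont (fun _ => c).
Proof. intros b a. apply continuity_2d_pt_const. Qed.

Lemma sph_cont_plus (F F' : R3 -> R) : sph_cont F -> sph_cont F' -> sph_cont (fun x => F x + F' x).
Proof. intros; apply cts2_plus; auto. Qed.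

Lemma sph_cont_scal (c : R) (F : R3 -> R) : sph_cont F -> sph_cont (fun x => c * F x).
Proof. intros; apply (cts2_mult (fun _ _ => c)); auto. apply (sph_cont_const c). Qed.

Lemma J_close (F F' : R3 -> R) (e : R) : sph_cont F -> sph_cont F' ->
  (forall x, on_sphere x -> Rabs (F x - F' x) <= e) -> Rabs (J F - J F') <= 4 * PI * e.
Proof.
  intros HF HF' H. rewrite <- J_const. apply Rabs_le.
  assert (A : J F <= J (fun x => F' x + e)).
  { apply J_le; auto; [apply sph_cont_plus; auto; apply sph_cont_const|].
    intros x Hx. specialize (H x Hx). apply Rabs_le_between in H. lra. }
  assert (B : J F' <= J (fun x => F x + e)).
  { apply J_le; auto; [apply sph_cont_plus; auto; apply sph_cont_const|].
    intros x Hx. specialize (H x Hx). apply Rabs_le_between in H. lra. }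
  rewrite J_plus in A, B; auto; try apply sph_cont_const. lra.
Qed.

(** * Rotations and invariance of the spherical integral *)

Definition frame : Type := (R3 * R3 * R3)%type.

Definition is_frame (e : frame) : Prop := rotation_frame (fst (fst e)) (snd (fst e)) (snd e).

(** The product with the matrix whose columns are the frame; [finv] is the product with its
    transpose. *)
Definition fmap (e : frame) (x : R3) : R3 :=
  vadd (vadd (vscale (v1 x) (fst (fst e))) (vscale (v2 x) (snd (fst e)))) (vscale (v3 x) (snd e)).

Definition finv (e : frame) (y : R3) : R3 :=
  mk3 (dot (fst (fst e)) y) (dot (snd (fst e)) y) (dot (snd e) y).

Lemma lagrange (x y : R3) : dot (cross x y) (cross x y) = dot x x * dot y y - dot x y * dot x y.
Proof. vring. Qed.

Lemma frame_cross (e1 e2 e3 : R3) : rotation_frame e1 e2 e3 -> cross e1 e2 = e3.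
Proof.
  intros (A & B & C & D & E & F & G).
  assert (H : dot (vsub (cross e1 e2) e3) (vsub (cross e1 e2) e3) = 0).
  { rewrite !dot_vsub_l, !dot_vsub_r, lagrange, (dot_comm e3 (cross e1 e2)), G, A, B, C, D. ring. }
  apply dot_self_eq0 in H.
  replace e3 with (vadd e3 (mk3 0 0 0)) by veq. rewrite <- H. unfold vsub. veq.
Qed.

(** Since e3 = e1 x e2, expanding the product z x (e1 x e2) shows z x e3 = 0; the Lagrange identity
    then gives |z|^2 = 0. This is the completeness of the frame. *)
Lemma frame_orthogonal_eq0 (e1 e2 e3 z : R3) : rotation_frame e1 e2 e3 ->
  dot e1 z = 0 -> dot e2 z = 0 -> dot e3 z = 0 -> z = mk3 0 0 0.
Proof.
  intros He H1 H2 H3. pose proof (frame_cross _ _ _ He) as Hc. destruct He as (_ & _ & C & _).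
  assert (T : cross z e3 = mk3 0 0 0).
  { rewrite <- Hc.
    transitivity (vsub (vscale (dot e2 z) e1) (vscale (dot e1 z) e2)); [veq|].
    rewrite H1, H2. veq. }
  pose proof (lagrange z e3) as L. rewrite T, C, (dot_comm z e3), H3 in L.
  apply dot_self_eq0. replace (dot z z) with (dot z z * 1 - 0 * 0) by ring. rewrite <- L. vring.
Qed.

Lemma finv_fmap (e : frame) (x : R3) : is_frame e -> finv e (fmap e x) = x.
Proof.
  destruct e as [[e1 e2] e3]. intros (A & B & C & D & E & F & _). simpl in *.
  unfold finv, fmap; simpl.
  rewrite !dot_vadd_r, !dot_vscale_r, (dot_comm e2 e1), (dot_comm e3 e1), (dot_comm e3 e2), A, B, C, D, E, F.
  apply vec_ext; vunfold; ring.
Qed.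

Lemma fmap_finv (e : frame) (y : R3) : is_frame e -> fmap e (finv e y) = y.
Proof.
  intros He. pose proof (finv_fmap e (finv e y) He) as H.
  assert (Z : vsub (fmap e (finv e y)) y = mk3 0 0 0).
  { destruct e as [[e1 e2] e3]. unfold is_frame in He; simpl in He.
    apply (frame_orthogonal_eq0 e1 e2 e3); auto; rewrite dot_vsub_r;
      apply Rminus_diag_eq.
    - apply (f_equal v1) in H. exact H.
    - apply (f_equal v2) in H. exact H.
    - apply (f_equal v3) in H. exact H. }
  replace y with (vadd (mk3 0 0 0) y) at 2 by veq. rewrite <- Z.
  generalize (fmap e (finv e y)). intros. veq.
Qed.

Lemma dot_finv (e : frame) (x y : R3) : dot (finv e y) x = dot y (fmap e x).
Proof. destruct e as [[e1 e2] e3]. unfold finv, fmap. simpl. vring. Qed.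

Lemma dot_fmap (e : frame) (x y : R3) : is_frame e -> dot (fmap e x) (fmap e y) = dot x y.
Proof. intros He. rewrite <- dot_finv, finv_fmap; auto. Qed.

Lemma nrm_fmap (e : frame) (x : R3) : is_frame e -> nrm (fmap e x) = nrm x.
Proof. intros. unfold nrm. rewrite dot_fmap; auto. Qed.

Lemma nrm_finv (e : frame) (x : R3) : is_frame e -> nrm (finv e x) = nrm x.
Proof. intros. rewrite <- (nrm_fmap e), fmap_finv; auto. Qed.

Lemma fmap_sphere (e : frame) (x : R3) : is_frame e -> on_sphere x -> on_sphere (fmap e x).
Proof. unfold on_sphere. intros He Hx. rewrite dot_fmap; auto. Qed.

Lemma finv_sphere (e : frame) (x : R3) : is_frame e -> on_sphere x -> on_sphere (finv e x).
Proof. unfold on_sphere. intros He Hx. rewrite dot_finv, fmap_finv; auto. Qed.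

Lemma fmap_vsub (e : frame) (x y : R3) : fmap e (vsub x y) = vsub (fmap e x) (fmap e y).
Proof. destruct e as [[e1 e2] e3]. unfold fmap; simpl. veq. Qed.

Lemma finv_vsub (e : frame) (x y : R3) : finv e (vsub x y) = vsub (finv e x) (finv e y).
Proof. destruct e as [[e1 e2] e3]. unfold finv; simpl. veq. Qed.

(** The gradient is pulled back by the transpose, an isometry, so the constant [K] is unchanged;
    this keeps the later estimates uniform over all rotations. *)
Lemma C11_fmap (e : frame) (F : R3 -> R) (G : R3 -> R3) (K : R) : is_frame e -> C11 F G K ->
  C11 (fun x => F (fmap e x)) (fun x => finv e (G (fmap e x))) K.
Proof.
  intros He [HK H]. split; auto. intros x y Hx Hy.
  destruct (H _ _ (fmap_sphere e x He Hx) (fmap_sphere e y He Hy)) as (A & B & C & D).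
  rewrite <- finv_vsub, !nrm_finv, dot_finv by auto.
  rewrite <- fmap_vsub in C, D. rewrite nrm_fmap in C by auto. rewrite dot_fmap in D by auto. auto.
Qed.

Lemma constant_of_quadratic_increments (h : R -> R) (C : R) :
  (forall t s, Rabs (h (t + s) - h t) <= C * (s * s)) -> forall t, h t = h 0.
Proof.
  intros H t.
  assert (Hd : forall x, is_derive h x 0).
  { intro x. apply quad_is_derive. exists C. intro s. rewrite Rmult_0_l, Rminus_0_r. apply H. }
  pose proof (RInt_derive_cts1 h (fun _ => 0) 0 t Hd (cts1_const 0)) as E.
  rewrite RInt_const_R in E. lra.
Qed.

Lemma sph_cont_dot_cross (G : R3 -> R3) (w : R3) :
  sph_cont (fun x => v1 (G x)) -> sph_cont (fun x => v2 (G x)) -> sph_cont (fun x => v3 (G x)) ->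
  sph_cont (fun x => dot (G x) (cross w x)).
Proof.
  unfold sph_cont. intros c1 c2 c3. destruct cts2_sph_coords as (d1 & d2 & d3). intros b a.
  change (continuity_2d_pt (fun b a =>
    v1 (G (sph a b)) * (v2 w * v3 (sph a b) - v3 w * v2 (sph a b)) +
    v2 (G (sph a b)) * (v3 w * v1 (sph a b) - v1 w * v3 (sph a b)) +
    v3 (G (sph a b)) * (v1 w * v2 (sph a b) - v2 w * v1 (sph a b))) b a).
  repeat first [apply c1 | apply c2 | apply c3 | apply d1 | apply d2 | apply d3
    | apply continuity_2d_pt_minus | apply continuity_2d_pt_plus | apply continuity_2d_pt_mult
    | apply continuity_2d_pt_opp | apply continuity_2d_pt_const].
Qed.

(** By the group law the increment at t is the increment at 0 of F' = F o r(t), which has the same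
    [K]. To first order it is s times the integral of the rotation field, which is zero, so the
    increments are quadratic in s and the integral is constant. *)
Lemma one_parameter_invariance (r : R -> frame) (w : R3) (C : R) :
  (forall t, is_frame (r t)) ->
  (forall t s x, fmap (r (t + s)) x = fmap (r t) (fmap (r s) x)) ->
  (forall x, fmap (r 0) x = x) -> dot w w = 1 ->
  (forall s x, on_sphere x -> nrm (vsub (fmap (r s) x) x) <= C * Rabs s) ->
  (forall s x, on_sphere x -> nrm (vsub (vsub (fmap (r s) x) x) (vscale s (cross w x))) <= C * (s * s)) ->
  (forall F G K, C11 F G K -> J (fun x => dot (G x) (cross w x)) = 0) ->
  forall F G K t, C11 F G K -> J (fun x => F (fmap (r t) x)) = J F.
Proof.
  intros Hr Hadd H0 Hw H1 H2 HJ F G K t HF.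
  rewrite (constant_of_quadratic_increments (fun t => J (fun x => F (fmap (r t) x)))
     (4 * PI * (K * (C * C) + K * C))).
  { apply J_ext. intros x _. rewrite H0. auto. }
  clear t. intros t s. cbv beta.
  pose proof (C11_fmap (r t) F G K (Hr t) HF) as HF'.
  set (F' := fun x => F (fmap (r t) x)) in *.
  set (G' := fun x => finv (r t) (G (fmap (r t) x))) in *.
  pose proof (C11_fmap (r s) F' G' K (Hr s) HF') as HF''.
  assert (Hdc : sph_cont (fun x => dot (G' x) (cross w x)))
    by (apply sph_cont_dot_cross; apply (C11_gradient_sph_cont _ _ _ HF')).
  (* The first-order term is inserted at no cost, its integral being zero; the two integrands then
     differ pointwise by O(s^2). *)
  replace (J (fun x => F (fmap (r (t + s)) x)) - J F') with
    (J (fun x => F' (fmap (r s) x)) - J (fun x => F' x + s * dot (G' x) (cross w x))).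
  2:{ rewrite J_plus, J_scal, (HJ F' G' K HF'); auto.
      - rewrite (J_ext (fun x => F (fmap (r (t + s)) x)) (fun x => F' (fmap (r s) x))).
        + unfold F'. ring.
        + intros x _. unfold F'. rewrite Hadd; auto.
      - apply (C11_sph_cont _ _ _ HF').
      - apply sph_cont_scal; auto. }
  rewrite Rmult_assoc. apply J_close.
  - apply (C11_sph_cont _ _ _ HF'').
  - apply sph_cont_plus; [apply (C11_sph_cont _ _ _ HF')|apply sph_cont_scal; auto].
  - intros x Hx.
    pose proof (fmap_sphere (r s) x (Hr s) Hx) as Hy.
    destruct HF' as [HK HF']. destruct (HF' _ _ Hx Hy) as (_ & B2 & _ & B4).
    specialize (H1 s x Hx). specialize (H2 s x Hx).
    rewrite <- nrm_sqr in B4.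
    set (y := fmap (r s) x) in *.
    set (e := vsub (vsub y x) (vscale s (cross w x))) in *.
    replace (vsub y x) with (vadd e (vscale s (cross w x))) in B4 at 1
      by (unfold e; generalize (cross w x); intros; veq).
    rewrite dot_vadd_r, dot_vscale_r in B4.
    pose proof (cauchy_schwarz (G' x) e) as CS.
    pose proof (nrm_nonneg e). pose proof (nrm_nonneg (G' x)). pose proof (nrm_nonneg (vsub y x)).
    assert (Eh : Rabs s * Rabs s = s * s).
    { rewrite <- Rabs_mult. apply Rabs_pos_eq; nra. }
    pose proof (Rabs_pos s).
    set (n := nrm (vsub y x)) in *.
    assert (n * n <= C * C * (s * s)) by (rewrite <- Eh; nra).
    assert (K * (n * n) <= K * (C * C * (s * s))) by (apply Rmult_le_compat_l; auto).
    assert (nrm (G' x) * nrm e <= K * (C * (s * s))) by (apply Rmult_le_compat; auto).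
    apply Rabs_le_between in B4. apply Rabs_le_between in CS. apply Rabs_le. lra.
Qed.

Definition rotX (t : R) : frame := (mk3 1 0 0, mk3 0 (cos t) (sin t), mk3 0 (- sin t) (cos t)).
Definition rotZ (t : R) : frame := (mk3 (cos t) (sin t) 0, mk3 (- sin t) (cos t) 0, mk3 0 0 1).

Ltac trig1 t := let H := fresh in pose proof (sin2_cos2 t) as H; unfold Rsqr in H.

Lemma rotX_frame (t : R) : is_frame (rotX t).
Proof. trig1 t. unfold is_frame, rotation_frame, rotX; vunfold. repeat split; nra. Qed.

Lemma rotZ_frame (t : R) : is_frame (rotZ t).
Proof. trig1 t. unfold is_frame, rotation_frame, rotZ; vunfold. repeat split; nra. Qed.

Lemma sphere_coord_le_1 (x : R3) : on_sphere x -> Rabs (v1 x) <= 1 /\ Rabs (v2 x) <= 1 /\ Rabs (v3 x) <= 1.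
Proof. intros H. rewrite <- (nrm_on_sphere x H). apply Rabs_coord_le. Qed.

Lemma rot_small_1 (u v s : R) : Rabs u <= 1 -> Rabs v <= 1 ->
  Rabs (u * (cos s - 1) - v * sin s) <= 2 * Rabs s /\
  Rabs (u * (cos s - 1) + v * sin s) <= 2 * Rabs s.
Proof.
  intros Hu Hv.
  assert (A : Rabs (u * (cos s - 1)) <= Rabs s).
  { apply Rabs_mult_le_1; auto. pose proof (one_minus_cos_le_abs s). apply Rabs_le; lra. }
  assert (B : Rabs (v * sin s) <= Rabs s) by (apply Rabs_mult_le_1; auto; apply Rabs_sin_le).
  apply Rabs_le_between in A. apply Rabs_le_between in B. split; apply Rabs_le; lra.
Qed.

Lemma rot_small_2 (u v s : R) : Rabs u <= 1 -> Rabs v <= 1 ->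
  Rabs (u * (cos s - 1) - v * (sin s - s)) <= 2 * (s * s) /\
  Rabs (u * (cos s - 1) + v * (sin s - s)) <= 2 * (s * s).
Proof.
  intros Hu Hv.
  assert (A : Rabs (u * (cos s - 1)) <= s * s).
  { apply Rabs_mult_le_1; auto. pose proof (one_minus_cos_le_sqr s). apply Rabs_le; lra. }
  assert (B : Rabs (v * (sin s - s)) <= s * s) by (apply Rabs_mult_le_1; auto; apply sin_sub_le_sqr).
  apply Rabs_le_between in A. apply Rabs_le_between in B. split; apply Rabs_le; lra.
Qed.

Ltac absring t := match goal with |- Rabs ?e <= _ => replace e with t by ring end.

Lemma J_rotX (F : R3 -> R) (G : R3 -> R3) (K t : R) : C11 F G K ->
  J (fun x => F (fmap (rotX t) x)) = J F.
Proof.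
  revert F G K t. apply (one_parameter_invariance rotX axis1 6).
  - apply rotX_frame.
  - intros t s x. unfold rotX, fmap. vdestr. apply vec_ext; vunfold; rewrite ?sin_plus, ?cos_plus; ring.
  - intro x. unfold rotX, fmap. rewrite sin_0, cos_0. vdestr. apply vec_ext; vunfold; ring.
  - unfold axis1; vunfold; ring.
  - intros s x Hx. destruct (sphere_coord_le_1 x Hx) as (A & B & C).
    replace (6 * Rabs s) with (3 * (2 * Rabs s)) by ring. pose proof (Rabs_pos s).
    destruct x as [[x y] z]. vunfold.
    apply nrm_le_3; unfold rotX, fmap, vsub; vunfold.
    + absring 0. rewrite Rabs_R0. lra.
    + absring (y * (cos s - 1) - z * sin s). apply rot_small_1; auto.
    + absring (z * (cos s - 1) + y * sin s). apply rot_small_1; auto.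
  - intros s x Hx. destruct (sphere_coord_le_1 x Hx) as (A & B & C).
    replace (6 * (s * s)) with (3 * (2 * (s * s))) by ring.
    destruct x as [[x y] z]. vunfold.
    apply nrm_le_3; unfold rotX, fmap, vsub, axis1; vunfold.
    + absring 0. rewrite Rabs_R0. nra.
    + absring (y * (cos s - 1) - z * (sin s - s)). apply rot_small_2; auto.
    + absring (z * (cos s - 1) + y * (sin s - s)). apply rot_small_2; auto.
  - apply J_rotation_field_axis1.
Qed.

Lemma J_rotZ (F : R3 -> R) (G : R3 -> R3) (K t : R) : C11 F G K ->
  J (fun x => F (fmap (rotZ t) x)) = J F.
Proof.
  revert F G K t. apply (one_parameter_invariance rotZ axis3 6).
  - apply rotZ_frame.
  - intros t s x. unfold rotZ, fmap. vdestr. apply vec_ext; vunfold; rewrite ?sin_plus, ?cos_plus; ring.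
  - intro x. unfold rotZ, fmap. rewrite sin_0, cos_0. vdestr. apply vec_ext; vunfold; ring.
  - unfold axis3; vunfold; ring.
  - intros s x Hx. destruct (sphere_coord_le_1 x Hx) as (A & B & C).
    replace (6 * Rabs s) with (3 * (2 * Rabs s)) by ring. pose proof (Rabs_pos s).
    destruct x as [[x y] z]. vunfold.
    apply nrm_le_3; unfold rotZ, fmap, vsub; vunfold.
    + absring (x * (cos s - 1) - y * sin s). apply rot_small_1; auto.
    + absring (y * (cos s - 1) + x * sin s). apply rot_small_1; auto.
    + absring 0. rewrite Rabs_R0. lra.
  - intros s x Hx. destruct (sphere_coord_le_1 x Hx) as (A & B & C).
    replace (6 * (s * s)) with (3 * (2 * (s * s))) by ring.
    destruct x as [[x y] z]. vunfold.
    apply nrm_le_3; unfold rotZ, fmap, vsub, axis3; vunfold.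
    + absring (x * (cos s - 1) - y * (sin s - s)). apply rot_small_2; auto.
    + absring (y * (cos s - 1) + x * (sin s - s)). apply rot_small_2; auto.
    + absring 0. rewrite Rabs_R0. nra.
  - apply J_rotation_field_axis3.
Qed.

Lemma angle_exists (x y : R) : x * x + y * y = 1 -> exists t, cos t = x /\ sin t = y.
Proof.
  intros H. assert (Hx : -1 <= x <= 1) by nra.
  assert (S : sqrt (1 - x²) = Rabs y).
  { replace (1 - x²) with (Rsqr y) by (unfold Rsqr; lra). apply sqrt_Rsqr_abs. }
  destruct (Rle_lt_dec 0 y).
  - exists (acos x). rewrite cos_acos, sin_acos, S, Rabs_pos_eq by auto. auto.
  - exists (- acos x). rewrite cos_neg, sin_neg, cos_acos, sin_acos, S, Rabs_left by auto. split; auto; lra.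
Qed.

Lemma cross_fmap_dot (e : frame) (x y z : R3) : is_frame e ->
  dot (cross (fmap e x) (fmap e y)) (fmap e z) = dot (cross x y) z.
Proof.
  intros He. assert (D : dot (cross (fst (fst e)) (snd (fst e))) (snd e) = 1) by apply He.
  transitivity (dot (cross (fst (fst e)) (snd (fst e))) (snd e) * dot (cross x y) z).
  - destruct e as [[e1 e2] e3]. unfold fmap; simpl. vring.
  - rewrite D. ring.
Qed.

Lemma frame_fmap (e : frame) (a b c : R3) : is_frame e -> rotation_frame a b c ->
  rotation_frame (fmap e a) (fmap e b) (fmap e c).
Proof.
  intros He (A & B & C & D & E & F & G). unfold rotation_frame.
  rewrite cross_fmap_dot, !dot_fmap by auto. repeat split; auto.
Qed.

Lemma frame_finv (e : frame) (a b c : R3) : is_frame e -> rotation_frame a b c ->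
  rotation_frame (finv e a) (finv e b) (finv e c).
Proof.
  intros He H.
  rewrite <- (fmap_finv e a), <- (fmap_finv e b), <- (fmap_finv e c) in H by auto.
  destruct H as (A & B & C & D & E & F & G).
  rewrite cross_fmap_dot, ?dot_fmap in * by auto. repeat split; auto.
Qed.

Lemma frame_axis3 (a b : R3) : rotation_frame a b axis3 ->
  exists p q, a = mk3 p q 0 /\ b = mk3 (- q) p 0 /\ p * p + q * q = 1.
Proof.
  intros H. pose proof (frame_cross _ _ _ H) as Hc. destruct H as (A & B & _ & D & E & F & _).
  destruct a as [[p q] z], b as [[p' q'] z']. exists p, q. unfold axis3 in *. vunfold.
  assert (z = 0) by lra. assert (z' = 0) by lra. subst z z'.
  injection Hc as _ _ Hc.
  (* The expression is |a|^2 + |b|^2 - 2 (p q' - q p') = 1 + 1 - 2, the bracket being the third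
     coordinate of the cross product. *)
  assert (Z : (p' + q) * (p' + q) + (q' - p) * (q' - p) = 0) by nra.
  destruct (Rplus_sqr_eq_0 _ _ Z) as [Z1 Z2].
  assert (p' = - q) by lra. assert (q' = p) by lra. subst p' q'.
  repeat split; lra.
Qed.

(** The image of the pole is (sin a sin b, - cos a sin b, cos b): b is read off from the third
    coordinate, then a from the other two, unless w is a pole. *)
Lemma pole_rotation (w : R3) : on_sphere w ->
  exists a b, fmap (rotZ a) (fmap (rotX b) axis3) = w.
Proof.
  unfold on_sphere. destruct w as [[p q] r]. vunfold. intros C.
  assert (Hr : 0 <= 1 - r * r) by nra.
  pose proof (sqrt_sqrt _ Hr) as Hs. set (s := sqrt (1 - r * r)) in *.
  destruct (angle_exists r s) as (b & B1 & B2); [nra|].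
  destruct (Req_dec s 0) as [Z|Z].
  - exists 0, b. assert (p = 0) by nra. assert (q = 0) by nra. subst p q.
    unfold fmap, rotX, rotZ, axis3; apply vec_ext; vunfold; rewrite ?B1, ?B2, ?Z; ring.
  - destruct (angle_exists (- q / s) (p / s)) as (a & A1 & A2).
    { apply Rmult_eq_reg_r with (s * s); [|nra]. transitivity (q * q + p * p); [field; auto|nra]. }
    exists a, b. unfold fmap, rotX, rotZ, axis3; apply vec_ext; vunfold;
      rewrite ?B1, ?B2, ?A1, ?A2; field; auto.
Qed.

Lemma frame_standard : rotation_frame (mk3 1 0 0) (mk3 0 1 0) (mk3 0 0 1).
Proof. unfold rotation_frame; vunfold. repeat split; ring. Qed.

Lemma frame_with_pole (w : R3) : on_sphere w -> exists e, is_frame e /\ snd e = w.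
Proof.
  intros Hw. destruct (pole_rotation w Hw) as (a & b & H).
  exists (fmap (rotZ a) (fmap (rotX b) (mk3 1 0 0)), fmap (rotZ a) (fmap (rotX b) (mk3 0 1 0)), w).
  split; auto. unfold is_frame; simpl. rewrite <- H.
  apply frame_fmap; [apply rotZ_frame|]. apply frame_fmap; [apply rotX_frame|]. apply frame_standard.
Qed.

Lemma frame_inverse (e : frame) : is_frame e -> exists e', is_frame e' /\ forall x, fmap e' x = finv e x.
Proof.
  intros He. exists (finv e (mk3 1 0 0), finv e (mk3 0 1 0), finv e (mk3 0 0 1)). split.
  - apply frame_finv; auto. apply frame_standard.
  - intro x. destruct e as [[e1 e2] e3]. unfold fmap, finv; simpl. veq.
Qed.

(** Undoing the rotation that carries the third axis to the third frame vector leaves a frame with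
    pole [axis3], and such a frame is a rotation about that axis. Invariance under [rotX] and [rotZ]
    thus covers every rotation. *)
Lemma euler_angles (e : frame) : is_frame e ->
  exists a b c, forall x, fmap e x = fmap (rotZ a) (fmap (rotX b) (fmap (rotZ c) x)).
Proof.
  intros He.
  destruct (pole_rotation (snd e)) as (a & b & Hab); [apply He|].
  exists a, b.
  set (f := fun x => finv (rotX b) (finv (rotZ a) x)).
  assert (Hf : forall x, fmap (rotZ a) (fmap (rotX b) (f x)) = x).
  { intro x. unfold f. rewrite !fmap_finv by (apply rotX_frame || apply rotZ_frame). auto. }
  assert (Ff : rotation_frame (f (fst (fst e))) (f (snd (fst e))) (f (snd e))).
  { apply frame_finv; [apply rotX_frame|]. apply frame_finv; [apply rotZ_frame|]. exact He. }
  assert (F3 : f (snd e) = axis3).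
  { rewrite <- Hab. unfold f. rewrite !finv_fmap by (apply rotX_frame || apply rotZ_frame). auto. }
  rewrite F3 in Ff.
  assert (Hf1 : exists p q, f (fst (fst e)) = mk3 p q 0 /\ f (snd (fst e)) = mk3 (-q) p 0 /\ p * p + q * q = 1).
  { apply frame_axis3; auto. }
  destruct Hf1 as (p & q & H1 & H2 & H3).
  destruct (angle_exists p q H3) as (c & C1 & C2). exists c. intro x.
  replace (fmap (rotZ c) x) with (vadd (vadd (vscale (v1 x) (f (fst (fst e)))) (vscale (v2 x) (f (snd (fst e))))) (vscale (v3 x) (f (snd e)))).
  2:{ rewrite H1, H2, F3. unfold fmap, rotZ, axis3. rewrite C1, C2. auto. }
  assert (lin : forall g s t r u v w, fmap g (vadd (vadd (vscale s u) (vscale t v)) (vscale r w)) =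
     vadd (vadd (vscale s (fmap g u)) (vscale t (fmap g v))) (vscale r (fmap g w))).
  { intros [[g1 g2] g3] s t r u v w. unfold fmap; simpl. veq. }
  rewrite !lin, !Hf. reflexivity.
Qed.

Lemma J_fmap (e : frame) (F : R3 -> R) (G : R3 -> R3) (K : R) : is_frame e -> C11 F G K ->
  J (fun x => F (fmap e x)) = J F.
Proof.
  intros He HF. destruct (euler_angles e He) as (a & b & c & H).
  rewrite (J_ext _ (fun x => F (fmap (rotZ a) (fmap (rotX b) (fmap (rotZ c) x)))))
    by (intros; rewrite H; auto).
  pose proof (C11_fmap _ _ _ _ (rotZ_frame a) HF) as HF1.
  pose proof (C11_fmap _ _ _ _ (rotX_frame b) HF1) as HF2.
  rewrite (J_rotZ _ _ _ c HF2), (J_rotX _ _ _ b HF1). apply (J_rotZ _ _ _ a HF).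
Qed.

(** * Test functions: affine functions, products, and cut-offs of squared distances *)

Definition test (F : R3 -> R) : Prop := exists G K, C11 F G K.

Lemma test_sph_cont (F : R3 -> R) : test F -> sph_cont F.
Proof. intros (G & K & H). apply (C11_sph_cont F G K H). Qed.

Lemma test_fmap (e : frame) (F : R3 -> R) : is_frame e -> test F -> test (fun x => F (fmap e x)).
Proof. intros He (G & K & H). eexists; eexists; apply (C11_fmap e F G K He H). Qed.

Lemma test_J_fmap (e : frame) (F : R3 -> R) : is_frame e -> test F -> J (fun x => F (fmap e x)) = J F.
Proof. intros He (G & K & H). apply (J_fmap e F G K He H). Qed.

Lemma test_affine (u : R3) (c : R) : test (fun x => dot x u + c).
Proof.
  exists (fun _ => u), (nrm u + Rabs c). pose proof (nrm_nonneg u). pose proof (Rabs_pos c).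
  split; [lra|]. intros x y Hx Hy.
  pose proof (nrm_nonneg (vsub y x)). pose proof (dot_self_nonneg (vsub y x)).
  repeat split.
  - eapply Rle_trans; [apply Rabs_triang|]. pose proof (cauchy_schwarz x u) as C.
    rewrite (nrm_on_sphere x Hx) in C. lra.
  - lra.
  - replace (vsub u u) with (vscale 0 u) by veq. rewrite nrm_vscale, Rabs_R0. nra.
  - replace (_ - _ - _) with 0; [rewrite Rabs_R0; nra|]. unfold vsub; vring.
Qed.

Lemma Rabs_prod_le (a b A B : R) : Rabs a <= A -> Rabs b <= B -> Rabs (a * b) <= A * B.
Proof. intros. rewrite Rabs_mult. apply Rmult_le_compat; auto; apply Rabs_pos. Qed.

Lemma nrm_vscale_le (c : R) (x : R3) (A B : R) : Rabs c <= A -> nrm x <= B -> nrm (vscale c x) <= A * B.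
Proof. intros. rewrite nrm_vscale. apply Rmult_le_compat; auto; [apply Rabs_pos|apply nrm_nonneg]. Qed.

Lemma test_mult (F1 F2 : R3 -> R) : test F1 -> test F2 -> test (fun x => F1 x * F2 x).
Proof.
  intros (G1 & K1 & H1) (G2 & K2 & H2).
  pose proof (C11_lipschitz _ _ _ H1) as L1. pose proof (C11_lipschitz _ _ _ H2) as L2.
  destruct H1 as [P1 H1], H2 as [P2 H2].
  (* The constant is 9 + 1 + 1: the product of the increments, each with Lipschitz constant 3 K, and
     one remainder from each factor. *)
  exists (fun x => vadd (vscale (F1 x) (G2 x)) (vscale (F2 x) (G1 x))), (11 * (K1 * K2)).
  split; [nra|]. intros x y Hx Hy.
  specialize (L1 x y Hx Hy). specialize (L2 x y Hx Hy).
  destruct (H1 x y Hx Hy) as (A1 & B1 & C1 & D1). destruct (H2 x y Hx Hy) as (A2 & B2 & C2 & D2).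
  destruct (H1 y x Hy Hx) as (A1' & B1' & _). destruct (H2 y x Hy Hx) as (A2' & B2' & _).
  assert (HK : 0 <= K1 * K2) by nra.
  pose proof (nrm_nonneg (vsub y x)) as Hn. rewrite <- nrm_sqr in *.
  set (n := nrm (vsub y x)) in *.
  repeat split.
  - pose proof (Rabs_prod_le _ _ _ _ A1 A2). lra.
  - eapply Rle_trans; [apply nrm_vadd|].
    pose proof (nrm_vscale_le _ _ _ _ A1 B2). pose proof (nrm_vscale_le _ _ _ _ A2 B1). lra.
  - replace (vsub _ _) with
      (vadd (vadd (vscale (F1 y) (vsub (G2 y) (G2 x))) (vscale (F1 y - F1 x) (G2 x)))
            (vadd (vscale (F2 y) (vsub (G1 y) (G1 x))) (vscale (F2 y - F2 x) (G1 x)))).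
    2:{ generalize (F1 x) (F1 y) (F2 x) (F2 y) (G1 x) (G1 y) (G2 x) (G2 y). intros. veq. }
    eapply Rle_trans; [apply nrm_vadd|].
    pose proof (nrm_vadd (vscale (F1 y) (vsub (G2 y) (G2 x))) (vscale (F1 y - F1 x) (G2 x))).
    pose proof (nrm_vadd (vscale (F2 y) (vsub (G1 y) (G1 x))) (vscale (F2 y - F2 x) (G1 x))).
    pose proof (nrm_vscale_le _ _ _ _ A1' C2). pose proof (nrm_vscale_le _ _ _ _ L1 B2).
    pose proof (nrm_vscale_le _ _ _ _ A2' C1). pose proof (nrm_vscale_le _ _ _ _ L2 B1).
    assert (0 <= K1 * K2 * n) by nra. nra.
  - replace (_ - _ - _) with
      (F1 x * (F2 y - F2 x - dot (G2 x) (vsub y x)) + F2 x * (F1 y - F1 x - dot (G1 x) (vsub y x))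
       + (F1 y - F1 x) * (F2 y - F2 x))
      by (rewrite dot_vadd_l, !dot_vscale_l; ring).
    pose proof (Rabs_prod_le _ _ _ _ A1 D2) as T1. pose proof (Rabs_prod_le _ _ _ _ A2 D1) as T2.
    pose proof (Rabs_prod_le _ _ _ _ L1 L2) as T3.
    apply Rabs_le_between in T1. apply Rabs_le_between in T2. apply Rabs_le_between in T3.
    apply Rabs_le. nra.
Qed.

(** A cut-off equal to 1 at s = 0 and to 0 from s = 1/r on, where s will be a squared distance.
    Squaring the positive part smooths its kink to C^{1,1}. *)
Definition bump (r s : R) : R := Rmax 0 (1 - r * s) * Rmax 0 (1 - r * s).

Lemma bump_bounds (r s : R) : 0 < r -> 0 <= s -> 0 <= bump r s <= 1.
Proof.
  intros. unfold bump. assert (0 <= r * s) by nra.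
  unfold Rmax. destruct (Rle_dec 0 (1 - r * s)); nra.
Qed.

Lemma bump_0 (r : R) : bump r 0 = 1.
Proof. unfold bump. rewrite Rmult_0_r, Rminus_0_r, Rmax_right; lra. Qed.

Lemma bump_eq0 (r s : R) : 1 <= r * s -> bump r s = 0.
Proof. intros. unfold bump. rewrite Rmax_left by lra. ring. Qed.

(** The squared positive part is convex with derivative twice the positive part, and that derivative
    has Lipschitz constant 2. *)
Lemma pos_part_taylor (a b : R) :
  0 <= Rmax 0 b * Rmax 0 b - Rmax 0 a * Rmax 0 a - 2 * Rmax 0 a * (b - a) <= (b - a) * (b - a).
Proof.
  pose proof (Rle_0_sqr (b - a)) as H. unfold Rsqr in H.
  destruct (Rle_lt_dec 0 a), (Rle_lt_dec 0 b);
    repeat first [rewrite Rmax_right by lra | rewrite Rmax_left by lra]; split; nra.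
Qed.

Lemma test_bump (D : R3 -> R) (r : R) : 0 < r -> test D -> (forall x, 0 <= D x) ->
  test (fun x => bump r (D x)).
Proof.
  intros Hr (G & K & H) Hpos. pose proof (C11_lipschitz _ _ _ H) as L. destruct H as [HK H].
  set (m := fun s => Rmax 0 (1 - r * s)).
  assert (m1 : forall s, 0 <= s -> 0 <= m s <= 1).
  { intros s Hs. unfold m, Rmax. destruct (Rle_dec 0 (1 - r * s)); nra. }
  assert (m2 : forall s t, Rabs (m t - m s) <= r * Rabs (t - s)).
  { intros s t. unfold m, Rmax. rewrite <- (Rabs_pos_eq r) at 3 by lra. rewrite <- Rabs_mult.
    destruct (Rle_dec 0 (1 - r * s)), (Rle_dec 0 (1 - r * t)); unfold Rabs;
      repeat destruct Rcase_abs; nra. }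
  assert (m3 : forall s t, Rabs (m t * m t - m s * m s + 2 * r * m s * (t - s)) <= r * r * ((t - s) * (t - s))).
  { intros s t. pose proof (pos_part_taylor (1 - r * s) (1 - r * t)) as T.
    fold (m s) (m t) in T.
    replace (1 - r * t - (1 - r * s)) with (- r * (t - s)) in T by ring.
    replace (r * r * ((t - s) * (t - s))) with (- r * (t - s) * (- r * (t - s))) by ring.
    apply Rabs_le. nra. }
  exists (fun x => vscale (- 2 * r * m (D x)) (G x)), ((1 + 2 * r + 2 * r * r) * (1 + K + 12 * K * K)).
  split; [nra|]. intros x y Hx Hy.
  specialize (L x y Hx Hy).
  destruct (H x y Hx Hy) as (A & B & C & E).
  pose proof (nrm_nonneg (vsub y x)) as Hn. rewrite <- nrm_sqr in *.
  set (n := nrm (vsub y x)) in *.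
  pose proof (m1 _ (Hpos x)) as M1. pose proof (m1 _ (Hpos y)) as M1'.
  specialize (m2 (D x) (D y)). specialize (m3 (D x) (D y)).
  set (M := 1 + 2 * r + 2 * r * r). assert (HM : 1 <= M) by (unfold M; nra).
  assert (HM2 : 2 * r <= M) by (unfold M; nra). assert (HM3 : 2 * r * r <= M) by (unfold M; nra).
  assert (c1 : forall s, 0 <= m s <= 1 -> Rabs (-2 * r * m s) <= M).
  { intros s Hs. apply Rabs_le. nra. }
  repeat split.
  - unfold bump. fold (m (D x)). apply Rle_trans with 1; [apply Rabs_le; nra|]. nra.
  - apply Rle_trans with (M * K); [apply nrm_vscale_le; auto|]. nra.
  - replace (vsub _ _) with
      (vadd (vscale (- 2 * r * m (D y)) (vsub (G y) (G x))) (vscale (- 2 * r * (m (D y) - m (D x))) (G x))).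
    2:{ generalize (m (D x)) (m (D y)) (G x) (G y). intros. veq. }
    eapply Rle_trans; [apply nrm_vadd|].
    pose proof (nrm_vscale_le _ _ _ _ (c1 _ M1') C).
    assert (T : Rabs (-2 * r * (m (D y) - m (D x))) <= M * (3 * K * n)).
    { rewrite Rabs_mult. rewrite Rabs_left by nra.
      apply Rle_trans with (2 * r * (r * (3 * K * n))); [apply Rmult_le_compat; try apply Rabs_pos; nra|].
      replace (2 * r * (r * (3 * K * n))) with ((2 * r * r) * (3 * K * n)) by ring.
      apply Rmult_le_compat_r; nra. }
    pose proof (nrm_vscale_le _ _ _ _ T B).
    assert (0 <= M * n) by nra. assert (0 <= K * (M * n)) by nra. assert (0 <= K * (K * (M * n))) by nra.
    fold M. nra.
  - unfold bump. fold (m (D x)) (m (D y)). rewrite dot_vscale_l.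
    replace (_ - _ - _) with
      ((m (D y) * m (D y) - m (D x) * m (D x) + 2 * r * m (D x) * (D y - D x))
       + (- 2 * r * m (D x)) * (D y - D x - dot (G x) (vsub y x))) by ring.
    pose proof (Rabs_prod_le _ _ _ _ (c1 _ M1) E) as T.
    eapply Rle_trans; [apply Rabs_triang|].
    assert (S : (D y - D x) * (D y - D x) <= (3 * K * n) * (3 * K * n)).
    { apply Rabs_le_between in L. nra. }
    assert (S2 : r * r * ((D y - D x) * (D y - D x)) <= M * ((3 * K * n) * (3 * K * n))).
    { apply Rmult_le_compat; [nra|apply Rle_0_sqr|nra|exact S]. }
    assert (0 <= M * (n * n)) by nra. assert (0 <= K * (M * (n * n))) by nra.
    assert (0 <= K * (K * (M * (n * n)))) by nra.
    fold M. nra.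
Qed.

(** The shift [p] allows the cut-off to be centred on a translated cone. The constant 4 comes from
    |x - p| <= 2, which bounds |Q|. *)
Lemma test_polar_part (N : R3 -> Prop) (Q : R3 -> R3) (p : R3) : nrm p <= 1 ->
  (forall x, polar_part N x (Q x)) ->
  test (fun x => dot (Q (vsub x p)) (Q (vsub x p))).
Proof.
  intros Hp HQ. exists (fun x => vscale 2 (Q (vsub x p))), 4. split; [lra|].
  intros x y Hx Hy.
  assert (b : nrm (Q (vsub x p)) <= 2).
  { eapply Rle_trans; [apply (polar_part_nrm N); auto|].
    eapply Rle_trans; [apply nrm_vsub|]. rewrite nrm_on_sphere; auto; lra. }
  pose proof (nrm_nonneg (Q (vsub x p))).
  assert (Ed : vsub (vsub y p) (vsub x p) = vsub y x) by veq.
  repeat split.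
  - rewrite <- nrm_sqr. apply Rabs_le. nra.
  - rewrite nrm_vscale, Rabs_pos_eq; lra.
  - replace (vsub (vscale 2 _) _) with (vscale 2 (vsub (Q (vsub y p)) (Q (vsub x p))))
      by (generalize (Q (vsub y p)) (Q (vsub x p)); intros; veq).
    rewrite nrm_vscale, Rabs_pos_eq by lra.
    pose proof (polar_part_lipschitz N _ _ _ _ (HQ (vsub x p)) (HQ (vsub y p))) as L.
    rewrite Ed in L. pose proof (nrm_nonneg (vsub y x)). lra.
  - pose proof (polar_part_taylor N _ _ _ _ (HQ (vsub x p)) (HQ (vsub y p))) as L.
    rewrite Ed in L. rewrite dot_vscale_l. pose proof (dot_self_nonneg (vsub y x)). lra.
Qed.

(** * Integrability by sandwiching between test functions *)

(** Riemann integrability relative to C^{1,1} functions. Unlike [is_sphere_integral], it passes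
    through rotations directly, because [J] of test functions does. *)
Definition sandwich (f : R3 -> R) (I : R) : Prop := forall eps, 0 < eps ->
  exists F F', test F /\ test F' /\ (forall x, on_sphere x -> F x <= f x <= F' x) /\
    I - eps < J F /\ J F' < I + eps.

(** The integral is the supremum of the [J F] over test functions below f. *)
Lemma sandwich_exists (f : R3 -> R) :
  (forall eps, 0 < eps -> exists F F', test F /\ test F' /\
     (forall x, on_sphere x -> F x <= f x <= F' x) /\ J F' - J F < eps) ->
  exists I, sandwich f I.
Proof.
  intros H.
  destruct (completeness (fun t => exists F, test F /\ (forall x, on_sphere x -> F x <= f x) /\ t = J F)) as [I [HI1 HI2]].
  - destruct (H 1) as (F & F' & TF & TF' & B & _); [lra|].
    exists (J F'). intros t (F0 & TF0 & HF0 & ->). apply J_le; auto using test_sph_cont.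
    intros x Hx. specialize (HF0 x Hx). specialize (B x Hx). lra.
  - destruct (H 1) as (F & F' & TF & TF' & B & _); [lra|].
    exists (J F), F. repeat split; auto. intros x Hx; apply B; auto.
  - exists I. intros eps He. destruct (H eps He) as (F & F' & TF & TF' & B & C).
    exists F, F'. repeat split; auto; try apply B; auto.
    + assert (I <= J F'); [|lra]. apply HI2. intros t (F0 & TF0 & HF0 & ->).
      apply J_le; auto using test_sph_cont.
      intros x Hx. specialize (HF0 x Hx). specialize (B x Hx). lra.
    + assert (J F <= I); [|lra]. apply HI1. exists F. repeat split; auto. intros x Hx; apply B; auto.
Qed.

Lemma sandwich_ext (f f' : R3 -> R) (I : R) : (forall x, on_sphere x -> f x = f' x) ->
  sandwich f I -> sandwich f' I.
Proof.
  intros E H eps He. destruct (H eps He) as (F & F' & A & B & C & D).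
  exists F, F'. repeat split; auto; try apply D; rewrite <- E; auto; apply C; auto.
Qed.

Lemma sandwich_fmap (e : frame) (f : R3 -> R) (I : R) : is_frame e -> sandwich f I ->
  sandwich (fun x => f (fmap e x)) I.
Proof.
  intros He H eps Heps. destruct (H eps Heps) as (F & F' & A & B & C & D & E).
  exists (fun x => F (fmap e x)), (fun x => F' (fmap e x)).
  rewrite !test_J_fmap by auto. repeat split; auto using test_fmap; apply C, fmap_sphere; auto.
Qed.

Lemma riemann_sum_J (F : R3 -> R) : sph_cont F -> is_sphere_integral F (J F).
Proof.
  intros HF eps He.
  assert (Hk : cts2 (fun a b => F (sph a b) * sin a)) by (apply cts2_swap, sph_cont_integrand; auto).
  destruct (double_riemann_sum _ PI (2 * PI) PI_RGT_0 two_PI_pos Hk eps He) as [N HN].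
  exists N. intros n t H1 H2 H3.
  specialize (HN n (fun i j => fst (t i j)) (fun i j => snd (t i j)) H1 H2 H3).
  unfold J. rewrite RInt_fubini; [exact HN|apply two_PI_pos|apply PI_RGT_0|].
  apply sph_cont_integrand; auto.
Qed.

Lemma riemann_sum_le (f g : R3 -> R) (n : nat) (t : nat -> nat -> R * R) : (1 <= n)%nat ->
  tags_ok n t -> (forall x, on_sphere x -> f x <= g x) -> riemann_sum f n t <= riemann_sum g n t.
Proof.
  intros Hn Ht H. unfold riemann_sum.
  assert (Hn0 : 0 < INR n) by (apply lt_0_INR; lia). pose proof PI_RGT_0.
  apply Rmult_le_compat_r; [left; apply Rdiv_lt_0_compat; lra|].
  apply Rmult_le_compat_r; [left; apply Rdiv_lt_0_compat; lra|].
  apply sum_Rle. intros i Hi. apply sum_Rle. intros j Hj.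
  apply Rmult_le_compat_r; [|apply H, sph_on_sphere].
  destruct (Ht i j ltac:(lia) ltac:(lia)) as [[A B] _].
  apply sin_ge_0.
  - eapply Rle_trans; [|exact A]. unfold Rdiv. pose proof (pos_INR i).
    apply Rmult_le_pos; [nra|left; apply Rinv_0_lt_compat; auto].
  - eapply Rle_trans; [exact B|]. apply Rle_div_l; auto.
    rewrite Rmult_comm. apply Rmult_le_compat_l; [lra|]. apply le_INR. lia.
Qed.

Lemma sandwich_is_sphere_integral (f : R3 -> R) (I : R) : sandwich f I -> is_sphere_integral f I.
Proof.
  intros H eps He. destruct (H (eps / 2)) as (F & F' & A & B & C & D & E); [lra|].
  destruct (riemann_sum_J F (test_sph_cont F A) (eps / 2)) as [N1 HN1]; [lra|].
  destruct (riemann_sum_J F' (test_sph_cont F' B) (eps / 2)) as [N2 HN2]; [lra|].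
  exists (N1 + N2)%nat. intros n t Hn1 Hn Ht.
  specialize (HN1 n t ltac:(lia) Hn Ht). specialize (HN2 n t ltac:(lia) Hn Ht).
  pose proof (riemann_sum_le F f n t Hn Ht (fun x Hx => proj1 (C x Hx))).
  pose proof (riemann_sum_le f F' n t Hn Ht (fun x Hx => proj2 (C x Hx))).
  apply Rabs_def2 in HN1. apply Rabs_def2 in HN2. apply Rabs_def1; lra.
Qed.

(** Every grid carries admissible tags, for instance the lower corners of its cells, so two values
    can be compared on a common sum. This pins down what [epsilon] selects. *)
Lemma is_sphere_integral_unique (f : R3 -> R) (I I' : R) :
  is_sphere_integral f I -> is_sphere_integral f I' -> I = I'.
Proof.
  intros H H'. apply cond_eq. intros eps He.
  destruct (H (eps / 2)) as [N HN]; [lra|]. destruct (H' (eps / 2)) as [N' HN']; [lra|].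
  set (n := S (N + N')).
  set (t := fun i j : nat => (INR i * PI / INR n, INR j * (2 * PI) / INR n)).
  assert (Hn0 : 0 < INR n) by (apply lt_0_INR; lia). pose proof PI_RGT_0.
  assert (Hip : 0 < / INR n) by (apply Rinv_0_lt_compat; auto).
  assert (Ht : tags_ok n t).
  { intros i j _ _. unfold t; cbn [fst snd]. rewrite !S_INR. unfold Rdiv.
    split; split; try lra; apply Rmult_le_compat_r; lra. }
  specialize (HN n t ltac:(lia) ltac:(lia) Ht). specialize (HN' n t ltac:(lia) ltac:(lia) Ht).
  apply Rabs_def2 in HN. apply Rabs_def2 in HN'. apply Rabs_def1; lra.
Qed.

Lemma sandwich_sphere_integral (f : R3 -> R) (I : R) : sandwich f I -> sphere_integral f = I.
Proof.
  intros H. apply sandwich_is_sphere_integral in H.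
  apply (is_sphere_integral_unique f); auto.
  unfold sphere_integral. apply epsilon_spec. exists I; auto.
Qed.

Lemma indicator_mul_in (N : R3 -> Prop) (g : R3 -> R) (x : R3) : N x -> indicator_mul N g x = g x.
Proof. unfold indicator_mul. destruct excluded_middle_informative; tauto. Qed.

Lemma indicator_mul_out (N : R3 -> Prop) (g : R3 -> R) (x : R3) : ~ N x -> indicator_mul N g x = 0.
Proof. unfold indicator_mul. destruct excluded_middle_informative; tauto. Qed.

(** * Integrability over a cone with an interior direction *)

Definition has_ball (N : R3 -> Prop) (w : R3) (c : R) : Prop := forall v, nrm v <= c -> N (vadd w v).

Lemma RInt_le_const_cts1 (g : R -> R) (a b M : R) : a <= b -> cts1 g ->
  (forall x, a < x < b -> g x <= M) -> RInt g a b <= M * (b - a).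
Proof.
  intros Hab Hg H. rewrite Rmult_comm, <- RInt_const_R. apply RInt_le_cts1; auto. apply cts1_const.
Qed.

(** Any two points of [P] are at distance at most l, so [P] lies within l of any one of them: the
    large bound M is paid on length at most 2 l, and d elsewhere. No measurability of [P] enters. *)
Lemma RInt_small_support (g : R -> R) (P : R -> Prop) (d l M A : R) :
  0 <= A -> 0 <= d -> 0 <= l -> 0 <= M -> cts1 g ->
  (forall a, 0 <= a <= A -> ~ P a -> g a <= d) ->
  (forall a, 0 <= a <= A -> g a <= M) ->
  (forall a a', 0 <= a -> a < a' -> a' <= A -> P a -> P a' -> a' - a <= l) ->
  RInt g 0 A <= d * A + M * (2 * l).
Proof.
  intros HA Hd Hl HM Hg H1 H2 H3.
  destruct (classic (exists a, 0 <= a <= A /\ P a)) as [(a0 & Ha0 & P0)|Hno].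
  - set (p := Rmax 0 (a0 - l)). set (q := Rmin A (a0 + l)).
    assert (Hp : 0 <= p <= a0) by (unfold p; split; [apply Rmax_l|apply Rmax_lub; lra]).
    assert (Hp2 : a0 - l <= p) by apply Rmax_r.
    assert (Hq : a0 <= q <= A) by (unfold q; split; [apply Rmin_glb; lra|apply Rmin_l]).
    assert (Hq2 : q <= a0 + l) by apply Rmin_r.
    rewrite (RInt_Chasles_cts1 g 0 p A), (RInt_Chasles_cts1 g p q A) by auto.
    assert (I1 : RInt g 0 p <= d * (p - 0)).
    { apply RInt_le_const_cts1; auto; [lra|]. intros x Hx. apply H1; [lra|]. intro Px.
      assert (x < a0 - l). { unfold p, Rmax in Hx. destruct (Rle_dec 0 (a0 - l)); lra. }
      assert (a0 - x <= l) by (apply H3; auto; lra). lra. }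
    assert (I2 : RInt g p q <= M * (q - p)).
    { apply RInt_le_const_cts1; auto; [lra|]. intros x Hx. apply H2; lra. }
    assert (I3 : RInt g q A <= d * (A - q)).
    { apply RInt_le_const_cts1; auto; [lra|]. intros x Hx. apply H1; [lra|]. intro Px.
      assert (a0 + l < x). { unfold q, Rmin in Hx. destruct (Rle_dec A (a0 + l)); lra. }
      assert (x - a0 <= l) by (apply H3; auto; lra). lra. }
    nra.
  - assert (RInt g 0 A <= d * (A - 0)).
    { apply RInt_le_const_cts1; auto. intros x Hx. apply H1; [lra|]. intro Px.
      apply Hno. exists x; split; auto; lra. }
    nra.
Qed.

(** A small sine means an angle near 0 or near pi, and d <= pi - a0 excludes the latter. For d <=
    1/2 one has sin d >= d - d^2 >= d / 2. *)
Lemma sin_le_small (d a0 delta : R) : 0 < a0 <= 1 / 2 -> 0 <= d <= PI - a0 ->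
  delta <= sin a0 / 2 -> sin d < 2 * delta -> d <= 4 * delta.
Proof.
  intros Ha0 Hd Hdel Hs. pose proof PI2_1.
  destruct (Rle_lt_dec d (1 / 2)).
  - pose proof (sin_sub_le_sqr d) as S. apply Rabs_le_between in S. nra.
  - exfalso. assert (sin a0 <= sin d); [|lra].
    destruct (Rle_lt_dec d (PI / 2)).
    + apply sin_incr_1; lra.
    + rewrite <- (sin_PI_x d). apply sin_incr_1; lra.
Qed.

Lemma cone_add_axis (N : R3 -> Prop) (x : R3) (t : R) : is_convex_cone N -> N axis3 -> 0 <= t ->
  N x -> N (vadd x (vscale t axis3)).
Proof. intros [Ha Hs] H3 Ht Hx. apply Ha; auto. Qed.

(* Along a meridian the cone cuts out an interval of directions, so two sections of its boundary
   layer of thickness [delta] are close together. *)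
Lemma meridian_layer (N : R3 -> Prop) (u : R3) (c delta b a a' : R) :
  is_convex_cone N -> 0 < c <= 1 -> has_ball N axis3 c -> 0 < dot u axis3 -> in_dual N u ->
  0 < delta -> delta <= c / 4 -> delta <= sin (c / 4) / 2 ->
  0 <= a -> a < a' -> a' <= PI ->
  ~ N (vsub (sph a b) (vscale delta axis3)) ->
  N (vadd (sph a' b) (vscale delta axis3)) -> a' - a <= 4 * delta.
Proof.
  intros HN Hc Hball Hu3 Hu Hdel Hdel1 Hdel2 Ha Haa Ha' Hout Hin.
  assert (N3 : N axis3).
  { replace axis3 with (vadd axis3 (mk3 0 0 0)) by (unfold axis3; veq). apply Hball.
    apply nrm_le; [lra|]. vunfold. nra. }
  (* Within angle c/4 of the pole the lowered point is still in the ball: its displacement is at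
     most 3 a + delta <= c. *)
  assert (Hca : c / 4 < a).
  { destruct (Rle_lt_dec a (c / 4)); auto. exfalso. apply Hout.
    replace (vsub (sph a b) (vscale delta axis3)) with
      (vadd axis3 (mk3 (sin a * cos b) (sin a * sin b) (cos a - 1 - delta))).
    2:{ unfold sph, vsub, axis3. apply vec_ext; vunfold; ring. }
    apply Hball. eapply Rle_trans; [apply nrm_le_coords|].
    pose proof (Rabs_sin_le a) as S. rewrite (Rabs_pos_eq a) in S by auto.
    pose proof (one_minus_cos_le_abs a) as S2. rewrite (Rabs_pos_eq a) in S2 by auto.
    change (v1 (mk3 (sin a * cos b) (sin a * sin b) (cos a - 1 - delta))) with (sin a * cos b).
    change (v2 (mk3 (sin a * cos b) (sin a * sin b) (cos a - 1 - delta))) with (sin a * sin b).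
    change (v3 (mk3 (sin a * cos b) (sin a * sin b) (cos a - 1 - delta))) with (cos a - 1 - delta).
    assert (Rabs (sin a * cos b) <= a).
    { rewrite Rmult_comm. apply Rabs_mult_le_1; auto. apply Rabs_cos_le_1. }
    assert (Rabs (sin a * sin b) <= a).
    { rewrite Rmult_comm. apply Rabs_mult_le_1; auto. apply Rabs_sin_le_1. }
    assert (Rabs (cos a - 1 - delta) <= a + delta) by (apply Rabs_le; lra).
    lra. }
  assert (Hsa : 0 <= sin a) by (apply sin_ge_0; lra).
  assert (Hsa1 : sin a <= 1) by apply SIN_bound. assert (Hsa1' : sin a' <= 1) by apply SIN_bound.
  (* At the south pole the raised point is a negative multiple of the axis, where [u] would be
     negative. *)
  assert (Hs' : 0 < sin a').
  { destruct Ha' as [Ha'|Ha']; [apply sin_gt_0; lra|]. exfalso. subst a'.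
    specialize (Hu _ Hin). unfold sph in Hu. rewrite sin_PI, cos_PI in Hu.
    replace (vadd _ _) with (vscale (delta - 1) axis3) in Hu by (unfold axis3; apply vec_ext; vunfold; ring).
    rewrite dot_vscale_r in Hu. nra. }
  apply (sin_le_small _ (c / 4)); try lra.
  rewrite sin_minus.
  (* sin a' times the lowered point at a equals sin a times the raised point at a' plus mu times the
     axis. So mu >= 0 would put the lowered point into N, and mu < 0 says sin (a' - a) < delta (sin
     a + sin a'). *)
  set (mu := sin a' * (cos a - delta) - sin a * (cos a' + delta)).
  destruct (Rle_lt_dec 0 mu) as [Hmu|Hmu]; [|unfold mu in Hmu; nra].
  exfalso. apply Hout.
  replace (vsub (sph a b) (vscale delta axis3)) with
    (vscale (/ sin a') (vadd (vscale (sin a) (vadd (sph a' b) (vscale delta axis3))) (vscale mu axis3))).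
  2:{ unfold sph, vsub, mu, axis3. apply vec_ext; vunfold; field; lra. }
  destruct HN as [Hadd Hsc]. apply Hsc; [left; apply Rinv_0_lt_compat; auto|].
  apply Hadd; apply Hsc; auto.
Qed.

(** The pole is an interior direction and [u] is arbitrary in the dual. Cut-offs for the cone and
    for the cone raised by delta along the axis enclose the indicator, and they differ only in a
    layer that each meridian crosses in length O(delta). *)
Lemma cone_sandwich_pole (N : R3 -> Prop) (u : R3) (c : R) :
  closed_convex_cone N -> 0 < c <= 1 -> has_ball N axis3 c -> on_sphere u -> in_dual N u ->
  exists I, sandwich (indicator_mul N (fun x => dot x u)) I.
Proof.
  intros HN Hc Hball Hus Hu. pose proof HN as [Hcl Hcone].
  assert (N3 : N axis3).
  { replace axis3 with (vadd axis3 (mk3 0 0 0)) by (unfold axis3; veq). apply Hball.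
    apply nrm_le; [lra|]. vunfold. nra. }
  assert (n3 : nrm axis3 = 1).
  { apply nrm_on_sphere. unfold on_sphere, axis3. vunfold. ring. }
  (* The ball contains axis3 - c u, so the product is in fact at least c. *)
  assert (Hu3 : 0 < dot u axis3).
  { assert (H : 0 <= dot u (vadd axis3 (vscale (- c) u))).
    { apply Hu, Hball. rewrite nrm_vscale, nrm_on_sphere, Rabs_left; auto; lra. }
    rewrite dot_vadd_r, dot_vscale_r, Hus in H. lra. }
  assert (Hu31 : dot u axis3 <= 1).
  { pose proof (cauchy_schwarz u axis3) as C. rewrite n3, nrm_on_sphere in C by auto.
    apply Rabs_le_between in C. lra. }
  destruct (pointwise_choice _ _ _ (fun x => polar_part_exists N x HN (ex_intro _ _ N3))) as [Q HQ].
  apply sandwich_exists. intros eps Heps.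
  pose proof PI_RGT_0. pose proof PI2_1.
  assert (Hs0 : 0 < sin (c / 4)) by (apply sin_gt_0; lra).
  (* On each meridian the gap is at most delta pi where the cut-offs agree, and at most 3 on length
     2 (4 delta) where they do not; integration over longitude contributes 2 pi. *)
  set (B := 2 * PI * (PI + 24)). assert (HB : 0 < B) by (unfold B; nra).
  set (delta := Rmin (Rmin (c / 4) (sin (c / 4) / 2)) (eps / (2 * B))).
  assert (D0 : 0 < delta).
  { unfold delta. repeat apply Rmin_glb_lt; try lra. apply Rdiv_lt_0_compat; lra. }
  assert (D1 : delta <= c / 4).
  { unfold delta. eapply Rle_trans; [apply Rmin_l|apply Rmin_l]. }
  assert (D2 : delta <= sin (c / 4) / 2).
  { unfold delta. eapply Rle_trans; [apply Rmin_l|apply Rmin_r]. }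
  assert (D3 : delta * B < eps).
  { apply Rle_lt_trans with (eps / (2 * B) * B); [apply Rmult_le_compat_r; [lra|apply Rmin_r]|].
    replace (eps / (2 * B) * B) with (eps / 2) by (field; lra). lra. }
  clearbody delta.
  (* With this r the cut-off vanishes at distance c delta from the cone; a point closer than that
     enters N when raised by delta, since delta times the ball covers the defect. *)
  set (r := / ((c * delta) * (c * delta))).
  assert (Hcd : 0 < c * delta) by nra.
  assert (Hr : 0 < r) by (apply Rinv_0_lt_compat; nra).
  set (chi := fun x => bump r (dot (Q x) (Q x))).
  assert (chi01 : forall x, 0 <= chi x <= 1) by (intro x; apply bump_bounds; auto; apply dot_self_nonneg).
  assert (chi1 : forall x, N x -> chi x = 1).
  { intros x Hx. unfold chi. rewrite (polar_part_in N x (Q x)) by auto. apply bump_0. }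
  assert (chi0 : forall x, chi x <> 0 -> N (vadd x (vscale delta axis3))).
  { intros x Hx. destruct (Rle_lt_dec 1 (r * dot (Q x) (Q x))) as [Hl|Hl].
    - exfalso. apply Hx. apply bump_eq0; auto.
    - destruct (HQ x) as (q1 & _ & _).
      replace (vadd x (vscale delta axis3)) with
        (vadd (vsub x (Q x)) (vscale delta (vadd axis3 (vscale (/ delta) (Q x))))).
      2:{ generalize (Q x). intros. unfold axis3. apply vec_ext; unfold vsub; vdestr; vunfold; field; lra. }
      apply Hcone; auto. apply Hcone; [lra|]. apply Hball.
      rewrite nrm_vscale, Rabs_pos_eq by (left; apply Rinv_0_lt_compat; auto).
      assert (nrm (Q x) <= c * delta).
      { apply nrm_le; [lra|]. unfold r in Hl.
        apply (Rmult_lt_compat_l (c * delta * (c * delta))) in Hl; [|nra].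
        rewrite <- Rmult_assoc, Rinv_r, Rmult_1_r, Rmult_1_l in Hl; nra. }
      apply Rle_div_l in H1; auto. unfold Rdiv in H1. lra. }
  assert (Nup : forall x, N (vsub x (vscale delta axis3)) -> N x).
  { intros x Hx. replace x with (vadd (vsub x (vscale delta axis3)) (vscale delta axis3))
      by (unfold axis3; veq). apply cone_add_axis; auto; lra. }
  assert (down : forall x, vadd (vsub x (vscale delta axis3)) (vscale delta axis3) = x)
    by (intro x; unfold axis3; veq).
  assert (Lb : forall x, on_sphere x -> -1 <= dot x u <= 1).
  { intros x Hx. pose proof (cauchy_schwarz x u) as C. rewrite !nrm_on_sphere in C by auto.
    apply Rabs_le_between in C. lra. }
  set (Fm := fun x => chi (vsub x (vscale delta axis3)) * (dot x u + 0)).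
  (* On the support of the cut-off, x + delta axis3 is in N, so <x, u> >= - delta; the added delta
     keeps the upper function nonnegative. The zero shift is written out to match
     [test_polar_part]. *)
  set (Fp := fun x => chi (vsub x (mk3 0 0 0)) * (dot x u + delta)).
  assert (z0 : forall x, vsub x (mk3 0 0 0) = x) by (intro; veq).
  assert (Tm : test Fm).
  { apply test_mult; [|apply test_affine].
    apply (test_bump (fun x => dot (Q (vsub x (vscale delta axis3))) (Q (vsub x (vscale delta axis3))))); auto.
    - apply (test_polar_part N); auto. rewrite nrm_vscale, n3, Rabs_pos_eq; lra.
    - intro; apply dot_self_nonneg. }
  assert (Tp : test Fp).
  { apply test_mult; [|apply test_affine].
    apply (test_bump (fun x => dot (Q (vsub x (mk3 0 0 0))) (Q (vsub x (mk3 0 0 0))))); auto.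
    - apply (test_polar_part N); auto. apply nrm_le; [lra|]. vunfold. nra.
    - intro; apply dot_self_nonneg. }
  exists Fm, Fp. repeat split; auto.
  - unfold Fm. rewrite Rplus_0_r.
    destruct (Req_dec (chi (vsub x (vscale delta axis3))) 0) as [E|E].
    + rewrite E, Rmult_0_l. destruct (classic (N x)) as [Nx|Nx].
      * rewrite indicator_mul_in by auto. rewrite dot_comm. auto.
      * rewrite indicator_mul_out by auto. lra.
    + apply chi0 in E. rewrite down in E. rewrite indicator_mul_in by auto.
      specialize (chi01 (vsub x (vscale delta axis3))). specialize (Hu x E).
      rewrite dot_comm in Hu. nra.
  - unfold Fp. rewrite z0. destruct (classic (N x)) as [Nx|Nx].
    + rewrite indicator_mul_in, chi1 by auto. lra.
    + rewrite indicator_mul_out by auto.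
      destruct (Req_dec (chi x) 0) as [E|E]; [rewrite E; lra|].
      apply chi0 in E. apply Hu in E. rewrite dot_vadd_r, dot_vscale_r, (dot_comm u x) in E.
      assert (0 <= dot x u + delta) by nra. specialize (chi01 x). apply Rmult_le_pos; lra.
  - pose proof (test_sph_cont _ Tm) as Cm. pose proof (test_sph_cont _ Tp) as Cp.
    apply Rle_lt_trans with (delta * B); auto.
    replace (J Fp - J Fm) with (J (fun x => Fp x + -1 * Fm x)).
    2:{ rewrite J_plus, J_scal; auto using sph_cont_scal. ring. }
    assert (Cd : sph_cont (fun x => Fp x + -1 * Fm x)) by (auto using sph_cont_plus, sph_cont_scal).
    unfold J. replace (delta * B) with (delta * (PI + 24) * (2 * PI - 0)) by (unfold B; ring).
    pose proof two_PI_pos as H2.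
    apply (RInt_le_const_cts1 (fun b => RInt (fun a => (Fp (sph a b) + -1 * Fm (sph a b)) * sin a) 0 PI)
             0 (2 * PI) (delta * (PI + 24)) (Rlt_le _ _ H2) (sph_cont_inner _ Cd)).
    intros b _.
    replace (delta * (PI + 24)) with (delta * PI + 3 * (2 * (4 * delta))) by ring.
    (* Where the two cut-offs differ, the lowered point is outside N and the raised one inside,
       which is the situation of [meridian_layer]. *)
    set (bad := fun a => chi (vsub (sph a b) (vscale delta axis3)) <> chi (sph a b)).
    apply (RInt_small_support _ bad); try lra.
    + apply (cts2_slice (fun b a => (Fp (sph a b) + -1 * Fm (sph a b)) * sin a)).
      exact (sph_cont_integrand _ Cd).
    + intros a Ha Hb. assert (E : chi (vsub (sph a b) (vscale delta axis3)) = chi (sph a b)) by (apply NNPP; auto).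
      unfold Fp, Fm. rewrite z0, E.
      assert (0 <= sin a) by (apply sin_ge_0; lra). assert (sin a <= 1) by apply SIN_bound.
      specialize (chi01 (sph a b)).
      assert (chi (sph a b) * sin a <= 1 * 1) by (apply Rmult_le_compat; lra).
      replace (_ * _) with (chi (sph a b) * sin a * delta) by ring. nra.
    + intros a Ha. unfold Fp, Fm. rewrite z0.
      assert (0 <= sin a) by (apply sin_ge_0; lra). assert (sin a <= 1) by apply SIN_bound.
      pose proof (chi01 (sph a b)). pose proof (chi01 (vsub (sph a b) (vscale delta axis3))).
      pose proof (Lb _ (sph_on_sphere a b)).
      set (p := chi (sph a b)) in *. set (q := chi (vsub (sph a b) (vscale delta axis3))) in *.
      set (L := dot (sph a b) u) in *.
      assert (p * (L + delta) <= 2) by nra. assert (-1 * (q * (L + 0)) <= 1) by nra. nra.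
    + assert (bad_out : forall a, bad a -> ~ N (vsub (sph a b) (vscale delta axis3))).
      { intros a Hb Hn. apply Hb. rewrite !chi1; auto. }
      assert (bad_in : forall a, bad a -> N (vadd (sph a b) (vscale delta axis3))).
      { intros a Hb. destruct (Req_dec (chi (sph a b)) 0) as [E|E]; [|apply chi0; auto].
        destruct (Req_dec (chi (vsub (sph a b) (vscale delta axis3))) 0) as [E2|E2].
        - exfalso. apply Hb. lra.
        - apply chi0 in E2. rewrite down in E2. apply cone_add_axis; auto; lra. }
      intros a a' Ha1 Ha2 Ha3 Ba Ba'.
      apply (meridian_layer N u c delta b a a'); auto; lra.
Qed.

Definition cone_preimage (e : frame) (N : R3 -> Prop) (x : R3) : Prop := N (fmap e x).

Lemma fmap_vadd (e : frame) (x y : R3) : fmap e (vadd x y) = vadd (fmap e x) (fmap e y).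
Proof. destruct e as [[e1 e2] e3]. unfold fmap; simpl. veq. Qed.

Lemma fmap_vscale (e : frame) (c : R) (x : R3) : fmap e (vscale c x) = vscale c (fmap e x).
Proof. destruct e as [[e1 e2] e3]. unfold fmap; simpl. veq. Qed.

Lemma cv3_fmap (e : frame) (s : nat -> R3) (x : R3) : cv3 s x -> cv3 (fun n => fmap e (s n)) (fmap e x).
Proof.
  intros (A & B & C). destruct e as [[e1 e2] e3].
  assert (L : forall p q r, Un_cv (fun n => v1 (s n) * p + v2 (s n) * q + v3 (s n) * r) (v1 x * p + v2 x * q + v3 x * r)).
  { intros p q r. apply is_lim_seq_Reals in A. apply is_lim_seq_Reals in B. apply is_lim_seq_Reals in C.
    apply is_lim_seq_Reals.
    repeat apply is_lim_seq_plus'; apply is_lim_seq_mult'; auto; apply is_lim_seq_const. }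
  unfold fmap; simpl. repeat split.
  - apply (L (v1 e1) (v1 e2) (v1 e3)).
  - apply (L (v2 e1) (v2 e2) (v2 e3)).
  - apply (L (v3 e1) (v3 e2) (v3 e3)).
Qed.

Lemma cone_preimage_closed (e : frame) (N : R3 -> Prop) : closed_convex_cone N ->
  closed_convex_cone (cone_preimage e N).
Proof.
  intros [Hcl [Ha Hs]]. unfold cone_preimage. split; [|split].
  - intros s x H1 H2. apply (Hcl (fun n => fmap e (s n))); auto. apply cv3_fmap; auto.
  - intros x y. rewrite fmap_vadd. apply Ha.
  - intros c x. rewrite fmap_vscale. apply Hs.
Qed.

Lemma cone_preimage_dual (e : frame) (N : R3 -> Prop) (y : R3) : is_frame e ->
  in_dual (cone_preimage e N) y <-> in_dual N (fmap e y).
Proof.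
  intros He. unfold in_dual, cone_preimage. split; intros H x Hx.
  - rewrite dot_comm, <- dot_finv, dot_comm. apply H. rewrite fmap_finv; auto.
  - rewrite <- (dot_fmap e) by auto. auto.
Qed.

(** A rotation carries the interior direction w to the pole, and [sandwich_fmap] carries the result
    back. *)
Lemma cone_sandwich (N : R3 -> Prop) (u w : R3) (c : R) :
  closed_convex_cone N -> 0 < c <= 1 -> on_sphere w -> has_ball N w c -> on_sphere u -> in_dual N u ->
  exists I, sandwich (indicator_mul N (fun x => dot x u)) I.
Proof.
  intros HN Hc Hw Hball Hus Hu. destruct (frame_with_pole w Hw) as (e & He & Hew).
  assert (e3 : fmap e axis3 = w).
  { rewrite <- Hew. destruct e as [[e1 e2] e3]. unfold fmap, axis3; simpl. veq. }
  destruct (cone_sandwich_pole (cone_preimage e N) (finv e u) c) as [I HI]; auto.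
  - apply cone_preimage_closed; auto.
  - intros v Hv. unfold cone_preimage. rewrite fmap_vadd, e3. apply Hball. rewrite nrm_fmap; auto.
  - apply finv_sphere; auto.
  - apply cone_preimage_dual; auto. rewrite fmap_finv; auto.
  - exists I. destruct (frame_inverse e He) as (e' & He' & Hinv).
    apply (sandwich_fmap e') in HI; auto.
    apply sandwich_ext with (2 := HI). intros x _. rewrite Hinv.
    unfold indicator_mul, cone_preimage. rewrite fmap_finv by auto.
    destruct excluded_middle_informative; auto.
    rewrite dot_comm, dot_finv, fmap_finv by auto. apply dot_comm.
Qed.

(** * Interior of a cone that contains its dual *)

Lemma exists_orthogonal (u : R3) : exists x, x <> mk3 0 0 0 /\ dot x u = 0.
Proof.
  destruct u as [[p q] r]. destruct (Req_dec p 0) as [Z|Z].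
  - exists (mk3 1 0 0). split; [|vunfold; rewrite Z; ring]. intro H. injection H. lra.
  - exists (mk3 (- q) p 0). split; [|vunfold; ring]. intro H. injection H. lra.
Qed.

(* A cone contained in a hyperplane has both normals in its dual. *)
Lemma not_in_hyperplane (N : R3 -> Prop) (x : R3) : (forall y, in_dual N y -> N y) ->
  x <> mk3 0 0 0 -> exists p, N p /\ dot x p <> 0.
Proof.
  intros Hd Hx. apply NNPP. intro Hno. apply Hx, dot_self_eq0.
  assert (H : forall p, N p -> dot x p = 0).
  { intros p Hp. apply NNPP. intro Hne. apply Hno. exists p; auto. }
  apply H, Hd. intros p Hp. rewrite H; auto; lra.
Qed.

(** Lying in no plane, the cone contains three independent vectors, and their sum is interior to the
    cone they span. Normalising the sum rescales the radius. *)
Lemma self_dual_ball (N : R3 -> Prop) : closed_convex_cone N ->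
  (forall y, in_dual N y -> N y) ->
  exists w c, 0 < c <= 1 /\ on_sphere w /\ has_ball N w c.
Proof.
  intros [Hcl [Hadd Hsc]] Hd.
  assert (ne : mk3 1 0 0 <> mk3 0 0 0) by (intro H; injection H; lra).
  destruct (not_in_hyperplane N _ Hd ne) as (p & Np & Hp0).
  assert (Hp : p <> mk3 0 0 0) by (intro H; subst p; apply Hp0; vunfold; ring).
  destruct (exists_orthogonal p) as (x & Hx & Hxp).
  destruct (not_in_hyperplane N _ Hd Hx) as (q & Nq & Hq).
  (* As x is orthogonal to p, the product of p x q with p x x is |p|^2 <x, q>, which is nonzero. *)
  assert (Hc : cross p q <> mk3 0 0 0).
  { intro H. assert (L := lagrange p q). rewrite H in L.
    assert (E : dot (cross p q) (cross p x) = dot p p * dot x q - dot x p * dot p q) by vring.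
    rewrite H, Hxp in E.
    assert (Z : dot (mk3 0 0 0) (cross p x) = 0) by vring. rewrite Z in E.
    assert (dot p p <> 0) by (intro K; apply Hp, dot_self_eq0, K).
    assert (dot p p * dot x q = 0) by lra. apply Rmult_integral in H1. tauto. }
  destruct (not_in_hyperplane N _ Hd Hc) as (t & Nt & Ht).
  set (w := vadd (vadd p q) t). set (D := dot (cross p q) t) in *.
  (* Cramer's rule. If all three coefficients of v are at most 1 in absolute value, then w + v has
     nonnegative coefficients. *)
  assert (cram : forall v, v = vadd (vadd (vscale (dot (cross q t) v / D) p) (vscale (dot (cross t p) v / D) q))
                       (vscale (dot (cross p q) v / D) t)).
  { intro v. unfold D in *. clear - Ht. apply vec_ext; vdestr; vunfold; field; auto. }
  assert (inN : forall v, Rabs (dot (cross q t) v / D) <= 1 -> Rabs (dot (cross t p) v / D) <= 1 ->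
     Rabs (dot (cross p q) v / D) <= 1 -> N (vadd w v)).
  { intros v A1 A2 A3. apply Rabs_le_between in A1, A2, A3.
    rewrite (cram v). set (a := _ / D) in A1 |- *. set (b := dot (cross t p) v / D) in *.
    set (g := dot (cross p q) v / D) in *.
    replace (vadd w _) with (vadd (vadd (vscale (1 + a) p) (vscale (1 + b) q)) (vscale (1 + g) t))
      by (unfold w; clearbody a b g; clear; veq).
    repeat apply Hadd; apply Hsc; auto; lra. }
  set (M := 1 + nrm (cross q t) + nrm (cross t p) + nrm (cross p q)).
  pose proof (nrm_nonneg (cross q t)). pose proof (nrm_nonneg (cross t p)). pose proof (nrm_nonneg (cross p q)).
  assert (HM : 1 <= M) by (unfold M; lra).
  assert (HD : 0 < Rabs D) by (apply Rabs_pos_lt; auto).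
  assert (small : forall m v, nrm m <= M -> nrm v <= Rabs D / M -> Rabs (dot m v / D) <= 1).
  { intros m v Hm Hv. unfold Rdiv. rewrite Rabs_mult, Rabs_inv.
    apply Rmult_le_reg_r with (Rabs D); auto. rewrite Rmult_assoc, Rinv_l, Rmult_1_l, Rmult_1_r by lra.
    eapply Rle_trans; [apply cauchy_schwarz|].
    apply Rle_trans with (M * (Rabs D / M)); [apply Rmult_le_compat; auto; apply nrm_nonneg|].
    right; field; lra. }
  assert (ball : has_ball N w (Rabs D / M)).
  { intros v Hv. apply inN; apply small; auto; unfold M; lra. }
  assert (Hw : 0 < nrm w).
  { assert (E : dot (cross p q) w = D) by (unfold w, D; vring).
    destruct (nrm_nonneg w) as [Hl|Hl]; auto. exfalso. apply Ht.
    pose proof (cauchy_schwarz (cross p q) w) as C. rewrite E, <- Hl in C. fold D.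
    apply Rabs_eq_0. apply Rle_antisym; [lra|apply Rabs_pos]. }
  assert (Hc0 : 0 < Rabs D / M / nrm w).
  { apply Rdiv_lt_0_compat; auto. apply Rdiv_lt_0_compat; lra. }
  exists (vscale (/ nrm w) w), (Rmin 1 (Rabs D / M / nrm w)).
  split; [split; [apply Rmin_glb_lt; lra|apply Rmin_l]|]. split.
  - unfold on_sphere. rewrite dot_vscale_l, dot_vscale_r, <- nrm_sqr. field. lra.
  - intros v Hv. replace (vadd _ v) with (vscale (/ nrm w) (vadd w (vscale (nrm w) v))).
    2:{ generalize dependent (nrm w). intros; apply vec_ext; clear - Hw; destruct w as [[? ?] ?], v as [[? ?] ?]; vunfold; field; lra. }
    apply Hsc; [left; apply Rinv_0_lt_compat; auto|]. apply ball.
    rewrite nrm_vscale, Rabs_pos_eq by lra.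
    apply Rle_trans with (nrm w * (Rabs D / M / nrm w)).
    + apply Rmult_le_compat_l; [lra|]. eapply Rle_trans; [exact Hv|apply Rmin_r].
    + right. field. lra.
Qed.

(** * Slopes of the cone over opposite and perpendicular directions *)

(** The situation after rotating [u] to the third axis, stated for the cone instead of the
    sector. *)
Definition polar_cone (N : R3 -> Prop) : Prop :=
  closed_convex_cone N /\ in_dual N axis3 /\ (forall y, in_dual N y -> N y).

Lemma polar_cone_axis (N : R3 -> Prop) : polar_cone N -> N axis3.
Proof. intros (_ & H & H'). auto. Qed.

Lemma polar_cone_scale (N : R3 -> Prop) (c : R) (x : R3) : polar_cone N -> 0 <= c -> N x ->
  N (vscale c x).
Proof. intros [[_ [_ H]] _]. apply H. Qed.

Lemma polar_cone_add (N : R3 -> Prop) (x y : R3) : polar_cone N -> N x -> N y -> N (vadd x y).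
Proof. intros [[_ [H _]] _]. apply H. Qed.

Lemma polar_cone_raise (N : R3 -> Prop) (p q s t : R) : polar_cone N -> s <= t ->
  N (mk3 p q s) -> N (mk3 p q t).
Proof.
  intros HN Hst Hx. replace (mk3 p q t) with (vadd (mk3 p q s) (vscale (t - s) axis3)).
  - apply cone_add_axis; auto; [apply HN|apply polar_cone_axis; auto|lra].
  - unfold axis3; apply vec_ext; vunfold; ring.
Qed.

Lemma polar_cone_height (N : R3 -> Prop) (x : R3) : polar_cone N -> N x -> 0 <= v3 x.
Proof.
  intros (_ & H & _) Hx. specialize (H x Hx). unfold axis3 in H. vdestr. vunfold. lra.
Qed.

(* The normal is tilted towards the axis until its component along [(p, q)] is exactly [- s]. *)
Lemma tilted_normal (N : R3 -> Prop) (p q s : R) : polar_cone N -> 0 < s ->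
  ~ N (mk3 p q s) -> exists a b, in_dual N (mk3 a b 1) /\ a * p + b * q = - s.
Proof.
  intros HN Hs Hx. pose proof (polar_cone_axis N HN) as N3. destruct HN as (HN & Hd3 & Hd).
  destruct (cone_separation N _ HN (ex_intro _ _ N3) Hx) as (n & Hn & Hlt).
  assert (Hn3 : 0 <= v3 n).
  { specialize (Hn _ N3). unfold axis3 in Hn. vdestr; vunfold; lra. }
  destruct n as [[a b] c]. vunfold.
  (* [g] is the height at which (a, b, g) becomes orthogonal to (p, q, s). It exceeds c, so it is
     reached by adding a positive multiple of the axis, which is in the dual; division by [g] gives
     unit height. *)
  set (g := - (a * p + b * q) / s).
  assert (Hg : a * p + b * q = - g * s) by (unfold g; field; lra).
  assert (Hgc : c < g) by nra.
  exists (a / g), (b / g). split.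
  - intros x Hx'. specialize (Hn x Hx'). specialize (Hd3 x Hx').
    replace (dot (a / g, b / g, 1) x) with (/ g * (dot (a, b, c) x + (g - c) * dot axis3 x)).
    + apply Rmult_le_pos; [left; apply Rinv_0_lt_compat; lra|].
      assert (0 <= (g - c) * dot axis3 x) by (apply Rmult_le_pos; lra). unfold axis3 in *. vunfold. lra.
    + unfold axis3. clearbody g. vdestr. vunfold. field. lra.
  - replace (a / g * p + b / g * q) with ((a * p + b * q) / g) by (field; lra).
    rewrite Hg. field. lra.
Qed.

(** One of the normals lies in N because N contains its dual, so the other is nonnegative on it; the
    two unit heights contribute 1. *)
Lemma tilted_normals_obtuse (N : R3 -> Prop) (a b a' b' : R) : polar_cone N ->
  in_dual N (mk3 a b 1) -> in_dual N (mk3 a' b' 1) -> -1 <= a * a' + b * b'.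
Proof.
  intros (_ & _ & Hd) H H'. apply Hd in H'. apply H in H'. vunfold. lra.
Qed.

(** After clearing denominators this is s^2 t^2 <= 1. Here 1 / (1 + s^2) is the squared sine of the
    polar angle with cotangent s. *)
Lemma inv_one_plus_sqr_pair (s t : R) : 0 < s -> 0 < t -> s * t <= 1 ->
  1 <= / (1 + s * s) + / (1 + t * t).
Proof.
  intros. assert (0 < 1 + s * s) by nra. assert (0 < 1 + t * t) by nra.
  replace (/ (1 + s * s) + / (1 + t * t)) with ((2 + s * s + t * t) / ((1 + s * s) * (1 + t * t)))
    by (field; lra).
  apply Rle_div_r; [nra|]. assert (0 < s * t) by nra.
  assert (s * t * (s * t) <= 1) by nra. nra.
Qed.

Lemma three_directions_poly (A Q x y : R) : 0 < A -> 1 < Q -> 0 < x -> x + y <= 1 ->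
  Q * (Q - 1) * ((A + x) * (A + x)) <=
  (Q - x * y) * (Q - x * y) * ((A + 1) * (A + 1) + (Q - 1)).
Proof.
  intros HA HQ Hx Hxy.
  (* As x > 0 and y <= z, replacing y by z only decreases the factor Q - x y; this removes y from
     the problem. *)
  set (z := 1 - x). set (W := Q - x * z).
  assert (HW : 0 <= W) by (unfold W, z; nra).
  assert (HW2 : W <= Q - x * y) by (unfold W, z; nra).
  (* Cauchy-Schwarz for (A + 1, sqrt (Q - 1)) and (1, - z / sqrt (Q - 1)) *)
  assert (C : (A + x) * (A + x) * (Q - 1) <= ((A + 1) * (A + 1) + (Q - 1)) * (Q - 1 + z * z)).
  { assert (E : ((A + 1) * (A + 1) + (Q - 1)) * (Q - 1 + z * z) - (A + x) * (A + x) * (Q - 1) =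
      ((A + 1) * z + (Q - 1)) * ((A + 1) * z + (Q - 1))) by (unfold z; ring).
    pose proof (Rle_0_sqr ((A + 1) * z + (Q - 1))) as S. unfold Rsqr in S. lra. }
  assert (P : Q * (Q - 1 + z * z) <= W * W).
  { assert (E : W * W - Q * (Q - 1 + z * z) = x * z * (x * z) + Q * (x * x)) by (unfold W, z; ring).
    pose proof (Rle_0_sqr (x * z)) as S. unfold Rsqr in S. nra. }
  set (T := (A + 1) * (A + 1) + (Q - 1)) in *.
  assert (HT : 0 <= T) by (unfold T; nra).
  apply Rle_trans with (W * W * T); [|apply Rmult_le_compat_r; auto; nra].
  apply Rle_trans with (Q * (T * (Q - 1 + z * z))); [|nra].
  replace (Q * (Q - 1) * ((A + x) * (A + x))) with (Q * ((A + x) * (A + x) * (Q - 1))) by ring.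
  apply Rmult_le_compat_l; lra.
Qed.

(** If s0 s1 <= 1, two terms suffice. Otherwise the constraints bound s2 from above, and the claim
    becomes (Q - 1) / ((1 + s0^2)(1 + s1^2)) <= 1 / (1 + s2^2), a polynomial inequality in A, Q, x
    and y. *)
Lemma three_directions (s0 s1 s2 c0 c1 c2 : R) : 0 < s0 -> 0 < s1 -> 0 < s2 -> 0 < c0 ->
  s0 * c1 + c0 * s1 <= 1 -> s1 * c2 <= 1 + c1 * s2 -> s0 * s2 <= 1 + c0 * c2 ->
  1 <= / (1 + s0 * s0) + / (1 + s1 * s1) + / (1 + s2 * s2).
Proof.
  intros H0 H1 H2 Hc0 I01 I12 I02.
  assert (P2 : 0 < / (1 + s2 * s2)) by (apply Rinv_0_lt_compat; nra).
  destruct (Rle_lt_dec (s0 * s1) 1) as [Hp|Hp].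
  { pose proof (inv_one_plus_sqr_pair s0 s1 H0 H1 Hp). lra. }
  set (A := s1 * s1). set (Q := s0 * s1 * (s0 * s1)). set (x := c0 * s1). set (y := c1 * s0).
  assert (HA : 0 < A) by (unfold A; nra). assert (HQ : 1 < Q) by (unfold Q; nra).
  assert (Hx : 0 < x) by (unfold x; nra). assert (Hxy : x + y <= 1) by (unfold x, y; lra).
  set (W := Q - x * y).
  assert (HW : 0 < W) by (unfold W; nra).
  (* s1 times [I02] plus c0 times [I12]; the unknown c2 cancels. *)
  assert (K : s2 * (s0 * s1 - c0 * c1) <= s1 + c0) by nra.
  assert (K2 : s2 * s1 * W <= s0 * s1 * (A + x)).
  { assert (E1 : s2 * s1 * W = s0 * s1 * s1 * (s2 * (s0 * s1 - c0 * c1))) by (unfold W, Q, x, y; ring).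
    assert (E2 : s0 * s1 * (A + x) = s0 * s1 * s1 * (s1 + c0)) by (unfold A, x; ring).
    rewrite E1, E2. apply Rmult_le_compat_l; auto. nra. }
  assert (K3 : s2 * s2 * A * (W * W) <= Q * ((A + x) * (A + x))).
  { replace (s2 * s2 * A * (W * W)) with ((s2 * s1 * W) * (s2 * s1 * W)) by (unfold A; ring).
    replace (Q * ((A + x) * (A + x))) with ((s0 * s1 * (A + x)) * (s0 * s1 * (A + x))) by (unfold Q; ring).
    assert (0 <= s2 * s1 * W) by (apply Rmult_le_pos; [apply Rmult_le_pos|]; lra).
    apply Rmult_le_compat; auto. }
  pose proof (three_directions_poly A Q x y HA HQ Hx Hxy) as K4. fold W in K4.
  assert (K5 : s2 * s2 * A * (Q - 1) <= (A + 1) * (A + 1) + (Q - 1)).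
  { apply Rmult_le_reg_r with (W * W); [nra|].
    apply Rle_trans with (Q * ((A + x) * (A + x)) * (Q - 1)).
    - replace (s2 * s2 * A * (Q - 1) * (W * W)) with (s2 * s2 * A * (W * W) * (Q - 1)) by ring.
      apply Rmult_le_compat_r; lra.
    - lra. }
  assert (D0 : 0 < 1 + s0 * s0) by nra. assert (D1 : 0 < 1 + s1 * s1) by nra. assert (D2 : 0 < 1 + s2 * s2) by nra.
  assert (E : 1 - / (1 + s0 * s0) - / (1 + s1 * s1) = (Q - 1) / ((1 + s0 * s0) * (1 + s1 * s1)))
    by (unfold Q; field; lra).
  assert (F : (Q - 1) / ((1 + s0 * s0) * (1 + s1 * s1)) <= / (1 + s2 * s2));
    [|unfold A; lra].
  apply Rle_div_l; [nra|]. apply Rmult_le_reg_l with (1 + s2 * s2); auto.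
  rewrite <- Rmult_assoc, Rinv_r, Rmult_1_l by lra.
  apply Rmult_le_reg_r with A; auto.
  replace ((1 + s0 * s0) * (1 + s1 * s1) * A) with ((A + Q) * (1 + A)) by (unfold A, Q; ring).
  nra.
Qed.

(* In the plane basis [(d, d')], the unit-height normals facing the directions [d, d', - d, - d']
   have planar parts [(- s0, c0)], [(c1, - s1)], [(s2, c2)], [(c3, s3)], and since the dual cone is
   contained in the cone, the pairwise scalar products of these planar parts are at least [- 1]. *)
Lemma four_slopes (s0 s1 s2 s3 c0 c1 c2 c3 m : R) :
  0 < s0 -> 0 < s1 -> 0 < s2 -> 0 < s3 ->
  -1 <= - s0 * s2 + c0 * c2 -> -1 <= - s0 * c1 - c0 * s1 -> -1 <= s2 * c1 - c2 * s1 ->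
  -1 <= - s0 * c3 + c0 * s3 -> -1 <= s2 * c3 + c2 * s3 ->
  m <= / (1 + s0 * s0) -> m <= / (1 + s1 * s1) -> m <= / (1 + s2 * s2) -> m <= / (1 + s3 * s3) ->
  1 + m <= / (1 + s0 * s0) + / (1 + s1 * s1) + / (1 + s2 * s2) + / (1 + s3 * s3).
Proof.
  intros H0 H1 H2 H3 I02 I01 I12 I03 I23 M0 M1 M2 M3.
  assert (P1 : 0 < / (1 + s1 * s1)) by (apply Rinv_0_lt_compat; nra).
  assert (P3 : 0 < / (1 + s3 * s3)) by (apply Rinv_0_lt_compat; nra).
  destruct (Rle_lt_dec (s0 * s2) 1) as [Hp|Hp].
  { pose proof (inv_one_plus_sqr_pair s0 s2 H0 H2 Hp). lra. }
  (* c0 and c2 have the same sign, which decides whether the third normal is taken from d' or from -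
     d'. The direction left out contributes at least m. *)
  assert (Hc : 0 < c0 * c2) by lra.
  destruct (Rtotal_order c0 0) as [Hn|[Hz|Hpos]].
  - pose proof (three_directions s0 s3 s2 (- c0) c3 (- c2) H0 H3 H2 ltac:(lra) ltac:(lra) ltac:(lra) ltac:(lra)). lra.
  - subst c0. lra.
  - pose proof (three_directions s0 s1 s2 c0 c1 c2 H0 H1 H2 Hpos ltac:(lra) ltac:(lra) ltac:(lra)). lra.
Qed.

Lemma slope_of_value (y : R) : 0 < y < 1 -> exists s, 0 < s /\ / (1 + s * s) = y.
Proof.
  intros Hy. assert (1 < / y) by (rewrite <- Rinv_1; apply Rinv_lt_contravar; lra).
  exists (sqrt (/ y - 1)). split; [apply sqrt_lt_R0; lra|].
  rewrite sqrt_sqrt by lra. replace (1 + (/ y - 1)) with (/ y) by ring. apply Rinv_inv.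
Qed.

(** [y] dominates the squared sine of the exit angle over the direction (p, q). It is only an upper
    bound because [y] will come from an upper test function. *)
Definition slope_bound (N : R3 -> Prop) (p q y : R) : Prop :=
  0 <= y /\ forall s, 0 <= s -> N (mk3 p q s) -> / (1 + s * s) <= y.

Lemma slope_bound_excludes (N : R3 -> Prop) (p q y z : R) : slope_bound N p q y -> y < z -> z < 1 ->
  exists s, 0 < s /\ / (1 + s * s) = z /\ ~ N (mk3 p q s).
Proof.
  intros [H0 H] Hz Hz1. destruct (slope_of_value z) as (s & Hs & E); [lra|].
  exists s. repeat split; auto. intro Hn. specialize (H s ltac:(lra) Hn). lra.
Qed.

Lemma four_directions (N : R3 -> Prop) (p q y0 y1 y2 y3 m : R) : polar_cone N -> p * p + q * q = 1 ->
  slope_bound N p q y0 -> slope_bound N (- q) p y1 -> slope_bound N (- p) (- q) y2 ->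
  slope_bound N q (- p) y3 -> m <= y0 -> m <= y1 -> m <= y2 -> m <= y3 ->
  1 + m <= y0 + y1 + y2 + y3.
Proof.
  intros HN Hpq B0 B1 B2 B3 M0 M1 M2 M3.
  pose proof (proj1 B0). pose proof (proj1 B1). pose proof (proj1 B2). pose proof (proj1 B3).
  destruct (Rle_lt_dec 1 y0); [lra|]. destruct (Rle_lt_dec 1 y1); [lra|].
  destruct (Rle_lt_dec 1 y2); [lra|]. destruct (Rle_lt_dec 1 y3); [lra|].
  apply Rnot_lt_le. intro Hlt.
  (* Raising each value by eta keeps it below 1 and gives a point strictly outside the cone, hence a
     normal. The four increments use up at most half of the assumed gap. *)
  set (eta := Rmin (Rmin (Rmin ((1 - y0) / 2) ((1 - y1) / 2)) (Rmin ((1 - y2) / 2) ((1 - y3) / 2)))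
                ((1 + m - (y0 + y1 + y2 + y3)) / 8)).
  assert (E0 : eta <= (1 - y0) / 2) by (unfold eta; eapply Rle_trans; [apply Rmin_l|]; eapply Rle_trans; [apply Rmin_l|apply Rmin_l]).
  assert (E1 : eta <= (1 - y1) / 2) by (unfold eta; eapply Rle_trans; [apply Rmin_l|]; eapply Rle_trans; [apply Rmin_l|apply Rmin_r]).
  assert (E2 : eta <= (1 - y2) / 2) by (unfold eta; eapply Rle_trans; [apply Rmin_l|]; eapply Rle_trans; [apply Rmin_r|apply Rmin_l]).
  assert (E3 : eta <= (1 - y3) / 2) by (unfold eta; eapply Rle_trans; [apply Rmin_l|]; eapply Rle_trans; [apply Rmin_r|apply Rmin_r]).
  assert (E4 : eta <= (1 + m - (y0 + y1 + y2 + y3)) / 8) by apply Rmin_r.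
  assert (E : 0 < eta) by (unfold eta; repeat apply Rmin_glb_lt; lra).
  clearbody eta.
  destruct (slope_bound_excludes _ _ _ _ (y0 + eta) B0) as (s0 & S0 & T0 & X0); [lra|lra|].
  destruct (slope_bound_excludes _ _ _ _ (y1 + eta) B1) as (s1 & S1 & T1 & X1); [lra|lra|].
  destruct (slope_bound_excludes _ _ _ _ (y2 + eta) B2) as (s2 & S2 & T2 & X2); [lra|lra|].
  destruct (slope_bound_excludes _ _ _ _ (y3 + eta) B3) as (s3 & S3 & T3 & X3); [lra|lra|].
  destruct (tilted_normal N _ _ _ HN S0 X0) as (a0 & b0 & D0 & L0).
  destruct (tilted_normal N _ _ _ HN S1 X1) as (a1 & b1 & D1 & L1).
  destruct (tilted_normal N _ _ _ HN S2 X2) as (a2 & b2 & D2 & L2).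
  destruct (tilted_normal N _ _ _ HN S3 X3) as (a3 & b3 & D3 & L3).
  pose proof (tilted_normals_obtuse N _ _ _ _ HN D0 D2) as O02.
  pose proof (tilted_normals_obtuse N _ _ _ _ HN D0 D1) as O01.
  pose proof (tilted_normals_obtuse N _ _ _ _ HN D2 D1) as O12.
  pose proof (tilted_normals_obtuse N _ _ _ _ HN D0 D3) as O03.
  pose proof (tilted_normals_obtuse N _ _ _ _ HN D2 D3) as O23.
  (* The planar scalar product in the orthonormal basis (p, q), (-q, p), in which [four_slopes] is
     stated. *)
  assert (ip : forall a b a' b', a * a' + b * b' =
     (a * p + b * q) * (a' * p + b' * q) + (- a * q + b * p) * (- a' * q + b' * p)).
  { intros. replace (a * a' + b * b') with ((a * a' + b * b') * (p * p + q * q)) by (rewrite Hpq; ring). ring. }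
  rewrite (ip a0 b0), L0 in O02, O01, O03. rewrite (ip a2 b2) in O12, O23.
  set (c0 := - a0 * q + b0 * p) in *. set (c2 := - a2 * q + b2 * p) in *.
  set (c1 := a1 * p + b1 * q) in *. set (c3 := a3 * p + b3 * q) in *.
  replace (- a1 * q + b1 * p) with (- s1) in * by lra.
  replace (- a3 * q + b3 * p) with s3 in * by lra.
  replace (a2 * p + b2 * q) with s2 in * by lra.
  pose proof (four_slopes s0 s1 s2 s3 c0 c1 c2 c3 m S0 S1 S2 S3 ltac:(lra) ltac:(lra) ltac:(lra) ltac:(lra) ltac:(lra)
    ltac:(lra) ltac:(lra) ltac:(lra) ltac:(lra)).
  lra.
Qed.

(** The first axis lies in N as well, so both normals have nonnegative first coordinates a and a'.
    Multiplying (s + a p)(t + a' q) = - p q b b' <= p q (1 + a a') out and dropping nonnegative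
    terms leaves s t <= p q <= 1/2. *)
Lemma facing_normals (N : R3 -> Prop) (p q s t : R) : polar_cone N -> in_dual N (mk3 1 0 0) ->
  0 < p -> 0 < q -> p * p + q * q = 1 -> 0 < s -> 0 < t ->
  ~ N (mk3 p q s) -> ~ N (mk3 q (- p) t) -> s * t <= 1 / 2.
Proof.
  intros HN H1 Hp Hq Hpq Hs Ht Xs Xt.
  destruct (tilted_normal N _ _ _ HN Hs Xs) as (a & b & D & L).
  destruct (tilted_normal N _ _ _ HN Ht Xt) as (a' & b' & D' & L').
  pose proof (tilted_normals_obtuse N _ _ _ _ HN D D') as O.
  pose proof (proj2 (proj2 HN) _ H1) as N1.
  assert (Ha : 0 <= a). { specialize (D _ N1). vunfold. lra. }
  assert (Ha' : 0 <= a'). { specialize (D' _ N1). vunfold. lra. }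
  assert (Hb : b * q = - (s + a * p)) by lra. assert (Hb' : b' * p = t + a' * q) by lra.
  assert (K : (s + a * p) * (t + a' * q) <= p * q * (1 + a * a')).
  { replace ((s + a * p) * (t + a' * q)) with (p * q * (- (b * b'))).
    - apply Rmult_le_compat_l; nra.
    - replace (s + a * p) with (- (b * q)) by lra. rewrite <- Hb'. ring. }
  assert (0 <= s * (a' * q)) by (apply Rmult_le_pos; nra).
  assert (0 <= t * (a * p)) by (apply Rmult_le_pos; nra).
  pose proof (Rle_0_sqr (p - q)) as Hsq. unfold Rsqr in Hsq. nra.
Qed.

(** For Y = 1/(1+s^2) and Z = 1/(1+t^2) one has Y + Z - 1 = (1 - s^2 t^2) Y Z, and s t <= 1/2 leaves
    3/4. The lifts S and T bound the product from below by a quantity that does not involve y and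
    z. *)
Lemma two_directions (N : R3 -> Prop) (p q y z S T : R) : polar_cone N -> in_dual N (mk3 1 0 0) ->
  0 < p -> 0 < q -> p * p + q * q = 1 -> slope_bound N p q y -> slope_bound N q (- p) z ->
  0 <= S -> 0 <= T -> N (mk3 p q S) -> N (mk3 q (- p) T) ->
  1 + 3 / 4 * (/ (1 + S * S) * / (1 + T * T)) <= y + z.
Proof.
  intros HN H1 Hp Hq Hpq By Bz HS HT NS NT.
  assert (By' := proj2 By S HS NS). assert (Bz' := proj2 Bz T HT NT).
  set (f := / (1 + S * S)) in *. set (g := / (1 + T * T)) in *.
  assert (Hf : 0 < f <= 1).
  { split; [apply Rinv_0_lt_compat; nra|]. unfold f. rewrite <- Rinv_1. apply Rinv_le_contravar; nra. }
  assert (Hg : 0 < g <= 1).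
  { split; [apply Rinv_0_lt_compat; nra|]. unfold g. rewrite <- Rinv_1. apply Rinv_le_contravar; nra. }
  destruct (Rle_lt_dec 1 y); [nra|]. destruct (Rle_lt_dec 1 z); [nra|].
  apply Rnot_lt_le. intro Hlt.
  set (eta := Rmin (Rmin ((1 - y) / 2) ((1 - z) / 2)) ((1 + 3 / 4 * (f * g) - (y + z)) / 4)).
  assert (E0 : eta <= (1 - y) / 2) by (unfold eta; eapply Rle_trans; [apply Rmin_l|apply Rmin_l]).
  assert (E1 : eta <= (1 - z) / 2) by (unfold eta; eapply Rle_trans; [apply Rmin_l|apply Rmin_r]).
  assert (E2 : eta <= (1 + 3 / 4 * (f * g) - (y + z)) / 4) by apply Rmin_r.
  assert (E : 0 < eta) by (unfold eta; repeat apply Rmin_glb_lt; lra).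
  clearbody eta.
  destruct (slope_bound_excludes _ _ _ _ (y + eta) By) as (s & S0 & T0 & X0); [lra|lra|].
  destruct (slope_bound_excludes _ _ _ _ (z + eta) Bz) as (t & S1 & T1 & X1); [lra|lra|].
  pose proof (facing_normals N p q s t HN H1 Hp Hq Hpq S0 S1 X0 X1) as K.
  assert (K1 : 0 < s * t) by nra.
  assert (K2 : s * t * (s * t) <= 1 / 4) by nra.
  assert (K3 : 1 + 3 / 4 * (/ (1 + s * s) * / (1 + t * t)) <= / (1 + s * s) + / (1 + t * t)).
  { assert (0 < 1 + s * s) by nra. assert (0 < 1 + t * t) by nra.
    assert (D : 0 < (1 + s * s) * (1 + t * t)) by nra.
    apply Rmult_le_reg_r with ((1 + s * s) * (1 + t * t)); auto.
    replace ((1 + 3 / 4 * (/ (1 + s * s) * / (1 + t * t))) * ((1 + s * s) * (1 + t * t)))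
      with ((1 + s * s) * (1 + t * t) + 3 / 4) by (field; lra).
    replace ((/ (1 + s * s) + / (1 + t * t)) * ((1 + s * s) * (1 + t * t)))
      with (1 + t * t + (1 + s * s)) by (field; lra).
    nra. }
  rewrite T0, T1 in K3.
  assert (f * g <= (y + eta) * (z + eta)) by (apply Rmult_le_compat; lra). lra.
Qed.

(** * The integral over meridians and the lower bound *)

Definition pole_fun (N : R3 -> Prop) : R3 -> R := indicator_mul N (fun x => dot x axis3).

Definition upper_test (N : R3 -> Prop) (F : R3 -> R) : Prop :=
  test F /\ forall x, on_sphere x -> pole_fun N x <= F x.

(* For [F = pole_fun N] this is the squared sine of the polar angle at which the meridian leaves [N]. *)
Definition meridian (F : R3 -> R) (b : R) : R := 2 * RInt (fun a => F (sph a b) * sin a) 0 PI.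

Lemma pole_fun_nonneg (N : R3 -> Prop) (x : R3) : polar_cone N -> 0 <= pole_fun N x.
Proof.
  intros (_ & H & _). unfold pole_fun. destruct (classic (N x)) as [Hx|Hx].
  - rewrite indicator_mul_in by auto. rewrite dot_comm. auto.
  - rewrite indicator_mul_out by auto. lra.
Qed.

Lemma RInt_sin_cos (c : R) : RInt (fun a => cos a * sin a) 0 c = sin c * sin c / 2.
Proof.
  rewrite (RInt_derive_cts1 (fun a => sin a * sin a * (1 / 2))).
  - rewrite sin_0. match goal with |- ?l = ?r => change (@eq R l r) end. field.
  - intro x. replace (cos x * sin x) with ((cos x * sin x + sin x * cos x) * (1 / 2)) by field.
    apply (is_derive_mult_const_R (fun a => sin a * sin a)).
    apply (is_derive_mult_R sin sin); apply is_derive_Reals, derivable_pt_lim_sin.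
  - apply cts1_mult; [apply cts1_cos|apply cts1_sin].
Qed.

(** Together with (cos b, sin b, s) and the pole, N contains the meridian arc up to the angle c with
    cotangent s. There F >= cos a, which contributes sin^2 c / 2 = 1 / (2 (1 + s^2)); the rest of
    the meridian contributes nonnegatively. *)
Lemma meridian_slope_bound (N : R3 -> Prop) (F : R3 -> R) (b : R) : polar_cone N -> upper_test N F ->
  slope_bound N (cos b) (sin b) (meridian F b).
Proof.
  intros HN [TF HF]. pose proof (test_sph_cont F TF) as CF. pose proof PI_RGT_0 as HPI.
  assert (Cg : cts1 (fun a => F (sph a b) * sin a)).
  { apply (cts2_slice (fun b a => F (sph a b) * sin a)), sph_cont_integrand; auto. }
  assert (Fpos : forall a, 0 <= a <= PI -> 0 <= F (sph a b) * sin a).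
  { intros a Ha. apply Rmult_le_pos; [|apply sin_ge_0; lra].
    eapply Rle_trans; [apply (pole_fun_nonneg N); auto|]. apply HF, sph_on_sphere. }
  assert (tail : forall c, 0 <= c <= PI -> 0 <= RInt (fun a => F (sph a b) * sin a) c PI).
  { intros c Hc. replace 0 with ((PI - c) * 0) by ring. rewrite <- RInt_const_R.
    apply RInt_le_cts1; [lra|apply cts1_const|auto|]. intros x Hx. apply Fpos. lra. }
  unfold meridian. split; [specialize (tail 0); lra|].
  intros s Hs Hn. set (c := PI / 2 - atan s).
  pose proof (atan_bound s) as Hat.
  assert (Hat0 : 0 <= atan s).
  { destruct Hs as [Hs|<-]; [left; rewrite <- atan_0; apply atan_increasing; auto|rewrite atan_0; lra]. }
  assert (Hk0 : 0 < 1 + s * s) by nra.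
  set (k := 1 / sqrt (1 + s²)).
  assert (Hk : 0 < k) by (apply Rdiv_lt_0_compat; [lra|apply sqrt_lt_R0; unfold Rsqr; lra]).
  assert (Hkk : k * k = / (1 + s * s)).
  { unfold k. replace (1 / sqrt (1 + s²) * (1 / sqrt (1 + s²))) with (/ (sqrt (1 + s²) * sqrt (1 + s²))).
    - rewrite sqrt_sqrt; [reflexivity|unfold Rsqr; lra].
    - field. apply Rgt_not_eq, sqrt_lt_R0. unfold Rsqr; lra. }
  assert (Hsc : sin c = k) by (unfold c; rewrite sin_shift, cos_atan; auto).
  assert (Hcc : cos c = s * k) by (unfold c; rewrite cos_shift, sin_atan; unfold k; field; apply Rgt_not_eq, sqrt_lt_R0; unfold Rsqr; lra).
  assert (Hc : 0 <= c <= PI) by (unfold c; lra).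
  rewrite (RInt_Chasles_cts1 _ 0 c PI) by auto. specialize (tail c Hc).
  assert (head : RInt (fun a => cos a * sin a) 0 c <= RInt (fun a => F (sph a b) * sin a) 0 c).
  { apply RInt_le_cts1; auto; [lra|apply cts1_mult; [apply cts1_cos|apply cts1_sin]|].
    intros a Ha. assert (Hsa : 0 <= sin a) by (apply sin_ge_0; lra).
    apply Rmult_le_compat_r; auto.
    assert (Hmu : 0 <= cos a - s * sin a).
    { assert (D : 0 <= sin (c - a)) by (apply sin_ge_0; lra).
      rewrite sin_minus, Hsc, Hcc in D. nra. }
    assert (Na : N (sph a b)).
    { replace (sph a b) with (vadd (vscale (sin a) (mk3 (cos b) (sin b) s)) (vscale (cos a - s * sin a) axis3)).
      - apply cone_add_axis; auto; [apply HN|apply polar_cone_axis; auto|apply polar_cone_scale; auto].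
      - unfold sph, axis3. apply vec_ext; vunfold; ring. }
    specialize (HF _ (sph_on_sphere a b)). unfold pole_fun in HF. rewrite indicator_mul_in in HF by auto.
    replace (dot (sph a b) axis3) with (cos a) in HF; [exact HF|].
    unfold sph, axis3. vunfold. ring. }
  rewrite RInt_sin_cos, Hsc in head. lra.
Qed.

Lemma cts1_meridian (F : R3 -> R) : test F -> cts1 (meridian F).
Proof.
  intros TF. apply (cts1_mult (fun _ => 2)); [apply cts1_const|].
  apply sph_cont_inner, test_sph_cont; auto.
Qed.

Lemma J_meridian (F : R3 -> R) : test F -> J F = / 2 * RInt (meridian F) 0 (2 * PI).
Proof.
  intros TF. unfold meridian. rewrite RInt_scal_cts1 by (apply sph_cont_inner, test_sph_cont; auto).
  rewrite <- Rmult_assoc, Rinv_l, Rmult_1_l by lra. reflexivity.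
Qed.

Lemma RInt_shift (g : R -> R) (c a b : R) : cts1 g ->
  RInt (fun x => g (x + c)) a b = RInt g (a + c) (b + c).
Proof.
  intros Hg. pose proof (RInt_comp_lin (V := R_CompleteNormedModule) g 1 c a b) as H.
  rewrite !Rmult_1_l in H. rewrite <- H by (apply ex_RInt_cts1; auto).
  apply RInt_ext_R. intro x. change (g (x + c) = 1 * g (1 * x + c)). rewrite !Rmult_1_l. reflexivity.
Qed.

Definition quarter_sum (g : R -> R) (b : R) : R :=
  g b + g (b + PI / 2) + g (b + PI) + g (b + 3 * (PI / 2)).

Lemma cts1_quarter_sum (g : R -> R) : cts1 g -> cts1 (quarter_sum g).
Proof. intros Hg. repeat apply cts1_plus; auto; apply cts1_shift; auto. Qed.

Lemma RInt_quarter_sum (g : R -> R) : cts1 g -> RInt g 0 (2 * PI) = RInt (quarter_sum g) 0 (PI / 2).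
Proof.
  intros Hg. unfold quarter_sum.
  rewrite !RInt_plus_cts1; auto using cts1_plus, cts1_shift.
  rewrite !RInt_shift by auto.
  rewrite (RInt_Chasles_cts1 g 0 (PI / 2) (2 * PI)), (RInt_Chasles_cts1 g (PI / 2) PI (2 * PI)),
    (RInt_Chasles_cts1 g PI (3 * (PI / 2)) (2 * PI)) by auto.
  rewrite !Rplus_0_l.
  replace (PI / 2 + PI / 2) with PI by field.
  replace (PI / 2 + PI) with (3 * (PI / 2)) by field.
  replace (PI / 2 + 3 * (PI / 2)) with (2 * PI) by field.
  rewrite !Rplus_assoc. reflexivity.
Qed.

Lemma quarter_turns (b : R) :
  cos (b + PI / 2) = - sin b /\ sin (b + PI / 2) = cos b /\
  cos (b + PI) = - cos b /\ sin (b + PI) = - sin b /\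
  cos (b + 3 * (PI / 2)) = sin b /\ sin (b + 3 * (PI / 2)) = - cos b.
Proof.
  rewrite !cos_plus, !sin_plus, cos_PI2, sin_PI2, cos_PI, sin_PI, cos_3PI2, sin_3PI2.
  repeat split; ring.
Qed.

Lemma quarter_slope_bounds (N : R3 -> Prop) (F : R3 -> R) (b : R) : polar_cone N -> upper_test N F ->
  slope_bound N (cos b) (sin b) (meridian F b) /\
  slope_bound N (- sin b) (cos b) (meridian F (b + PI / 2)) /\
  slope_bound N (- cos b) (- sin b) (meridian F (b + PI)) /\
  slope_bound N (sin b) (- cos b) (meridian F (b + 3 * (PI / 2))).
Proof.
  intros HN HF. destruct (quarter_turns b) as (A & B & C & D & E & G).
  pose proof (meridian_slope_bound N F b HN HF).
  pose proof (meridian_slope_bound N F (b + PI / 2) HN HF) as H1.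
  pose proof (meridian_slope_bound N F (b + PI) HN HF) as H2.
  pose proof (meridian_slope_bound N F (b + 3 * (PI / 2)) HN HF) as H3.
  rewrite A, B in H1. rewrite C, D in H2. rewrite E, G in H3. auto.
Qed.

Lemma cos_sin_unit (b : R) : cos b * cos b + sin b * sin b = 1.
Proof. pose proof (sin2_cos2 b) as H. unfold Rsqr in H. lra. Qed.

Lemma quarter_sum_ge_1 (N : R3 -> Prop) (F : R3 -> R) (b : R) : polar_cone N -> upper_test N F ->
  1 <= quarter_sum (meridian F) b.
Proof.
  intros HN HF. destruct (quarter_slope_bounds N F b HN HF) as (A & B & C & D).
  pose proof (four_directions N _ _ _ _ _ _ 0 HN (cos_sin_unit b) A B C D
    (proj1 A) (proj1 B) (proj1 C) (proj1 D)).
  unfold quarter_sum. lra.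
Qed.

(** Half of a quarter turn times the pointwise bound 1, plus a gain c on (l, r). The empty interval
    gives the lower bound itself, a proper one its strict form. *)
Lemma J_upper_test_ge (N : R3 -> Prop) (F : R3 -> R) (c l r : R) : polar_cone N -> upper_test N F ->
  0 <= l -> l <= r -> r <= PI / 2 -> 0 <= c ->
  (forall b, l < b < r -> 1 + c <= quarter_sum (meridian F) b) ->
  PI / 4 + c * (r - l) / 2 <= J F.
Proof.
  intros HN HF Hl Hlr Hr Hc H. pose proof (proj1 HF) as TF.
  rewrite J_meridian, RInt_quarter_sum by auto using cts1_meridian.
  assert (C : cts1 (quarter_sum (meridian F))) by auto using cts1_quarter_sum, cts1_meridian.
  assert (G : forall p q e, p <= q -> (forall b, p < b < q -> e <= quarter_sum (meridian F) b) ->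
     (q - p) * e <= RInt (quarter_sum (meridian F)) p q).
  { intros p q e Hpq He. rewrite <- RInt_const_R. apply RInt_le_cts1; auto. apply cts1_const. }
  rewrite (RInt_Chasles_cts1 _ 0 l (PI / 2)), (RInt_Chasles_cts1 _ l r (PI / 2)) by auto.
  pose proof (G 0 l 1 Hl (fun b _ => quarter_sum_ge_1 N F b HN HF)).
  pose proof (G l r (1 + c) Hlr H).
  pose proof (G r (PI / 2) 1 Hr (fun b _ => quarter_sum_ge_1 N F b HN HF)).
  lra.
Qed.

(** The integral is approached from above by test functions, so only functions above [pole_fun N]
    ever need an estimate. *)
Lemma sandwich_ge (N : R3 -> Prop) (I c : R) : sandwich (pole_fun N) I ->
  (forall F, upper_test N F -> c <= J F) -> c <= I.
Proof.
  intros H HF. apply Rnot_lt_le. intro Hlt. destruct (H (c - I)) as (F & F' & _ & T & B & _ & E); [lra|].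
  assert (c <= J F'); [|lra]. apply HF. split; auto. intros x Hx. apply B; auto.
Qed.

Lemma sandwich_ge_quarter_PI (N : R3 -> Prop) (I : R) : polar_cone N -> sandwich (pole_fun N) I ->
  PI / 4 <= I.
Proof.
  intros HN H. apply (sandwich_ge N); auto. intros F HF. pose proof PI_RGT_0.
  pose proof (J_upper_test_ge N F 0 0 0 HN HF ltac:(lra) ltac:(lra) ltac:(lra) ltac:(lra) ltac:(intros; lra)).
  lra.
Qed.

(** * Strict inequality and the case of equality *)

(** The gain c and the interval are the same for all upper test functions, so the strict inequality
    survives the passage to the integral. *)
Lemma sandwich_gt_quarter_PI (N : R3 -> Prop) (I c l r : R) : polar_cone N -> sandwich (pole_fun N) I ->
  0 <= l -> l < r -> r <= PI / 2 -> 0 < c ->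
  (forall F b, upper_test N F -> l < b < r -> 1 + c <= quarter_sum (meridian F) b) -> PI / 4 < I.
Proof.
  intros HN H Hl Hlr Hr Hc HQ.
  apply Rlt_le_trans with (PI / 4 + c * (r - l) / 2); [nra|].
  apply (sandwich_ge N); auto. intros F HF. apply (J_upper_test_ge N); auto; lra.
Qed.

Lemma horizontal_normalise (N : R3 -> Prop) (a b : R) : 0 < a * a + b * b -> in_dual N (mk3 a b 0) ->
  exists a' b', a' * a' + b' * b' = 1 /\ in_dual N (mk3 a' b' 0).
Proof.
  intros Hab H. set (r := sqrt (a * a + b * b)).
  assert (Hr : 0 < r) by (apply sqrt_lt_R0; auto).
  assert (Hrr : r * r = a * a + b * b) by (apply sqrt_sqrt; lra).
  exists (a / r), (b / r). split.
  - replace (a / r * (a / r) + b / r * (b / r)) with ((a * a + b * b) / (r * r)) by (field; lra).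
    rewrite Hrr. field. lra.
  - intros x Hx. specialize (H x Hx).
    replace (dot (mk3 (a / r) (b / r) 0) x) with (/ r * dot (mk3 a b 0) x).
    + apply Rmult_le_pos; auto. left. apply Rinv_0_lt_compat; auto.
    + clearbody r. vdestr. vunfold. field. lra.
Qed.

(* Separation of the direction [(p, q)] from the (possibly non-closed) planar projection of [N]. *)
Lemma horizontal_normal (N : R3 -> Prop) (p q : R) : polar_cone N -> p * p + q * q = 1 ->
  (forall s, ~ N (mk3 p q s)) -> exists a b, a * a + b * b = 1 /\ in_dual N (mk3 a b 0).
Proof.
  intros HN Hpq Hout.
  (* Planar coordinates along (p, q) and (-q, p). The open half-line Q = 0, P > 0 misses the
     projection of N and is to be separated from it. *)
  set (P := fun x => v1 x * p + v2 x * q). set (Q := fun x => - v1 x * q + v2 x * p).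
  assert (H0 : forall x, N x -> Q x = 0 -> P x <= 0).
  { intros x Hx HQ. apply Rnot_lt_le. intro HP. apply (Hout (v3 x / P x)).
    replace (mk3 p q (v3 x / P x)) with (vscale (/ P x) x).
    - apply polar_cone_scale; auto. left. apply Rinv_0_lt_compat; auto.
    - assert (X1 : v1 x = P x * p).
      { transitivity (v1 x * (p * p + q * q)); [rewrite Hpq; ring|].
        transitivity (P x * p - Q x * q); [unfold P, Q; ring|rewrite HQ; ring]. }
      assert (X2 : v2 x = P x * q).
      { transitivity (v2 x * (p * p + q * q)); [rewrite Hpq; ring|].
        transitivity (P x * q + Q x * p); [unfold P, Q; ring|rewrite HQ; ring]. }
      apply vec_ext;
        [change (/ P x * v1 x = p); rewrite X1|change (/ P x * v2 x = q); rewrite X2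
        |change (/ P x * v3 x = v3 x / P x)]; field; lra. }
  assert (Hpair : forall x y, N x -> N y -> 0 < Q x -> Q y < 0 -> P x * - Q y <= - P y * Q x).
  { intros x y Hx Hy Qx Qy.
    assert (Nz : N (vadd (vscale (- Q y) x) (vscale (Q x) y))).
    { apply polar_cone_add; auto; apply polar_cone_scale; auto; lra. }
    apply H0 in Nz.
    - unfold P at 1 in Nz. unfold P. vunfold. lra.
    - unfold Q at 1. vunfold. fold (Q x) (Q y). unfold Q. vunfold. ring. }
  destruct (classic (exists x, N x /\ 0 < Q x)) as [(x & Nx & Qx)|Hno].
  2:{ apply (horizontal_normalise N q (- p)); [lra|]. intros y Hy.
      assert (~ 0 < Q y) by (intro; apply Hno; exists y; auto).
      assert (E : dot (mk3 q (- p) 0) y = - Q y) by (unfold Q; vring). lra. }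
  destruct (classic (exists y, N y /\ Q y < 0)) as [(y & Ny & Qy)|Hno].
  2:{ apply (horizontal_normalise N (- q) p); [lra|]. intros y Hy.
      assert (~ Q y < 0) by (intro; apply Hno; exists y; auto).
      assert (E : dot (mk3 (- q) p 0) y = Q y) by (unfold Q; vring). lra. }
  (* [al] is the steepest ratio P / Q on the side Q > 0. By [Hpair] it does not exceed any ratio on
     the side Q < 0, so al Q - P >= 0 on all of N. *)
  destruct (completeness (fun t => exists z, N z /\ 0 < Q z /\ t = P z / Q z)) as [al [Hub Hlub]].
  { exists (P y / Q y). intros t (z & Nz & Qz & ->). specialize (Hpair z y Nz Ny Qz Qy).
    apply Rle_div_l; auto. replace (P y / Q y * Q z) with (- P y * Q z / - Q y) by (field; lra).
    apply Rle_div_r; lra. }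
  { exists (P x / Q x), x. auto. }
  apply (horizontal_normalise N (- al * q - p) (al * p - q)).
  { replace ((- al * q - p) * (- al * q - p) + (al * p - q) * (al * p - q)) with
      ((al * al + 1) * (p * p + q * q)) by ring. rewrite Hpq. nra. }
  intros z Nz. assert (E : dot (mk3 (- al * q - p) (al * p - q) 0) z = al * Q z - P z) by (unfold P, Q; vring).
  rewrite E. destruct (Rtotal_order (Q z) 0) as [Qz|[Qz|Qz]].
  - assert (al <= P z / Q z).
    { apply Hlub. intros t (w & Nw & Qw & ->). specialize (Hpair w z Nw Nz Qw Qz).
      apply Rle_div_l; auto. replace (P z / Q z * Q w) with (- P z * Q w / - Q z) by (field; lra).
      apply Rle_div_r; lra. }
    assert (P z / Q z * Q z = P z) by (field; lra). nra.
  - specialize (H0 z Nz Qz). rewrite Qz. lra.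
  - assert (P z / Q z <= al) by (apply Hub; exists z; auto).
    assert (P z / Q z * Q z = P z) by (field; lra). nra.
Qed.

(** If some coordinate direction has no lift into N, separation gives a horizontal normal. If all
    four have one, every direction is a nonnegative combination of two of them, and the sum of the
    four heights serves for all. *)
Lemma horizontal_normal_or_bounded (N : R3 -> Prop) : polar_cone N ->
  (exists a b, a * a + b * b = 1 /\ in_dual N (mk3 a b 0)) \/
  (exists M, 0 <= M /\ forall b, N (mk3 (cos b) (sin b) M)).
Proof.
  intros HN.
  assert (D : forall p q, p * p + q * q = 1 ->
     (exists a b, a * a + b * b = 1 /\ in_dual N (mk3 a b 0)) \/ exists s, 0 <= s /\ N (mk3 p q s)).
  { intros p q Hpq. destruct (classic (exists s, N (mk3 p q s))) as [[s Hs]|Hno].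
    - right. exists s. split; auto. apply (polar_cone_height N _ HN Hs).
    - left. apply (horizontal_normal N p q HN Hpq). intros s Hs. apply Hno. exists s; auto. }
  destruct (D 1 0) as [|(s0 & P0 & H0)]; [ring|auto|].
  destruct (D 0 1) as [|(s1 & P1 & H1)]; [ring|auto|].
  destruct (D (-1) 0) as [|(s2 & P2 & H2)]; [ring|auto|].
  destruct (D 0 (-1)) as [|(s3 & P3 & H3)]; [ring|auto|].
  right. exists (s0 + s1 + s2 + s3). split; [lra|]. intro b.
  pose proof (COS_bound b) as Cb. pose proof (SIN_bound b) as Sb.
  assert (X : exists s, s <= s0 + s2 /\ N (mk3 (cos b) 0 s)).
  { destruct (Rle_lt_dec 0 (cos b)) as [C|C].
    - exists (cos b * s0). split; [nra|].
      replace (mk3 (cos b) 0 (cos b * s0)) with (vscale (cos b) (mk3 1 0 s0)) by (apply vec_ext; vunfold; ring).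
      apply polar_cone_scale; auto.
    - exists (- cos b * s2). split; [nra|].
      replace (mk3 (cos b) 0 (- cos b * s2)) with (vscale (- cos b) (mk3 (-1) 0 s2)) by (apply vec_ext; vunfold; ring).
      apply polar_cone_scale; auto; lra. }
  assert (Y : exists s, s <= s1 + s3 /\ N (mk3 0 (sin b) s)).
  { destruct (Rle_lt_dec 0 (sin b)) as [C|C].
    - exists (sin b * s1). split; [nra|].
      replace (mk3 0 (sin b) (sin b * s1)) with (vscale (sin b) (mk3 0 1 s1)) by (apply vec_ext; vunfold; ring).
      apply polar_cone_scale; auto.
    - exists (- sin b * s3). split; [nra|].
      replace (mk3 0 (sin b) (- sin b * s3)) with (vscale (- sin b) (mk3 0 (-1) s3)) by (apply vec_ext; vunfold; ring).
      apply polar_cone_scale; auto; lra. }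
  destruct X as (s & Hs & Xs). destruct Y as (t & Ht & Yt).
  apply (polar_cone_raise N _ _ (s + t)); auto; [lra|].
  replace (mk3 (cos b) (sin b) (s + t)) with (vadd (mk3 (cos b) 0 s) (mk3 0 (sin b) t))
    by (apply vec_ext; vunfold; ring).
  apply polar_cone_add; auto.
Qed.

(** A common height M forces all four values to be at least 1 / (1 + M^2), and this minimum is the
    gain in [four_directions]. *)
Lemma bounded_strict (N : R3 -> Prop) (I M : R) : polar_cone N -> sandwich (pole_fun N) I ->
  0 <= M -> (forall b, N (mk3 (cos b) (sin b) M)) -> PI / 4 < I.
Proof.
  intros HN HI HM Hb. pose proof PI_RGT_0.
  assert (Hm : 0 < / (1 + M * M)) by (apply Rinv_0_lt_compat; nra).
  apply (sandwich_gt_quarter_PI N I (/ (1 + M * M)) 0 (PI / 2)); auto; try lra.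
  intros F b HF _. destruct (quarter_slope_bounds N F b HN HF) as (A & B & C & D).
  destruct (quarter_turns b) as (T1 & T2 & T3 & T4 & T5 & T6).
  pose proof (Hb (b + PI / 2)) as N1. rewrite T1, T2 in N1.
  pose proof (Hb (b + PI)) as N2. rewrite T3, T4 in N2.
  pose proof (Hb (b + 3 * (PI / 2))) as N3. rewrite T5, T6 in N3.
  pose proof (four_directions N _ _ _ _ _ _ (/ (1 + M * M)) HN (cos_sin_unit b) A B C D
    (proj2 A M HM (Hb b)) (proj2 B M HM N1) (proj2 C M HM N2) (proj2 D M HM N3)).
  unfold quarter_sum. lra.
Qed.

(** (cos g, sin g) is a nonnegative combination of (cos f, sin f) and (1, 0). The latter lies in N
    at height 0, so the height is only multiplied by sin g / sin f <= 1. *)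
Lemma tilt_towards_axis (N : R3 -> Prop) (s f g : R) : polar_cone N -> N (mk3 1 0 0) ->
  0 <= g <= f -> 0 < f <= PI / 2 -> N (mk3 (cos f) (sin f) s) -> N (mk3 (cos g) (sin g) s).
Proof.
  intros HN N1 Hg Hf Hn. pose proof PI_RGT_0.
  assert (Hs : 0 <= s) by apply (polar_cone_height N _ HN Hn).
  assert (Sf : 0 < sin f) by (apply sin_gt_0; lra).
  assert (Sg : 0 <= sin g) by (apply sin_ge_0; lra).
  assert (Sgf : sin g <= sin f) by (apply sin_incr_1; lra).
  assert (D : 0 <= sin (f - g)) by (apply sin_ge_0; lra). rewrite sin_minus in D.
  set (r := sin g / sin f). assert (E : r * sin f = sin g) by (unfold r; field; lra).
  assert (Hr : 0 <= r) by (apply Rmult_le_pos; [auto|left; apply Rinv_0_lt_compat; auto]).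
  assert (Hr1 : r <= 1) by nra.
  apply (polar_cone_raise N _ _ (r * s)); auto; [nra|].
  replace (mk3 (cos g) (sin g) (r * s)) with
    (vadd (vscale r (mk3 (cos f) (sin f) s)) (vscale (cos g - r * cos f) (mk3 1 0 0))).
  - apply polar_cone_add; auto; apply polar_cone_scale; auto.
    apply Rmult_le_reg_r with (sin f); auto. nra.
  - clearbody r. apply vec_ext; vunfold; [ring|rewrite <- E; ring|ring].
Qed.

Lemma tilt_towards_axis' (N : R3 -> Prop) (s f g : R) : polar_cone N -> N (mk3 1 0 0) ->
  f <= g <= PI / 2 -> 0 <= f < PI / 2 -> N (mk3 (sin f) (- cos f) s) -> N (mk3 (sin g) (- cos g) s).
Proof.
  intros HN N1 Hg Hf Hn. pose proof PI_RGT_0.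
  assert (Hs : 0 <= s) by apply (polar_cone_height N _ HN Hn).
  assert (Sf : 0 < cos f) by (apply cos_gt_0; lra).
  assert (Sg : 0 <= cos g) by (apply cos_ge_0; lra).
  assert (Sgf : cos g <= cos f) by (apply cos_decr_1; lra).
  assert (D : 0 <= sin (g - f)) by (apply sin_ge_0; lra). rewrite sin_minus in D.
  set (r := cos g / cos f). assert (E : r * cos f = cos g) by (unfold r; field; lra).
  assert (Hr : 0 <= r) by (apply Rmult_le_pos; [auto|left; apply Rinv_0_lt_compat; auto]).
  assert (Hr1 : r <= 1) by nra.
  apply (polar_cone_raise N _ _ (r * s)); auto; [nra|].
  replace (mk3 (sin g) (- cos g) (r * s)) with
    (vadd (vscale r (mk3 (sin f) (- cos f) s)) (vscale (sin g - r * sin f) (mk3 1 0 0))).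
  - apply polar_cone_add; auto; apply polar_cone_scale; auto.
    apply Rmult_le_reg_r with (cos f); auto. nra.
  - clearbody r. apply vec_ext; vunfold; [ring|rewrite <- E; ring|ring].
Qed.

(** Tilting both vectors towards the first axis gives lifts of fixed heights over (cos b, sin b) and
    (sin b, - cos b) for every b between f and g, so [two_directions] has a uniform gain there. *)
Lemma overlap_strict (N : R3 -> Prop) (I f g s t : R) : polar_cone N -> sandwich (pole_fun N) I ->
  in_dual N (mk3 1 0 0) -> 0 <= f -> f < g -> g <= PI / 2 ->
  N (mk3 (sin f) (- cos f) t) -> N (mk3 (cos g) (sin g) s) -> PI / 4 < I.
Proof.
  intros HN HI H1 Hf Hfg Hg Kf Mg. pose proof PI_RGT_0.
  pose proof (proj2 (proj2 HN) _ H1) as N1.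
  assert (Hs : 0 <= s) by apply (polar_cone_height N _ HN Mg).
  assert (Ht : 0 <= t) by apply (polar_cone_height N _ HN Kf).
  assert (Ps : 0 < / (1 + s * s)) by (apply Rinv_0_lt_compat; nra).
  assert (Pt : 0 < / (1 + t * t)) by (apply Rinv_0_lt_compat; nra).
  apply (sandwich_gt_quarter_PI N I (3 / 4 * (/ (1 + s * s) * / (1 + t * t))) f g); auto.
  { apply Rmult_lt_0_compat; [lra|apply Rmult_lt_0_compat; auto]. }
  intros F b HF Hb. destruct (quarter_slope_bounds N F b HN HF) as (A & B & C & D).
  assert (Nb : N (mk3 (cos b) (sin b) s)) by (apply (tilt_towards_axis N s g b); auto; lra).
  assert (Nb' : N (mk3 (sin b) (- cos b) t)) by (apply (tilt_towards_axis' N t f b); auto; lra).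
  assert (0 < cos b) by (apply cos_gt_0; lra). assert (0 < sin b) by (apply sin_gt_0; lra).
  pose proof (two_directions N (cos b) (sin b) _ _ s t HN H1 ltac:(auto) ltac:(auto) (cos_sin_unit b) A D Hs Ht Nb Nb').
  pose proof (proj1 B). pose proof (proj1 C). unfold quarter_sum. lra.
Qed.

Lemma flat_direction (N : R3 -> Prop) (p q : R) : polar_cone N ->
  (forall s, 0 < s -> N (mk3 p q s)) -> N (mk3 p q 0).
Proof.
  intros HN H. apply (closed_of_perturb N _ axis3); [apply HN|]. intros t Ht.
  replace (vadd (mk3 p q 0) (vscale t axis3)) with (mk3 p q t) by (unfold axis3; apply vec_ext; vunfold; ring).
  auto.
Qed.

Lemma polar_coordinates (X Y : R) : 0 <= X -> 0 <= Y -> 0 < X + Y ->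
  exists r f, 0 < r /\ 0 <= f <= PI / 2 /\ X = r * cos f /\ Y = r * sin f.
Proof.
  intros HX HY HXY. pose proof PI_RGT_0. set (r := sqrt (X * X + Y * Y)).
  pose proof (Rmult_lt_0_compat _ _ HXY HXY). pose proof (Rle_0_sqr (X - Y)) as Hsq. unfold Rsqr in Hsq.
  assert (Hp : 0 < X * X + Y * Y) by lra.
  assert (Hr : 0 < r) by (apply sqrt_lt_R0; auto).
  assert (Hrr : r * r = X * X + Y * Y) by (apply sqrt_sqrt; lra).
  clearbody r.
  assert (E : X / r * (X / r) + Y / r * (Y / r) = 1).
  { replace (X / r * (X / r) + Y / r * (Y / r)) with ((X * X + Y * Y) / (r * r)) by (field; lra).
    rewrite Hrr. field. lra. }
  assert (Hx : 0 <= X / r) by (apply Rmult_le_pos; [auto|left; apply Rinv_0_lt_compat; auto]).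
  assert (Hy : 0 <= Y / r) by (apply Rmult_le_pos; [auto|left; apply Rinv_0_lt_compat; auto]).
  assert (Hb : -1 <= X / r <= 1) by nra.
  assert (C : cos (acos (X / r)) = X / r) by (apply cos_acos; auto).
  assert (S : sin (acos (X / r)) = Y / r).
  { rewrite sin_acos by auto. replace (1 - (X / r)²) with ((Y / r)²) by (unfold Rsqr; lra).
    apply sqrt_Rsqr; auto. }
  exists r, (acos (X / r)). rewrite C, S. pose proof (acos_bound (X / r)).
  repeat split; auto; try (field; lra); try lra.
  apply Rnot_lt_le. intro Hl. assert (cos (acos (X / r)) < 0) by (apply cos_lt_0; lra). lra.
Qed.

Lemma angle_lt (f g : R) : 0 <= f <= PI / 2 -> 0 <= g <= PI / 2 ->
  0 < sin g * cos f - cos g * sin f -> f < g.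
Proof.
  intros Hf Hg H. rewrite <- sin_minus in H. apply Rnot_le_lt. intro Hle. pose proof PI_RGT_0.
  assert (0 <= sin (f - g)) by (apply sin_ge_0; lra).
  rewrite <- (Ropp_minus_distr f g), sin_neg in H. lra.
Qed.

Lemma equality_orthant (N : R3 -> Prop) (I : R) : polar_cone N -> sandwich (pole_fun N) I ->
  in_dual N (mk3 1 0 0) -> I <= PI / 4 ->
  exists p q, p * p + q * q = 1 /\ forall x, N x <-> orthant (mk3 q (- p) 0) (mk3 p q 0) axis3 x.
Proof.
  intros HN HI H1 Hle. pose proof PI_RGT_0.
  pose proof (proj2 (proj2 HN) _ H1) as N1. pose proof (polar_cone_axis N HN) as N3.
  assert (no_overlap : forall f g s t, 0 <= f -> f < g -> g <= PI / 2 ->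
     N (mk3 (sin f) (- cos f) t) -> N (mk3 (cos g) (sin g) s) -> False).
  { intros f g s t F1 F2 F3 F4 F5.
    pose proof (overlap_strict N I f g s t HN HI H1 F1 F2 F3 F4 F5). lra. }
  (* [N] contains the horizontal directions of angle in [(fs - PI / 2, fs)] and lies above no others. *)
  destruct (completeness (fun f => f = 0 \/ (0 < f <= PI / 2 /\ exists s, N (mk3 (cos f) (sin f) s))))
    as [fs [Hub Hlub]].
  { exists (PI / 2). intros f [->|[Hf _]]; lra. }
  (* The angle 0 is put into the set by hand so that the supremum exists even when no positive angle
     has a lift. *)
  { exists 0; auto. }
  assert (F0 : 0 <= fs) by (apply Hub; auto).
  assert (F1 : fs <= PI / 2) by (apply Hlub; intros f [->|[Hf _]]; lra).
  assert (above : forall f s, fs < f <= PI / 2 -> ~ N (mk3 (cos f) (sin f) s)).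
  { intros f s Hf Hn. assert (f <= fs); [|lra]. apply Hub. right. split; [lra|]. exists s; auto. }
  assert (below : forall f t, 0 <= f < fs -> ~ N (mk3 (sin f) (- cos f) t)).
  { intros f t Hf Hn. assert (fs <= f); [|lra]. apply Hlub. intros g [->|[Hg [s Hs]]]; [lra|].
    apply Rnot_lt_le. intro Hfg. apply (no_overlap f g s t); auto; lra. }
  (* A missing point at height s over (cos f, sin f), together with the one missing at height 1/s
     over (sin f, - cos f), would give slopes of product 1, against the bound 1/2. *)
  assert (flat_below : forall f, 0 < f < fs -> N (mk3 (cos f) (sin f) 0)).
  { intros f Hf. apply flat_direction; auto. intros s Hs. apply NNPP. intro Hn.
    assert (0 < cos f) by (apply cos_gt_0; lra). assert (0 < sin f) by (apply sin_gt_0; lra).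
    pose proof (facing_normals N (cos f) (sin f) s (/ s) HN H1 ltac:(auto) ltac:(auto) (cos_sin_unit f) Hs
      (Rinv_0_lt_compat s Hs) Hn (below f (/ s) ltac:(lra))) as K.
    rewrite Rinv_r in K; lra. }
  assert (flat_above : forall f, fs < f < PI / 2 -> N (mk3 (sin f) (- cos f) 0)).
  { intros f Hf. apply flat_direction; auto. intros t Ht. apply NNPP. intro Hn.
    assert (0 < cos f) by (apply cos_gt_0; lra). assert (0 < sin f) by (apply sin_gt_0; lra).
    pose proof (facing_normals N (cos f) (sin f) (/ t) t HN H1 ltac:(auto) ltac:(auto) (cos_sin_unit f)
      (Rinv_0_lt_compat t Ht) Ht (above f (/ t) ltac:(lra)) Hn) as K.
    rewrite Rinv_l in K; lra. }
  set (p := cos fs). set (q := sin fs).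
  assert (Hpq : p * p + q * q = 1) by apply cos_sin_unit.
  assert (Hp : 0 <= p) by (apply cos_ge_0; lra).
  assert (Hq : 0 <= q) by (apply sin_ge_0; lra).
  (* The edge is approached from within: adding t (1, 0, 0) turns the direction to an angle strictly
     between 0 and fs, where [flat_below] applies. *)
  assert (E1 : N (mk3 p q 0)).
  { destruct (Req_dec fs 0) as [Z|Z].
    - unfold p, q. rewrite Z, cos_0, sin_0. auto.
    - assert (0 < q) by (apply sin_gt_0; lra).
      apply (closed_of_perturb N _ (mk3 1 0 0)); [apply HN|]. intros t Ht.
      destruct (polar_coordinates (p + t) q) as (r & f & Hr & Hf & X & Y); [lra|lra|lra|].
      assert (f < fs).
      { apply angle_lt; try lra. fold p q. apply Rmult_lt_reg_l with r; auto.
        replace (r * (q * cos f - p * sin f)) with (q * (r * cos f) - p * (r * sin f)) by ring.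
        rewrite <- X, <- Y. nra. }
      assert (0 < f).
      { destruct Hf as [[Hf|Hf] _]; auto. exfalso. subst f. rewrite sin_0 in Y. lra. }
      replace (vadd (mk3 p q 0) (vscale t (mk3 1 0 0))) with (vscale r (mk3 (cos f) (sin f) 0)).
      + apply polar_cone_scale; auto; lra.
      + apply vec_ext; vunfold; lra. }
  assert (E2 : N (mk3 q (- p) 0)).
  { destruct (Req_dec fs (PI / 2)) as [Z|Z].
    - unfold p, q. rewrite Z, cos_PI2, sin_PI2, Ropp_0. auto.
    - assert (0 < p) by (apply cos_gt_0; lra).
      apply (closed_of_perturb N _ (mk3 1 0 0)); [apply HN|]. intros t Ht.
      destruct (polar_coordinates p (q + t)) as (r & f & Hr & Hf & X & Y); [lra|lra|lra|].
      assert (fs < f).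
      { apply angle_lt; try lra. fold p q. apply Rmult_lt_reg_l with r; auto.
        replace (r * (sin f * p - cos f * q)) with (r * sin f * p - r * cos f * q) by ring.
        rewrite <- X, <- Y. nra. }
      assert (f < PI / 2).
      { destruct Hf as [_ [Hf|Hf]]; auto. exfalso. subst f. rewrite cos_PI2 in X. lra. }
      replace (vadd (mk3 q (- p) 0) (vscale t (mk3 1 0 0))) with (vscale r (mk3 (sin f) (- cos f) 0)).
      + apply polar_cone_scale; auto; lra.
      + apply vec_ext; vunfold; lra. }
  exists p, q. split; auto. intro x. split.
  - intros Hx. exists (v1 x * q - v2 x * p), (v1 x * p + v2 x * q), (v3 x).
    assert (X1 : 0 <= v1 x). { specialize (H1 x Hx). vdestr. vunfold. lra. }
    pose proof (polar_cone_height N x HN Hx) as X3.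
    repeat split; auto.
    (* A negative coefficient along (q, -p) would place the horizontal part of x at an angle beyond
       fs, against [above]. *)
    + apply Rnot_lt_le. intro Hlt.
      assert (0 < v2 x) by nra.
      destruct (polar_coordinates (v1 x) (v2 x)) as (r & f & Hr & Hf & X & Y); [lra|lra|lra|].
      assert (fs < f).
      { apply angle_lt; try lra. fold p q. apply Rmult_lt_reg_l with r; auto.
        replace (r * (sin f * p - cos f * q)) with (r * sin f * p - r * cos f * q) by ring.
        rewrite <- X, <- Y. lra. }
      apply (above f (v3 x / r)); [lra|].
      replace (mk3 (cos f) (sin f) (v3 x / r)) with (vscale (/ r) x).
      * apply polar_cone_scale; auto. left. apply Rinv_0_lt_compat; auto.
      * apply vec_ext;
          [change (/ r * v1 x = cos f); rewrite X|change (/ r * v2 x = sin f); rewrite Y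
          |change (/ r * v3 x = v3 x / r)]; field; lra.
    (* A negative coefficient along (p, q) would make the horizontal part of x a multiple of (sin f,
       - cos f) with f < fs, against [below]. *)
    + apply Rnot_lt_le. intro Hlt.
      assert (0 < - v2 x) by nra.
      destruct (polar_coordinates (- v2 x) (v1 x)) as (r & f & Hr & Hf & X & Y); [lra|lra|lra|].
      assert (f < fs).
      { apply angle_lt; try lra. fold p q. apply Rmult_lt_reg_l with r; auto.
        replace (r * (q * cos f - p * sin f)) with (r * cos f * q - r * sin f * p) by ring.
        rewrite <- X, <- Y. lra. }
      apply (below f (v3 x / r)); [lra|].
      replace (mk3 (sin f) (- cos f) (v3 x / r)) with (vscale (/ r) x).
      * apply polar_cone_scale; auto. left. apply Rinv_0_lt_compat; auto.
      * assert (Y2 : v2 x = - (r * cos f)) by lra.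
        apply vec_ext;
          [change (/ r * v1 x = sin f); rewrite Y|change (/ r * v2 x = - cos f); rewrite Y2
          |change (/ r * v3 x = v3 x / r)]; field; lra.
    + assert (A1 : v1 x = (v1 x * q - v2 x * p) * q + (v1 x * p + v2 x * q) * p).
      { replace (v1 x) with (v1 x * (p * p + q * q)) at 1 by (rewrite Hpq; ring). ring. }
      assert (A2 : v2 x = (v1 x * q - v2 x * p) * - p + (v1 x * p + v2 x * q) * q).
      { replace (v2 x) with (v2 x * (p * p + q * q)) at 1 by (rewrite Hpq; ring). ring. }
      unfold axis3. apply vec_ext; vunfold; lra.
  - intros (a & b & c & Ha & Hb & Hc & ->).
    apply polar_cone_add; auto; [apply polar_cone_add; auto|]; apply polar_cone_scale; auto.
Qed.

(** * The value at the octant *)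

Definition octant (x : R3) : Prop := 0 <= v1 x /\ 0 <= v2 x /\ 0 <= v3 x.

(** Longitudes in the first quarter contribute at most 1/2 each, the others at most 0. The opposite
    estimate is supplied by the general lower bound. *)
Lemma lower_test_octant (F : R3 -> R) : test F ->
  (forall x, on_sphere x -> F x <= pole_fun octant x) -> J F <= PI / 4.
Proof.
  intros TF HF. pose proof PI_RGT_0. pose proof (test_sph_cont F TF) as CF.
  assert (Cg : forall b, cts1 (fun a => F (sph a b) * sin a)).
  { intro b. apply (cts2_slice (fun b a => F (sph a b) * sin a)), sph_cont_integrand; auto. }
  assert (dot3 : forall a b, dot (sph a b) axis3 = cos a) by (intros; unfold sph, axis3; vunfold; ring).
  assert (in_bound : forall b, RInt (fun a => F (sph a b) * sin a) 0 PI <= 1 / 2).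
  { intro b. rewrite (RInt_Chasles_cts1 _ 0 (PI / 2) PI) by auto.
    assert (A : RInt (fun a => F (sph a b) * sin a) 0 (PI / 2) <= RInt (fun a => cos a * sin a) 0 (PI / 2)).
    { apply RInt_le_cts1; auto; [lra|apply cts1_mult; [apply cts1_cos|apply cts1_sin]|].
      intros a Ha. apply Rmult_le_compat_r; [apply sin_ge_0; lra|].
      eapply Rle_trans; [apply HF, sph_on_sphere|]. unfold pole_fun.
      destruct (classic (octant (sph a b))).
      - rewrite indicator_mul_in, dot3 by auto. lra.
      - rewrite indicator_mul_out by auto. apply cos_ge_0; lra. }
    rewrite RInt_sin_cos, sin_PI2 in A.
    assert (B : RInt (fun a => F (sph a b) * sin a) (PI / 2) PI <= 0 * (PI - PI / 2)).
    { apply RInt_le_const_cts1; auto; [lra|]. intros a Ha.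
      assert (F (sph a b) <= 0).
      { eapply Rle_trans; [apply HF, sph_on_sphere|]. unfold pole_fun.
        rewrite indicator_mul_out; [lra|]. intros (_ & _ & Hc).
        change (v3 (sph a b)) with (cos a) in Hc. assert (cos a < 0) by (apply cos_lt_0; lra). lra. }
      assert (0 <= sin a) by (apply sin_ge_0; lra). nra. }
    lra. }
  assert (out_bound : forall b, PI / 2 < b < 2 * PI -> RInt (fun a => F (sph a b) * sin a) 0 PI <= 0).
  { intros b Hb. replace 0 with (0 * (PI - 0)) at 2 by ring.
    apply RInt_le_const_cts1; auto; [lra|]. intros a Ha.
    assert (Hs : 0 < sin a) by (apply sin_gt_0; lra).
    assert (F (sph a b) <= 0).
    { eapply Rle_trans; [apply HF, sph_on_sphere|]. unfold pole_fun.
      rewrite indicator_mul_out; [lra|]. intros (Hx & Hy & _).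
      change (v1 (sph a b)) with (sin a * cos b) in Hx. change (v2 (sph a b)) with (sin a * sin b) in Hy.
      destruct (Rle_lt_dec b PI).
      - assert (cos b < 0) by (apply cos_lt_0; lra). nra.
      - assert (sin b < 0) by (apply sin_lt_0; lra). nra. }
    nra. }
  unfold J. rewrite (RInt_Chasles_cts1 _ 0 (PI / 2) (2 * PI)) by (apply sph_cont_inner; auto).
  assert (A : RInt (fun b => RInt (fun a => F (sph a b) * sin a) 0 PI) 0 (PI / 2) <= 1 / 2 * (PI / 2 - 0)).
  { apply RInt_le_const_cts1; [lra|apply sph_cont_inner; auto|auto]. }
  assert (B : RInt (fun b => RInt (fun a => F (sph a b) * sin a) 0 PI) (PI / 2) (2 * PI) <= 0 * (2 * PI - PI / 2)).
  { apply RInt_le_const_cts1; [lra|apply sph_cont_inner; auto|auto]. }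
  lra.
Qed.

Lemma sandwich_octant_le (I : R) : sandwich (pole_fun octant) I -> I <= PI / 4.
Proof.
  intros H. apply Rnot_lt_le. intro Hlt.
  destruct (H (I - PI / 4)) as (F & F' & T & _ & B & C & _); [lra|].
  assert (J F <= PI / 4); [|lra]. apply lower_test_octant; auto. intros x Hx. apply B; auto.
Qed.

(** * From sectors to cones, and the theorem *)

Lemma normalise_on_sphere (x : R3) : x <> mk3 0 0 0 ->
  0 < nrm x /\ on_sphere (vscale (/ nrm x) x) /\ vscale (nrm x) (vscale (/ nrm x) x) = x.
Proof.
  intros Hx. assert (Hn : 0 < nrm x).
  { destruct (nrm_nonneg x) as [H|H]; auto. exfalso. apply Hx, dot_self_eq0.
    rewrite <- nrm_sqr, <- H. ring. }
  split; auto. split.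
  - unfold on_sphere. rewrite dot_vscale_l, dot_vscale_r, <- nrm_sqr. field. lra.
  - apply vec_ext; destruct x as [[? ?] ?]; vunfold; field; lra.
Qed.

(** Normalising vectors translates duality and the inclusion of the dual from the sector to the
    cone. The interior ball then makes the integral exist, so [Phi] gets its actual value: 2 / (4
    pi) times I. *)
Lemma classC_cone (S : R3 -> Prop) (u : R3) : classC S -> dual S u ->
  exists N I, closed_convex_cone N /\ (forall x, S x <-> N x /\ on_sphere x) /\ in_dual N u /\
    (forall y, in_dual N y -> N y) /\ sandwich (indicator_mul N (fun x => dot x u)) I /\
    Phi S u = I / (2 * PI).
Proof.
  intros [[N [HN HS]] HC] Hu. pose proof PI_RGT_0. pose proof HN as [_ [_ Hsc]].
  assert (Nu : N u) by (apply HS, HC, Hu).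
  assert (dual_cone : forall y, dual S y -> in_dual N y).
  { intros y [_ Hy] x Hx. destruct (classic (x = mk3 0 0 0)) as [->|Hx0].
    - right. vring.
    - destruct (normalise_on_sphere x Hx0) as (A & B & C). rewrite <- C, dot_vscale_r.
      apply Rmult_le_pos; [lra|]. apply Hy, HS. split; auto.
      apply Hsc; auto. left. apply Rinv_0_lt_compat; auto. }
  assert (self : forall y, in_dual N y -> N y).
  { intros y Hy. destruct (classic (y = mk3 0 0 0)) as [->|Hy0].
    - apply (closed_cone_0 N u); auto.
    - destruct (normalise_on_sphere y Hy0) as (A & B & C). rewrite <- C.
      apply Hsc; [lra|]. apply HS, HC. split; auto. intros x Hx. rewrite dot_vscale_l.
      apply Rmult_le_pos; [left; apply Rinv_0_lt_compat; auto|]. apply Hy. apply HS in Hx. apply Hx. }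
  destruct (self_dual_ball N HN self) as (w & c & Hc & Hw & Hball).
  destruct (cone_sandwich N u w c HN Hc Hw Hball (proj1 Hu) (dual_cone u Hu)) as [I HI].
  exists N, I. repeat split; try apply HN; try apply HS; auto; try (apply HS; auto).
  unfold Phi, omega3. rewrite (sandwich_sphere_integral _ I).
  - field. lra.
  - apply sandwich_ext with (2 := HI). intros x Hx. unfold indicator_mul.
    specialize (HS x). repeat destruct excluded_middle_informative; tauto.
Qed.

Lemma polar_preimage (N : R3 -> Prop) (e : frame) (I : R) : closed_convex_cone N -> is_frame e ->
  in_dual N (snd e) -> (forall y, in_dual N y -> N y) ->
  sandwich (indicator_mul N (fun x => dot x (snd e))) I ->
  polar_cone (cone_preimage e N) /\ sandwich (pole_fun (cone_preimage e N)) I.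
Proof.
  intros HN He Hu Hself HI.
  assert (e3 : fmap e axis3 = snd e).
  { destruct e as [[e1 e2] e3]. unfold fmap, axis3; simpl. veq. }
  split; [split; [|split]|].
  - apply cone_preimage_closed; auto.
  - apply cone_preimage_dual; auto. rewrite e3; auto.
  - intros y Hy. apply Hself. apply (cone_preimage_dual e N y He). auto.
  - apply (sandwich_fmap e) in HI; auto. apply sandwich_ext with (2 := HI).
    intros x _. unfold pole_fun, indicator_mul, cone_preimage.
    destruct excluded_middle_informative; auto. rewrite <- e3. apply dot_fmap; auto.
Qed.

Lemma orthant_fmap (e : frame) (a b c x : R3) : is_frame e ->
  orthant a b c (finv e x) <-> orthant (fmap e a) (fmap e b) (fmap e c) x.
Proof.
  intros He. split; intros (r & s & t & Hr & Hs & Ht & E); exists r, s, t; repeat split; auto.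
  - rewrite <- (fmap_finv e x He), E, !fmap_vadd, !fmap_vscale. auto.
  - rewrite E, <- !fmap_vscale, <- !fmap_vadd, finv_fmap; auto.
Qed.

Lemma orthant_frame_octant (e : frame) (x : R3) : is_frame e ->
  orthant (fst (fst e)) (snd (fst e)) (snd e) (fmap e x) <-> octant x.
Proof.
  intros He. split.
  - intros (a & b & c & Ha & Hb & Hc & E). change (fmap e x = fmap e (mk3 a b c)) in E.
    apply (f_equal (finv e)) in E. rewrite !finv_fmap in E by auto. subst x. repeat split; auto.
  - intros (A & B & C). exists (v1 x), (v2 x), (v3 x). repeat split; auto.
Qed.

Lemma classC_lower_bound (S : R3 -> Prop) (u : R3) : classC S -> dual S u -> 1 / 8 <= Phi S u.
Proof.
  intros HC Hu. pose proof PI_RGT_0.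
  destruct (classC_cone S u HC Hu) as (N & I & HN & HS & Hd & Hself & HI & ->).
  destruct (frame_with_pole u (proj1 Hu)) as (e & He & <-).
  destruct (polar_preimage N e I HN He Hd Hself HI) as [HP HI'].
  pose proof (sandwich_ge_quarter_PI _ _ HP HI').
  apply (proj1 (Rle_div_r (1 / 8) I (2 * PI) two_PI_pos)). lra.
Qed.

(** In the coordinates of its own frame the orthant is the octant with pole e3; the octant gives the
    upper estimate and [classC_lower_bound] the lower one. *)
Lemma Phi_orthant (S : R3 -> Prop) (e1 e2 e3 : R3) : classC S -> dual S e3 ->
  rotation_frame e1 e2 e3 -> (forall x, S x <-> splus_orthant e1 e2 e3 x) -> Phi S e3 = 1 / 8.
Proof.
  intros HC Hu He HO. pose proof PI_RGT_0.
  pose proof (classC_lower_bound S e3 HC Hu) as Hlow.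
  destruct (classC_cone S e3 HC Hu) as (N & I & HN & HS & Hd & Hself & HI & E).
  destruct (polar_preimage N (e1, e2, e3) I HN He Hd Hself HI) as [HP HI'].
  assert (HI0 : sandwich (pole_fun octant) I).
  { apply sandwich_ext with (2 := HI'). intros x Hx.
    assert (K : cone_preimage (e1, e2, e3) N x <-> octant x).
    { pose proof (fmap_sphere (e1, e2, e3) x He Hx) as Hy.
      pose proof (orthant_frame_octant (e1, e2, e3) x He) as O. simpl in O.
      specialize (HS (fmap (e1, e2, e3) x)). specialize (HO (fmap (e1, e2, e3) x)).
      unfold cone_preimage, splus_orthant in *. tauto. }
    unfold pole_fun, indicator_mul. repeat destruct excluded_middle_informative; tauto. }
  apply sandwich_octant_le in HI0. rewrite E in *.
  apply Rle_antisym; auto. apply (proj2 (Rle_div_l I (1 / 8) (2 * PI) two_PI_pos)). lra.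
Qed.

(** Cyclic permutations of a frame preserve its orientation, so any of the three extreme points can
    be moved to the last position, the one treated in [Phi_orthant]. *)
Lemma splus_orthant_rotate (e1 e2 e3 x : R3) : splus_orthant e1 e2 e3 x <-> splus_orthant e2 e3 e1 x.
Proof.
  unfold splus_orthant, orthant. split; intros [(a & b & c & Ha & Hb & Hc & E) Hx]; split; auto.
  - exists b, c, a. repeat split; auto. rewrite E. veq.
  - exists c, a, b. repeat split; auto. rewrite E. veq.
Qed.

Lemma rotation_frame_rotate (e1 e2 e3 : R3) : rotation_frame e1 e2 e3 -> rotation_frame e2 e3 e1.
Proof.
  intros (A & B & C & D & E & F & G). unfold rotation_frame.
  rewrite (dot_comm e2 e1), (dot_comm e3 e1). repeat split; auto.
  rewrite <- G. vring.
Qed.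

Lemma Phi_equality_orthant (S : R3 -> Prop) (u : R3) : classC S -> dual S u -> Phi S u = 1 / 8 ->
  exists e1 e2, rotation_frame e1 e2 u /\ forall x, S x <-> splus_orthant e1 e2 u x.
Proof.
  intros HC Hu HPhi. pose proof PI_RGT_0.
  destruct (classC_cone S u HC Hu) as (N & I & HN & HS & Hd & Hself & HI & E).
  assert (HIle : I = PI / 4).
  { rewrite E in HPhi. replace I with (I / (2 * PI) * (2 * PI)) by (field; lra). rewrite HPhi. field. }
  destruct (frame_with_pole u (proj1 Hu)) as (e & He & Heu). subst u.
  destruct (polar_preimage N e I HN He Hd Hself HI) as [HP HI'].
  destruct (horizontal_normal_or_bounded _ HP) as [(a & b & Hab & Hn)|(M & HM & HMb)].
  2:{ pose proof (bounded_strict _ _ _ HP HI' HM HMb). lra. }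
  assert (e3 : fmap e axis3 = snd e).
  { destruct e as [[e1 e2] e3]. unfold fmap, axis3; simpl. veq. }
  assert (Fab : rotation_frame (mk3 a b 0) (mk3 (- b) a 0) axis3).
  { unfold rotation_frame, axis3. vunfold. repeat split; lra. }
  (* The frame is turned about [u] so that the horizontal normal becomes the first axis, as
     [equality_orthant] requires. *)
  set (g := (fmap e (mk3 a b 0), fmap e (mk3 (- b) a 0), snd e)).
  assert (Hg : is_frame g).
  { unfold is_frame, g; simpl. rewrite <- e3. apply frame_fmap; auto. }
  destruct (polar_preimage N g I HN Hg Hd Hself HI) as [HPg HIg].
  assert (H1 : in_dual (cone_preimage g N) (mk3 1 0 0)).
  { apply cone_preimage_dual; auto. replace (fmap g (mk3 1 0 0)) with (fmap e (mk3 a b 0)).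
    - apply cone_preimage_dual; auto.
    - unfold g, fmap at 2; simpl. generalize (fmap e (mk3 a b 0)) (fmap e (mk3 (- b) a 0)) (snd e). intros; veq. }
  destruct (equality_orthant _ I HPg HIg H1) as (p & q & Hpq & HO); [lra|].
  assert (g3 : fmap g axis3 = snd e).
  { unfold g, fmap, axis3; simpl. generalize (snd e). intros; destruct e as [[? ?] ?]; veq. }
  exists (fmap g (mk3 q (- p) 0)), (fmap g (mk3 p q 0)). rewrite <- g3. split.
  - apply frame_fmap; auto. unfold rotation_frame, axis3. vunfold. repeat split; lra.
  - intro x. unfold splus_orthant. rewrite <- orthant_fmap, <- HO by auto.
    unfold cone_preimage. rewrite fmap_finv by auto. apply HS.
Qed.

Lemma orthant_standard (x : R3) : orthant (mk3 1 0 0) (mk3 0 1 0) (mk3 0 0 1) x <-> octant x.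
Proof.
  split.
  - intros (a & b & c & Ha & Hb & Hc & ->). unfold octant. vunfold. lra.
  - intros (A & B & C). exists (v1 x), (v2 x), (v3 x). repeat split; auto. veq.
Qed.

Lemma closed_convex_cone_octant : closed_convex_cone octant.
Proof.
  assert (lim : forall (s : nat -> R) l, (forall n, 0 <= s n) -> Un_cv s l -> 0 <= l).
  { intros s l Hs Hl. apply is_lim_seq_Reals in Hl.
    apply (is_lim_seq_le (fun _ => 0) s 0 l Hs (is_lim_seq_const 0) Hl). }
  split; [|split].
  - intros s x Hs (A & B & C). repeat split.
    + apply (lim (fun n => v1 (s n))); auto. intro n; apply Hs.
    + apply (lim (fun n => v2 (s n))); auto. intro n; apply Hs.
    + apply (lim (fun n => v3 (s n))); auto. intro n; apply Hs.
  - intros x y (A & B & C) (A' & B' & C'). unfold octant. vdestr; vunfold. lra.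
  - intros c x Hc (A & B & C). unfold octant. vdestr; vunfold. nra.
Qed.

Lemma classC_splus_orthant_standard :
  classC (splus_orthant (mk3 1 0 0) (mk3 0 1 0) (mk3 0 0 1)) /\
  dual (splus_orthant (mk3 1 0 0) (mk3 0 1 0) (mk3 0 0 1)) (mk3 0 0 1).
Proof.
  assert (S1 : on_sphere (mk3 1 0 0)) by (unfold on_sphere; vunfold; ring).
  assert (S2 : on_sphere (mk3 0 1 0)) by (unfold on_sphere; vunfold; ring).
  assert (S3 : on_sphere (mk3 0 0 1)) by (unfold on_sphere; vunfold; ring).
  split; [split|].
  - exists octant. split; [apply closed_convex_cone_octant|].
    intro x. unfold splus_orthant. rewrite orthant_standard. tauto.
  - intros y [Hy H]. split; auto. apply orthant_standard.
    assert (T : forall x, octant x -> on_sphere x -> 0 <= dot y x).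
    { intros x Hx Hs. apply H. split; auto. apply orthant_standard; auto. }
    pose proof (T (mk3 1 0 0)) as T1. pose proof (T (mk3 0 1 0)) as T2. pose proof (T (mk3 0 0 1)) as T3.
    unfold octant in *. clear T H Hy. vdestr; vunfold.
    specialize (T1 ltac:(lra) S1). specialize (T2 ltac:(lra) S2). specialize (T3 ltac:(lra) S3). lra.
  - split; auto. intros x [Hx _]. apply orthant_standard in Hx. destruct Hx as (_ & _ & Hx).
    vdestr; vunfold. lra.
Qed.

Theorem theorem4p2 :
  (* the minimum over S in C, u in S^* is 1/8 : lower bound ... *)
  (forall (S : R3 -> Prop) (u : R3), classC S -> dual S u -> 1 / 8 <= Phi S u) /\
  (* ... attained ... *)
  (exists (S : R3 -> Prop) (u : R3), classC S /\ dual S u /\ Phi S u = 1 / 8) /\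
  (* ... exactly at S^+-orthants and their extreme points *)
  (forall (S : R3 -> Prop) (u : R3), classC S -> dual S u ->
     (Phi S u = 1 / 8 <->
      exists e1 e2 e3 : R3, rotation_frame e1 e2 e3 /\
        (forall x, S x <-> splus_orthant e1 e2 e3 x) /\
        (u = e1 \/ u = e2 \/ u = e3))).
Proof.
  split; [exact classC_lower_bound|split].
  - destruct classC_splus_orthant_standard as [HC Hd].
    eexists; eexists; split; [exact HC|split; [exact Hd|]].
    apply (Phi_orthant _ _ _ _ HC Hd frame_standard). intro x; tauto.
  - intros S u HC Hu. split.
    + intros HPhi. destruct (Phi_equality_orthant S u HC Hu HPhi) as (e1 & e2 & He & HS).
      exists e1, e2, u. auto.
    + intros (e1 & e2 & e3 & He & HS & [-> | [-> | ->]]).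
      * apply (Phi_orthant S e2 e3 e1); auto; [apply rotation_frame_rotate; auto|].
        intro x. rewrite HS. apply splus_orthant_rotate.
      * apply (Phi_orthant S e3 e1 e2); auto; [do 2 apply rotation_frame_rotate; auto|].
        intro x. rewrite HS, splus_orthant_rotate. apply splus_orthant_rotate.
      * apply (Phi_orthant S e1 e2 e3); auto.
Qed.
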